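(* Let $\theta_1 \in (0,\pi/2]$, $\theta_2 \in [0,\pi/2]$, $p \in\mathcal{C}^2([0,1])$ with $p > 0$, and $\tilde{q} \in\mathcal{C}^0([0,1])$. Let $q \in\mathcal{C}^0([0,1])$ and $q_c \in\mathbb{R}$ be such that $\tilde q(x) = q(x) - q_c$ and $q(x)>0$ for all $x\in[0,1]$. Let $\delta > 0$ and $N_0 \geq 1$ be such that $-\lambda_n + q_c < - \delta$ for all $n \geq N_0 + 1$. Let $K\in\mathbb{R}^{1 \times N_0}$ and $L\in\mathbb{R}^{N_0}$ be such that $A_0 + \mathfrak{B}_0 K$ and $A_0 - L C_0$ are Hurwitz with eigenvalues that have a real part strictly less than $-\delta<0$. For a given $N \geq N_0 +1$, assume that there exist a symmetric matrix $P\in\mathbb{R}^{2N\times 2N}$ with $P \succ 0$, $\alpha>1$, and $\beta,\gamma > 0$ such that $$\Theta_1 \preceq 0 ,\qquad \Theta_2 \leq 0 \qquad (\ast)$$ where $$\Theta_1 = \begin{bmatrix} F^\top P + P F + 2 \delta P + \alpha\gamma \Vert \mathcal{R}_N a \Vert_{L^2}^2 \tilde{K}^\top \tilde{K} & P\mathcal{L} \\ \mathcal{L}^\top P & - \beta \end{bmatrix} + \alpha\gamma \Vert \mathcal{R}_N b \Vert_{L^2}^2 E^\top E ,$$ $$\Theta_2 = 2\gamma\left\{ - \left( 1 - \frac{1}{\alpha} \right) \lambda_{N+1}+q_c + \delta \right\} + \beta M_\phi ,\qquad M_\phi = \sum_{n \geq N+1} \frac{\vert \phi_n(0) \vert^2}{\lambda_n}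 < +\infty .$$ Then there exists a constant $M > 0$ such that for any initial conditions $z_0 \in H^2(0,1)$ and $\hat{z}_n(0)\in\mathbb{R}$ ($1\le n\le N$) such that $\cos(\theta_1) z_0(0) - \sin(\theta_1) z_0'(0) = 0$ and $\cos(\theta_2) z_0(1) + \sin(\theta_2) z_0'(1) = K \hat{Z}^{N_0}(0)$, where $\hat Z^{N_0}=[\hat z_1,\ldots,\hat z_{N_0}]^\top$, the trajectories of the closed-loop system composed of the plant (P) and the controller (C) described in the context satisfy $$\Vert z(t,\cdot) \Vert_{H^1}^2 + \sum_{n = 1}^{N} \hat{z}_n(t)^2 \leq M e^{-2\delta t} \left( \Vert z_0 \Vert_{H^1}^2 + \sum_{n = 1}^{N} \hat{z}_n(0)^2 \right)$$ for all $t \geq 0$. Moreover, the constraints $(\ast)$ are always feasible (i.e. such $P,\alpha,\beta,\gamma$ exist) for $N$ selected large enough.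
   Context: All functions are real valued. $\langle f,g\rangle=\int_0^1 fg\,dx$ is the inner product of $L^2(0,1)$. For symmetric matrices, $P\succ0$ (resp. $\succeq 0$, $\preceq 0$) means positive definite (resp. positive semi-definite, negative semi-definite). Sturm-Liouville operator: $\mathcal{A}f=-(pf')'+qf$ on $D(\mathcal{A})=\{f\in H^2(0,1): \cos(\theta_1)f(0)-\sin(\theta_1)f'(0)=0,\ \cos(\theta_2)f(1)+\sin(\theta_2)f'(1)=0\}$. Its eigenvalues $\lambda_1<\lambda_2<\cdots$ are simple, positive (as $q>0$) and tend to $+\infty$; $\phi_n$ are associated unit-norm eigenvectors, forming a Hilbert basis of $L^2(0,1)$. For $f\in L^2(0,1)$, $\mathcal{R}_Nf=\sum_{n\ge N+1}\langle f,\phi_n\rangle\phi_n$. Plant (P): for $t>0$, $x\in(0,1)$, $z_t=(p(x)z_x)_x-\tilde q(x)z$, $\ \cos(\theta_1)z(t,0)-\sin(\theta_1)z_x(t,0)=0$, $\ \cos(\theta_2)z(t,1)+\sin(\theta_2)z_x(t,1)=u(t)$, $\ y(t)=z(t,0)$, $\ z(0,x)=z_0(x)$, with input $u$ and measurement $y$. Let $a(x)=\frac{2p(x)+2xp'(x)-x^2\tilde q(x)}{\cos(\theta_2)+2\sin(\theta_2)}$, $b(x)=-\frac{x^2}{\cos(\theta_2)+2\sin(\theta_2)}$, $a_n=\langle a,\phi_n\rangle$, $b_n=\langle b,\phi_n\rangle$, and $\beta_n=a_n+(-\lambda_n+q_c)b_n=p(1)\{-\cos(\theta_2)\phi_n'(1)+\sin(\theta_2)\phi_n(1)\}$.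 Controller (C), with $K=[k_1,\ldots,k_{N_0}]$ and $L=[l_1,\ldots,l_{N_0}]^\top$: $\hat w_n=\hat z_n+b_nu$ for $1\le n\le N$; $\dot{\hat z}_n=(-\lambda_n+q_c)\hat z_n+\beta_nu-l_n\{\sum_{k=1}^N\hat w_k\phi_k(0)-y\}$ for $1\le n\le N_0$; $\dot{\hat z}_n=(-\lambda_n+q_c)\hat z_n+\beta_nu$ for $N_0+1\le n\le N$; $u=\sum_{k=1}^{N_0}k_k\hat z_k$. Trajectories are understood as classical solutions: with $w(t,x)=z(t,x)+b(x)u(t)$ (so that $w_t=(pw_x)_x-\tilde qw+a\,u+b\,\dot u$ with homogeneous boundary conditions, $y(t)=w(t,0)$, and $w(0,\cdot)\in D(\mathcal A)$) and $\hat z=(\hat z_1,\ldots,\hat z_N)$, one has $(w,\hat z)\in\mathcal{C}^0([0,\infty);L^2(0,1)\times\mathbb{R}^N)\cap\mathcal{C}^1((0,\infty);L^2(0,1)\times\mathbb{R}^N)$, $w(t,\cdot)\in D(\mathcal{A})$ for all $t>0$, $\mathcal{A}w\in\mathcal{C}^0((0,\infty);L^2(0,1))$ and $\mathcal{A}^{1/2}w\in\mathcal{C}^0([0,\infty);L^2(0,1))$. Such solutions exist for the initial conditions considered, by standard semigroup theory. Matrices: $A_0=\mathrm{diag}(-\lambda_1+q_c,\ldots,-\lambda_{N_0}+q_c)$, $A_1=\mathrm{diag}(-\lambda_{N_0+1}+q_c,\ldots,-\lambda_N+q_c)$, $\mathfrak{B}_0=[\beta_1,\ldots,\beta_{N_0}]^\top$,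 $\tilde{\mathfrak{B}}_1=\left[\frac{\beta_{N_0+1}}{\lambda_{N_0+1}},\ldots,\frac{\beta_N}{\lambda_N}\right]^\top$, $C_0=[\phi_1(0),\ldots,\phi_{N_0}(0)]$, $\tilde C_1=\left[\frac{\phi_{N_0+1}(0)}{\sqrt{\lambda_{N_0+1}}},\ldots,\frac{\phi_N(0)}{\sqrt{\lambda_N}}\right]$, $$F=\begin{bmatrix}A_0+\mathfrak{B}_0K&LC_0&0&L\tilde C_1\\0&A_0-LC_0&0&-L\tilde C_1\\\tilde{\mathfrak{B}}_1K&0&A_1&0\\0&0&0&A_1\end{bmatrix},\quad\mathcal{L}=\begin{bmatrix}L\\-L\\0\\0\end{bmatrix},$$ $\tilde K=[K\ 0\ 0\ 0]\in\mathbb{R}^{1\times 2N}$, and $E=K\,[A_0+\mathfrak{B}_0K\ \ LC_0\ \ 0\ \ L\tilde C_1\ \ L]\in\mathbb{R}^{1\times(2N+1)}$, with block sizes $N_0,N_0,N-N_0,N-N_0$ (and a last block of size $1$ for $E$). *)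

(* Defs.v *)
From HB Require Import structures.
From mathcomp Require Import all_boot all_order all_algebra.
From mathcomp Require Import all_classical all_reals all_analysis.
From mathcomp Require Import complex.

Set Implicit Arguments.
Unset Strict Implicit.
Unset Printing Implicit Defensive.

Import Order.TTheory GRing.Theory Num.Theory.
Import numFieldNormedType.Exports.

Local Open Scope classical_set_scope.
Local Open Scope ring_scope.

(* Functions on [0,1] are represented by total functions R -> R whose values
   outside [0,1] are irrelevant. Sequences indexed by n >= 1 in the
   mathematical notation are indexed from 0: lam n, phi n stand for
   lambda_{n+1}, phi_{n+1}, so that a sum over n >= N+1 becomes a sum over
   indices n >= N, and lambda_{N+1} is lam N. *)

Section FunctionSpaces.
Context {R : realType}.
Implicit Types f g : R -> R.

Local Notation mu := (@lebesgue_measure R).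

Definition inner f g : R := \int[mu]_(x in `[0, 1]) (f x * g x).

Definition L2norm f : R := Num.sqrt (inner f f).

Definition L2 f : Prop :=
  measurable_fun (`[0, 1] : set R) f /\
  mu.-integrable `[0, 1] (fun x => (f x ^+ 2)%:E).

(* The membership conditions exclude the junk value 0 that L2norm takes on
   functions of infinite norm. *)
Definition L2_cvg {T : Type} (F : set_system T) (f : T -> R -> R) g : Prop :=
  [/\ \forall s \near F, L2 (f s), L2 g &
      (fun s => L2norm (fun x => f s x - g x)) @ F --> (0 : R)].

Definition L2_continuous_on (D : set R) (f : R -> R -> R) : Prop :=
  forall t, D t -> L2_cvg (within D (nbhs t)) f (f t).

Definition L2_derivative (f : R -> R -> R) (t : R) g : Prop :=
  L2_cvg ((0 : R)^') (fun (h x : R) => h^-1 * (f (t + h) x - f t x)) g.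

Definition L2_sum (s : nat -> R -> R) g : Prop :=
  L2_cvg \oo (fun m x => \sum_(0 <= n < m) s n x) g.

Definition hilbert_basis (phi : nat -> R -> R) : Prop :=
  [/\ forall n, L2 (phi n),
      forall m n, inner (phi m) (phi n) = (m == n)%:R &
      forall f, L2 f -> L2_sum (fun n x => inner f (phi n) * phi n x) f].

(* R_N f, the sum in L^2 of the tail series (defined up to a.e. equality). *)
Definition residual (phi : nat -> R -> R) (N : nat) f : R -> R :=
  xget (cst 0) [set g | L2_sum
    (fun n x => if (N <= n)%N then inner f (phi n) * phi n x else 0) g].

(* f is (the continuous representative of) an element of H^1(0,1), with weak
   derivative g. In particular, when g is itself in H^1, g is the classical
   derivative of f on [0,1] and its endpoint values are the traces of f'. *)
Definition weak_deriv f g : Prop :=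
  L2 g /\ forall x, 0 <= x <= 1 -> f x = f 0 + \int[mu]_(s in `[0, x]) g s.

(* The weak derivative is unique only a.e., which is enough for H1norm. *)
Definition wderiv f : R -> R := xget (cst 0) [set g | weak_deriv f g].

Definition H1norm f : R := Num.sqrt (inner f f + inner (wderiv f) (wderiv f)).

Definition H2_bc (theta1 theta2 r : R) f : Prop :=
  exists f1 f2, [/\ weak_deriv f f1, weak_deriv f1 f2,
    cos theta1 * f 0 - sin theta1 * f1 0 = 0 &
    cos theta2 * f 1 + sin theta2 * f1 1 = r].

Definition C1_01 f f' : Prop :=
  [/\ {within `[0, 1], continuous f}, {within `[0, 1], continuous f'} &
      forall x : R, 0 < x < 1 -> is_derive x 1 f (f' x)].

Definition C2_01 f : Prop := exists f1 f2, C1_01 f f1 /\ C1_01 f1 f2.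

End FunctionSpaces.

Section SturmLiouville.
Context {R : realType}.
Variables (theta1 theta2 : R) (p q : R -> R).

Definition domA (f : R -> R) : Prop := H2_bc theta1 theta2 0 f.

(* g = - (p f')' + q f, written as (p f')' = q f - g; g is an arbitrary
   representative of its a.e. class. *)
Definition sl_expr (f g : R -> R) : Prop :=
  exists f1, weak_deriv f f1 /\
    weak_deriv (fun x => p x * f1 x) (fun x => q x * f x - g x).

Definition sl_eigenfunction (l : R) (f : R -> R) : Prop :=
  domA f /\ sl_expr f (fun x => l * f x).

Definition sl_eigenvalue (l : R) : Prop :=
  exists2 f, sl_eigenfunction l f & exists2 x, 0 <= x <= 1 & f x != 0.

Definition sl_spectrum (lam : nat -> R) (phi : nat -> R -> R) : Prop :=
  [/\ {homo lam : m n / (m < n)%N >-> m < n},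
      forall l, sl_eigenvalue l <-> exists n, lam n = l,
      forall n, sl_eigenfunction (lam n) (phi n) &
      hilbert_basis phi].

End SturmLiouville.

(* g = A^{1/2} f in the sense of the spectral calculus of A. *)
Definition sqrtA {R : realType} (lam : nat -> R) (phi : nat -> R -> R)
    (f g : R -> R) : Prop :=
  L2 f /\
  L2_sum (fun n x => Num.sqrt (lam n) * inner f (phi n) * phi n x) g.

Section ClosedLoop.
Context {R : realType}.
Variables (theta1 theta2 : R) (p qt q : R -> R) (qc : R).
Variables (lam : nat -> R) (phi : nat -> R -> R).

(* p' is only meaningful on ]0,1[ here, which determines a almost everywhere. *)
Definition a_fun (x : R) : R :=
  (2 * p x + 2 * x * derive1 p x - x ^+ 2 * qt x) /
  (cos theta2 + 2 * sin theta2).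

Definition b_fun (x : R) : R := - (x ^+ 2 / (cos theta2 + 2 * sin theta2)).

Definition a_coef n : R := inner a_fun (phi n).
Definition b_coef n : R := inner b_fun (phi n).
Definition beta_coef n : R := a_coef n + (- lam n + qc) * b_coef n.

Variables (N0 N : nat) (K : 'rV[R]_N0) (L : 'cV[R]_N0).

Definition A0 : 'M[R]_N0 := diag_mx (\row_(i < N0) (- lam i + qc)).
Definition A1 : 'M[R]_(N - N0) :=
  diag_mx (\row_(i < N - N0) (- lam (N0 + i)%N + qc)).
Definition B0 : 'cV[R]_N0 := \col_(i < N0) beta_coef i.
Definition B1 : 'cV[R]_(N - N0) :=
  \col_(i < N - N0) (beta_coef (N0 + i)%N / lam (N0 + i)%N).
Definition C0 : 'rV[R]_N0 := \row_(i < N0) phi i 0.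
Definition C1 : 'rV[R]_(N - N0) :=
  \row_(i < N - N0) (phi (N0 + i)%N 0 / Num.sqrt (lam (N0 + i)%N)).

(* The size 2N, decomposed along the block structure (here N0 <= N). *)
Definition dimX : nat := ((N0 + N0) + ((N - N0) + (N - N0)))%N.

Definition Fmx : 'M[R]_dimX :=
  block_mx
    (block_mx (A0 + B0 *m K) (L *m C0)
              0              (A0 - L *m C0))
    (block_mx 0 (L *m C1)
              0 (- (L *m C1)))
    (block_mx (B1 *m K) 0
              0         0)
    (block_mx A1 0
              0  A1).

Definition Lmx : 'cV[R]_dimX := col_mx (col_mx L (- L)) 0.

Definition Kmx : 'rV[R]_dimX := row_mx (row_mx K 0) 0.

Definition Emx : 'rV[R]_(dimX + 1) :=
  K *m row_mx (row_mx (row_mx (A0 + B0 *m K) (L *m C0))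
                      (row_mx 0 (L *m C1)))
              L.

Definition M_phi : \bar R :=
  (\sum_(N <= n <oo) (`|phi n 0| ^+ 2 / lam n)%:E)%E.

Definition Theta1 (delta : R) (P : 'M[R]_dimX) (alpha beta gamma : R)
    : 'M[R]_(dimX + 1) :=
  block_mx
    (Fmx^T *m P + P *m Fmx + (2 * delta) *: P
      + (alpha * gamma * L2norm (residual phi N a_fun) ^+ 2)
          *: (Kmx^T *m Kmx))
    (P *m Lmx)
    (Lmx^T *m P)
    (- beta)%:M
  + (alpha * gamma * L2norm (residual phi N b_fun) ^+ 2) *: (Emx^T *m Emx).

Definition Theta2 (delta alpha beta gamma : R) : R :=
  2 * gamma * (- (1 - alpha^-1) * lam N + qc + delta) + beta * fine M_phi.

Definition posdef {n} (A : 'M[R]_n) : Prop :=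
  A^T = A /\ forall x : 'cV[R]_n, x != 0 -> 0 < (x^T *m A *m x) 0 0.

Definition negsemidef {n} (A : 'M[R]_n) : Prop :=
  A^T = A /\ forall x : 'cV[R]_n, (x^T *m A *m x) 0 0 <= 0.

Definition LMI (delta : R) (P : 'M[R]_dimX) (alpha beta gamma : R) : Prop :=
  [/\ posdef P, 1 < alpha, 0 < beta /\ 0 < gamma,
      negsemidef (Theta1 delta P alpha beta gamma) &
      Theta2 delta alpha beta gamma <= 0].

(* zh n, for n < N, are the components of the controller state; those with
   n >= N play no role. z t is the function z(t,.). *)
Variables (zh : nat -> R -> R) (z : R -> R -> R).

Definition control (t : R) : R := \sum_(k < N0) K 0 k * zh k t.
Definition output (t : R) : R := z t 0.
Definition homogenized (t x : R) : R := z t x + b_fun x * control t.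
Definition what n (t : R) : R := zh n t + b_coef n * control t.
Definition innovation (t : R) : R :=
  \sum_(k < N) what k t * phi k 0 - output t.

(* z_t is taken in L^2 and equals - (- (p z_x)_x + qt z). *)
Definition plant_eq : Prop :=
  forall t, 0 < t ->
    H2_bc theta1 theta2 (control t) (z t) /\
    exists2 g, sl_expr p qt (z t) g & L2_derivative z t (fun x => - g x).

Definition controller_eq : Prop :=
  (forall (n : 'I_N0) (t : R), 0 < t ->
     is_derive t 1 (zh n) ((- lam n + qc) * zh n t + beta_coef n * control t
                           - L n 0 * innovation t)) /\
  (forall (n : nat) (t : R), (N0 <= n < N)%N -> 0 < t ->
     is_derive t 1 (zh n) ((- lam n + qc) * zh n t + beta_coef n * control t)).

Definition zhat_regularity : Prop :=
  forall n, (n < N)%N ->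
    [/\ {within `[0, +oo[, continuous (zh n)},
        forall t, 0 < t -> derivable (zh n) t 1 &
        forall t, 0 < t -> {for t, continuous (derive1 (zh n))}].

Definition w_regularity : Prop :=
  let w := homogenized in
  [/\ L2_continuous_on `[0, +oo[ w,
      exists wt, L2_continuous_on `]0, +oo[ wt /\
        forall t, 0 < t -> L2_derivative w t (wt t),
      forall t, 0 <= t -> domA theta1 theta2 (w t),
      exists Aw, L2_continuous_on `]0, +oo[ Aw /\
        forall t, 0 < t -> sl_expr p q (w t) (Aw t) &
      exists v, L2_continuous_on `[0, +oo[ v /\
        forall t, 0 <= t -> sqrtA lam phi (w t) (v t)].

Definition closed_loop_trajectory (z0 : R -> R) (zh0 : nat -> R) : Prop :=
  [/\ forall x, 0 <= x <= 1 -> z 0 x = z0 x,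
      forall n, (n < N)%N -> zh n 0 = zh0 n,
      plant_eq, controller_eq & zhat_regularity /\ w_regularity].

End ClosedLoop.

(* All complex eigenvalues of the real matrix A have real part < r. *)
Definition spectral_abscissa_lt {R : realType} {n} (A : 'M[R]_n) (r : R)
    : Prop :=
  forall l : R[i],
    eigenvalue (map_mx (real_complex R) A) l -> complex.Re l < r.

(* Main.v *)
(** With [w = z + b u] the boundary input is moved into the equation, so that
    [w] lies in the domain of [A]. Let [W] be the part of the energy [<A w, w>]
    carried by the modes of index at least [N], and [X] the reduced state
    (observer modes and scaled observation errors). Along trajectories
    [V = X^T P X + gamma W] satisfies [V' + 2 delta V <= 0]: Young's inequality
    with parameter [alpha] absorbs the action of [u] and [u'] on the tail into
    [Theta1], and the unobserved part of the output, whose square is at most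
    [M_phi W] by Cauchy-Schwarz, is paid for by [Theta2]. Coercivity of the form
    of [A] makes [V] equivalent to the squared [H^1] norm. Differentiability of
    [<A w, w>] comes from the symmetry of [A], and [M_phi] is finite because the
    truncated Green function at [0] has an energy controlled by point
    evaluation.

    For feasibility, [P] is block diagonal, built from Lyapunov matrices of the
    two Hurwitz blocks and multiples of the identity. By Bessel's inequality and
    the finiteness of [M_phi], the norms of the remaining blocks are bounded
    uniformly in [N], so all weights can be fixed before [N]; then [Theta2 <= 0]
    once [lam N] is large. *)
Require Import Defs.
From HB Require Import structures.
From mathcomp Require Import all_boot all_order all_algebra.
From mathcomp Require Import all_classical all_reals all_analysis.
From mathcomp Require Import complex mxred spectral.
From mathcomp Require Import measurable_realfun ring lra.

Set Implicit Arguments.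
Unset Strict Implicit.
Unset Printing Implicit Defensive.

Import Order.TTheory GRing.Theory Num.Theory.
Import numFieldNormedType.Exports.

Local Open Scope classical_set_scope.
Local Open Scope ring_scope.

(** * The space L2(0,1) *)

(** Regularity shapes the proof. An $H^1$ function is a primitive of an $L^2$ function known only up
    to null sets, so derivatives are carried as explicit arguments and replaced by continuous
    representatives wherever a trace is read off. Along a trajectory [A w] is continuous only for
    [t > 0] and has no derivative in time, whereas decay is claimed from [t = 0].

    No series is differentiated term by term: the tail energy is the full energy minus finitely many
    squared modes, and its derivative collapses to an expression in [A w] stripped of those modes.

    One inequality, the bound of a point value by the energy, is used for three things: finiteness
    of [M_phi], growth of the eigenvalues (without which [Theta2] could not be made negative), and
    convergence at [0] of the eigenfunction expansion, which $L^2$ convergence does not give.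

    The weights in the reduced state serve feasibility only: they keep the blocks coupling the
    infinite families of modes bounded as [N] grows. *)

Lemma quadratic_discr_le (R : realFieldType) (a b c : R) : 0 <= c ->
  (forall t, 0 <= a + 2 * t * b + t ^+ 2 * c) -> b ^+ 2 <= a * c.
Proof.
move=> c0 h; have [c1|] := ltrP 0 c.
  have := h (- b / c); rewrite (_ : _ + _ = a - b ^+ 2 / c); last first.
    by field; rewrite gt_eqF.
  by rewrite subr_ge0 ler_pdivrMr.
rewrite le_eqVlt ltNge c0 orbF => /eqP c_eq0; rewrite c_eq0 mulr0.
have [->|b0] := eqVneq b 0; first by rewrite expr0n.
(* For [c = 0] the polynomial is affine; at this point it takes the value [-1]. *)
have := h (- (a + 1) / (2 * b)); rewrite c_eq0 mulr0 addr0.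
rewrite (_ : 2 * _ * b = - (a + 1)); last by field; rewrite b0.
by move=> ?; exfalso; lra.
Qed.

Section L2_basics.
Context {R : realType}.
Implicit Types f g h : R -> R.
Local Notation mu := (@lebesgue_measure R).
Local Notation I := (`[0, 1]%classic : set R).

Lemma EFin_integrableZl (D : set R) k f : measurable D ->
  mu.-integrable D (EFin \o f) -> mu.-integrable D (EFin \o (fun x => k * f x)).
Proof.
move=> mD h; exact: (@eq_integrable _ _ _ mu D mD _ _ _ (@integrableZl _ _ _ mu D mD k _ h)).
Qed.

Lemma EFin_integrableD (D : set R) f g : measurable D ->
  mu.-integrable D (EFin \o f) -> mu.-integrable D (EFin \o g) ->
  mu.-integrable D (EFin \o (fun x => f x + g x)).
Proof.
move=> mD i1 i2.
exact: (@eq_integrable _ _ _ mu D mD _ _ _ (@integrableD _ _ _ mu D mD _ _ i1 i2)).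
Qed.

Lemma EFin_le_integrable (D : set R) f g : measurable D -> measurable_fun D f ->
  (forall x, D x -> `|f x| <= `|g x|) ->
  mu.-integrable D (EFin \o g) -> mu.-integrable D (EFin \o f).
Proof.
move=> mD mf fg ig.
by apply: (@le_integrable _ _ _ mu D mD _ _ _ _ ig); first exact/measurable_EFinP.
Qed.

Lemma EFin_eq_integrable (D : set R) f g : measurable D ->
  (forall x, D x -> f x = g x) ->
  mu.-integrable D (EFin \o f) -> mu.-integrable D (EFin \o g).
Proof.
move=> mD fg; apply: eq_integrable => // x xD /=.
by rewrite fg//; move: xD; rewrite inE.
Qed.

(** The set is arbitrary because the product rule and the trace inequality apply this on
    subintervals. *)
Lemma integral_CauchySchwarz (D : set R) f g : measurable D ->
  mu.-integrable D (EFin \o (fun x => f x ^+ 2)) ->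
  mu.-integrable D (EFin \o (fun x => g x ^+ 2)) ->
  mu.-integrable D (EFin \o (fun x => f x * g x)) ->
  (\int[mu]_(x in D) (f x * g x)) ^+ 2 <=
  \int[mu]_(x in D) (f x ^+ 2) * \int[mu]_(x in D) (g x ^+ 2).
Proof.
move=> mD if2 ig2 ifg; apply: quadratic_discr_le => [|t].
  by apply: Rintegral_ge0 => x _; exact: sqr_ge0.
have := @Rintegral_ge0 _ _ _ mu D (fun x => (f x + t * g x) ^+ 2)
  (fun x _ => sqr_ge0 _).
suff -> : \int[mu]_(x in D) ((f x + t * g x) ^+ 2) =
  \int[mu]_(x in D) (f x ^+ 2) + 2 * t * \int[mu]_(x in D) (f x * g x) +
  t ^+ 2 * \int[mu]_(x in D) (g x ^+ 2) by [].
have i1 : mu.-integrable D (EFin \o (fun x => (2 * t) * (f x * g x))).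
  exact: EFin_integrableZl.
have i2 : mu.-integrable D (EFin \o (fun x => t ^+ 2 * g x ^+ 2)).
  exact: EFin_integrableZl.
rewrite -!RintegralZl// -!RintegralD//; last exact: EFin_integrableD.
by apply: eq_Rintegral => x _; ring.
Qed.

Lemma measurable_I : measurable I. Proof. exact: measurable_itv. Qed.
Hint Resolve measurable_I : core.

Lemma L2_meas f : L2 f -> measurable_fun I f. Proof. by case. Qed.

Lemma eq_L2 f g : (forall x : R, 0 <= x <= 1 -> f x = g x) -> L2 f -> L2 g.
Proof.
move=> fg [mf if2]; split.
  by apply: eq_measurable_fun mf => x; rewrite inE/= in_itv/=; exact: fg.
by apply: EFin_eq_integrable if2 => // x /=; rewrite in_itv/= => xI; rewrite fg.
Qed.

Lemma L2_integrableM f g : L2 f -> L2 g ->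
  mu.-integrable I (EFin \o (fun x => f x * g x)).
Proof.
move=> [mf if2] [mg ig2].
apply: (EFin_le_integrable measurable_I _ _ (EFin_integrableD measurable_I if2 ig2)).
  exact: measurable_funM.
move=> x _; rewrite normrM.
rewrite [leRHS]ger0_norm ?addr_ge0 ?sqr_ge0//.
rewrite -(real_normK (num_real (f x))) -(real_normK (num_real (g x))).
have := sqr_ge0 (`|f x| - `|g x|); have := normr_ge0 (f x).
have := normr_ge0 (g x); nra.
Qed.

Lemma L2D f g : L2 f -> L2 g -> L2 (fun x => f x + g x).
Proof.
move=> Lf Lg; split; first by apply: measurable_funD; [case: Lf|case: Lg].
have [[_ if2] [_ ig2]] := (Lf, Lg).
have i1 := EFin_integrableD measurable_I (EFin_integrableD measurable_I if2 ig2)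
  (EFin_integrableZl 2 measurable_I (L2_integrableM Lf Lg)).
by apply: EFin_eq_integrable i1 => //= x _; ring.
Qed.

Lemma L2Z k f : L2 f -> L2 (fun x => k * f x).
Proof.
move=> [mf if2]; split; first exact: measurable_funM.
apply: EFin_eq_integrable (EFin_integrableZl (k ^+ 2) measurable_I if2) => //= x _.
by rewrite exprMn.
Qed.

Lemma L2N f : L2 f -> L2 (fun x => - f x).
Proof. by move=> /(L2Z (-1)); apply: eq_L2 => x _; rewrite mulN1r. Qed.

Lemma L2B f g : L2 f -> L2 g -> L2 (fun x => f x - g x).
Proof. by move=> Lf /L2N; exact: L2D. Qed.

Lemma lebesgue_I : mu I = 1%E.
Proof. by rewrite lebesgue_measure_itv/= lte_fin ltr01 oppr0 adde0. Qed.

Lemma lebesgue_I_lty : (mu I < +oo)%E.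
Proof. by rewrite lebesgue_I ltry. Qed.

Lemma L2_cst k : L2 (fun=> k : R).
Proof.
split => //; apply: measurable_bounded_integrable => //; first exact: lebesgue_I_lty.
by exists (k ^+ 2); split => [|M /ltW kM x _ /=]; rewrite ?num_real// ger0_norm ?sqr_ge0.
Qed.

Lemma L2_sumn (I : Type) (r : seq I) (P : pred I) (s : I -> R -> R) :
  (forall i, L2 (s i)) -> L2 (fun x => \sum_(i <- r | P i) s i x).
Proof.
move=> Ls; elim: r => [|i r IHr].
  by apply: eq_L2 (L2_cst 0) => x _; rewrite big_nil.
have [Pi|NPi] := boolP (P i).
  by apply: eq_L2 (L2D (Ls i) IHr) => x _; rewrite big_cons Pi.
by apply: eq_L2 IHr => x _; rewrite big_cons (negbTE NPi).
Qed.

Lemma L2_integrable f : L2 f -> mu.-integrable I (EFin \o f).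
Proof.
move=> Lf; apply: EFin_eq_integrable (L2_integrableM Lf (L2_cst 1)) => // x _.
by rewrite mulr1.
Qed.

Lemma within_continuous_measurable f :
  {within `[0, 1], continuous f} -> measurable_fun I f.
Proof. by move=> cf; exact: subspace_continuous_measurable_fun. Qed.

Lemma within_continuous_bounded f : {within `[0, 1], continuous f} ->
  exists2 M, 0 < M & forall x, 0 <= x <= 1 -> `|f x| <= M.
Proof.
move=> cf.
have /compact_bounded[M [Mr hM]] :
    compact (f @` (`[0, 1]%classic : set R)).
  by apply: continuous_compact => //; exact: segment_compact.
exists (`|M| + 1); first by rewrite ltr_wpDl.
move=> x xI; apply: hM; last by exists x => //=; rewrite in_itv.
by rewrite (le_lt_trans (ler_norm _))// ltrDl.
Qed.

Lemma L2_bounded f M : measurable_fun I f ->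
  (forall x : R, 0 <= x <= 1 -> `|f x| <= M) -> L2 f.
Proof.
move=> mf hM; split => //.
apply: measurable_bounded_integrable => //; first exact: lebesgue_I_lty.
  exact: measurable_funX.
exists (M ^+ 2); split => [|M' /ltW MM' x /=]; rewrite ?num_real// in_itv/= => xI.
rewrite normrX (le_trans _ MM')// ler_pXn2r// ?nnegrE ?hM//.
exact: le_trans (hM _ xI).
Qed.

Lemma continuous_L2 f : {within `[0, 1], continuous f} -> L2 f.
Proof.
move=> cf; have [M _ hM] := within_continuous_bounded cf.
by apply: L2_bounded hM; exact: within_continuous_measurable.
Qed.

Lemma L2M_bounded f g M : L2 f -> measurable_fun I g ->
  (forall x : R, 0 <= x <= 1 -> `|g x| <= M) -> L2 (fun x => g x * f x).
Proof.
move=> Lf mg hM; split; first by apply: measurable_funM => //; case: Lf.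
have [mf if2] := Lf.
apply: (EFin_le_integrable measurable_I _ _
          (EFin_integrableZl (M ^+ 2) measurable_I if2)).
  exact/measurable_funX/measurable_funM.
move=> x /=; rewrite in_itv/= => xI.
rewrite exprMn normrM [leRHS]normrM ler_wpM2r// normrX [leRHS]normrX.
by rewrite ler_pXn2r ?nnegrE// (le_trans (hM _ xI)) ?ler_norm.
Qed.

Lemma L2M_continuous f g : L2 f -> {within `[0, 1], continuous g} ->
  L2 (fun x => g x * f x).
Proof.
move=> Lf cg; have [M _ hM] := within_continuous_bounded cg.
by apply: L2M_bounded hM => //; exact: within_continuous_measurable.
Qed.

Lemma eq_inner f f' g g' : (forall x : R, 0 <= x <= 1 -> f x = f' x) ->
  (forall x : R, 0 <= x <= 1 -> g x = g' x) -> inner f g = inner f' g'.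
Proof.
move=> ff gg; apply: eq_Rintegral => x; rewrite inE/= in_itv/= => xI.
by rewrite ff// gg.
Qed.

Lemma innerC f g : inner f g = inner g f.
Proof. by apply: eq_Rintegral => x _; rewrite mulrC. Qed.

Lemma innerDl f g h : L2 f -> L2 g -> L2 h ->
  inner (fun x => f x + g x) h = inner f h + inner g h.
Proof.
move=> Lf Lg Lh; rewrite -RintegralD//; [|exact: L2_integrableM..].
by apply: eq_Rintegral => x _; rewrite mulrDl.
Qed.

Lemma innerZl k f h : L2 f -> L2 h -> inner (fun x => k * f x) h = k * inner f h.
Proof.
move=> Lf Lh; rewrite -RintegralZl//; last exact: L2_integrableM.
by apply: eq_Rintegral => x _; rewrite mulrA.
Qed.

Lemma innerNl f h : L2 f -> L2 h -> inner (fun x => - f x) h = - inner f h.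
Proof.
move=> Lf Lh; rewrite -mulN1r -innerZl//.
by apply: eq_inner => // x _; rewrite mulN1r.
Qed.

Lemma innerBl f g h : L2 f -> L2 g -> L2 h ->
  inner (fun x => f x - g x) h = inner f h - inner g h.
Proof. by move=> Lf Lg Lh; rewrite innerDl ?innerNl//; exact: L2N. Qed.

Lemma innerDr f g h : L2 f -> L2 g -> L2 h ->
  inner h (fun x => f x + g x) = inner h f + inner h g.
Proof. by move=> Lf Lg Lh; rewrite ![inner h _]innerC innerDl. Qed.

Lemma innerZr k f h : L2 f -> L2 h -> inner h (fun x => k * f x) = k * inner h f.
Proof. by move=> Lf Lh; rewrite ![inner h _]innerC innerZl. Qed.

Lemma innerBr f g h : L2 f -> L2 g -> L2 h ->
  inner h (fun x => f x - g x) = inner h f - inner h g.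
Proof. by move=> Lf Lg Lh; rewrite ![inner h _]innerC innerBl. Qed.

Lemma inner0l h : inner (fun=> 0) h = 0.
Proof.
rewrite /inner (@eq_Rintegral _ _ _ _ _ (fun=> 0)); last first.
  by move=> x _; rewrite mul0r.
by rewrite Rintegral_cst// mul0r.
Qed.

Lemma inner_suml (I : Type) (r : seq I) (P : pred I) (s : I -> R -> R) h :
  (forall i, L2 (s i)) -> L2 h ->
  inner (fun x => \sum_(i <- r | P i) s i x) h = \sum_(i <- r | P i) inner (s i) h.
Proof.
move=> Ls Lh; elim: r => [|i r IHr].
  by rewrite big_nil -[RHS](inner0l h); apply: eq_inner => // x _; rewrite big_nil.
rewrite big_cons -IHr; have [Pi|NPi] := boolP (P i).
  rewrite -innerDl//; last exact: L2_sumn.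
  by apply: eq_inner => // x _; rewrite big_cons Pi.
by apply: eq_inner => // x _; rewrite big_cons (negbTE NPi).
Qed.

Lemma inner_ge0 f : 0 <= inner f f.
Proof. by apply: Rintegral_ge0 => x _; rewrite -expr2 sqr_ge0. Qed.

Lemma sqr_L2norm f : L2norm f ^+ 2 = inner f f.
Proof. by rewrite sqr_sqrtr// inner_ge0. Qed.

Lemma L2norm_ge0 f : 0 <= L2norm f. Proof. exact: sqrtr_ge0. Qed.

Lemma inner_CauchySchwarz f g : L2 f -> L2 g ->
  inner f g ^+ 2 <= inner f f * inner g g.
Proof.
move=> Lf Lg.
have sqE h : inner h h = \int[mu]_(x in I) (h x ^+ 2).
  by apply: eq_Rintegral => x _; rewrite expr2.
rewrite !sqE; apply: integral_CauchySchwarz => //; first exact: (proj2 Lf).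
  exact: (proj2 Lg).
exact: L2_integrableM.
Qed.

Lemma norm_inner_le f g : L2 f -> L2 g -> `|inner f g| <= L2norm f * L2norm g.
Proof.
move=> Lf Lg; rewrite -sqrtr_sqr -sqrtrM ?inner_ge0//.
by rewrite ler_wsqrtr// inner_CauchySchwarz.
Qed.

Lemma inner_sqrDle f g : L2 f -> L2 g ->
  inner (fun x => f x + g x) (fun x => f x + g x) <= 2 * inner f f + 2 * inner g g.
Proof.
move=> Lf Lg; have := inner_ge0 (fun x => f x - g x).
have [LD LB] := (L2D Lf Lg, L2B Lf Lg).
rewrite innerBl// !innerBr// innerDl// !innerDr// (innerC g f); lra.
Qed.

End L2_basics.
Global Hint Resolve measurable_I : core.

(** * Weak derivatives *)

Lemma le0_pow2 (R : realType) (c d : R) : (forall n, c * 2 ^+ n <= d) -> c <= 0.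
Proof.
move=> h; rewrite leNgt; apply/negP => c0.
have /= := truncnS_gt (d / c); rewrite ltr_pdivrMr// mulrC ltNge => /negP; apply.
apply: le_trans (h (Num.truncn (d / c)).+1); rewrite ler_pM2l// -natrX ler_nat.
by rewrite ltnW// ltn_expl.
Qed.

(** Bisection: on each half the factor [y - x] is halved while the increments of [Q] add up, so
    every step gains a factor 2 in the bound on the increment of [H]. No differentiability of [H] is
    involved. *)
Lemma quadratic_variation_cst (R : realType) (H Q : R -> R) :
  (forall x y, 0 <= x -> x <= y -> y <= 1 ->
    `|H y - H x| <= (y - x) * (Q y - Q x)) ->
  forall x, 0 <= x <= 1 -> H x = H 0.
Proof.
move=> HQ.
have step n : forall x y, 0 <= x -> x <= y -> y <= 1 ->
    `|H y - H x| * 2 ^+ n <= (y - x) * (Q y - Q x).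
  elim: n => [|n IHn] x y x0 xy y1; first by rewrite expr0 mulr1 HQ.
  pose m := (x + y) / 2.
  have [xm my] : x <= m /\ m <= y by rewrite /m; split; lra.
  have h1 := IHn x m x0 xm (le_trans my y1).
  have h2 := IHn m y (le_trans x0 xm) my y1.
  have h3 : `|H y - H x| <= `|H y - H m| + `|H m - H x|.
    by rewrite (le_trans _ (ler_normD _ _))// addrA subrK.
  have p0 : 0 <= (2 : R) ^+ n by rewrite exprn_ge0.
  have h4 : `|H y - H x| * 2 ^+ n <= (`|H y - H m| + `|H m - H x|) * 2 ^+ n.
    by rewrite ler_wpM2r.
  have e1 : m - x = (y - x) / 2 by rewrite /m; lra.
  have e2 : y - m = (y - x) / 2 by rewrite /m; lra.
  rewrite e1 in h1; rewrite e2 in h2; rewrite exprS mulrCA.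
  nra.
move=> x /andP[x0 x1]; apply/eqP; rewrite -subr_eq0 -normr_le0.
exact/le0_pow2/(fun n => step n 0 x (lexx _) x0 x1).
Qed.

Section weak_derivatives.
Context {R : realType}.
Implicit Types f g h : R -> R.
Local Notation mu := (@lebesgue_measure R).
Local Notation I := (`[0, 1]%classic : set R).

Lemma Rintegral_cst_itv (k x y : R) : x <= y ->
  \int[mu]_(_ in `[x, y]) k = k * (y - x).
Proof.
move=> xy; rewrite Rintegral_cst//; congr (_ * _).
transitivity (fine (mu (`[x, y]%classic : set R))) => //.
rewrite lebesgue_measure_itv/= lte_fin.
by case: ifPn => //; rewrite -leNgt => yx /=; lra.
Qed.

Lemma integrable_subitv f (a b : R) : mu.-integrable I (EFin \o f) ->
  0 <= a -> b <= 1 -> mu.-integrable `[a, b] (EFin \o f).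
Proof.
move=> fI a0 b1; apply: integrableS fI => //.
by apply: subset_itvScc; rewrite bnd_simp.
Qed.

Lemma Rintegral_itvBcc f (x y : R) : mu.-integrable I (EFin \o f) ->
  0 <= x -> x <= y -> y <= 1 ->
  \int[mu]_(t in `[0, y]) f t - \int[mu]_(t in `[0, x]) f t =
  \int[mu]_(t in `[x, y]) f t.
Proof.
move=> fI x0 xy y1; rewrite Rintegral_itvB ?bnd_simp//; last first.
  exact: integrable_subitv.
rewrite Rintegral_itv_obnd_cbnd//.
apply: (@integrableS _ _ _ mu `[x, y]) => //; last exact: integrable_subitv.
exact: subset_itv_oc_cc.
Qed.

Lemma weak_derivB f g (x y : R) : weak_deriv f g -> 0 <= x -> x <= y -> y <= 1 ->
  f y - f x = \int[mu]_(t in `[x, y]) g t.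
Proof.
move=> [Lg fE] x0 xy y1.
rewrite -Rintegral_itvBcc//; last exact: L2_integrable.
by rewrite (fE y) ?(fE x) ?x0 ?y1 ?(le_trans x0 xy) ?(le_trans xy y1)//; lra.
Qed.

Lemma weak_deriv_continuous f g : weak_deriv f g ->
  {within `[0, 1], continuous f}.
Proof.
move=> [Lg fE].
have := @parameterized_integral_continuous R 0 1 g ler01 (L2_integrable Lg).
move=> cint; apply: (@subspace_eq_continuous _ _ _
    (fun x => f 0 + parameterized_integral mu 0 x g)).
  move=> x; rewrite inE/= in_itv/= => /fE fx.
  by rewrite /from_subspace fx.
by move=> x; apply: cvgD; [exact: cvg_cst|exact: cint].
Qed.

Lemma eq_weak_deriv f f' g g' : (forall x : R, 0 <= x <= 1 -> f x = f' x) ->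
  (forall x : R, 0 <= x <= 1 -> g x = g' x) -> weak_deriv f g -> weak_deriv f' g'.
Proof.
move=> ff gg [Lg fE]; split; first exact: eq_L2 Lg.
move=> x /andP[x0 x1].
rewrite -ff ?x0// fE ?x0// ff ?lexx ?ler01//; congr (_ + _).
apply: eq_Rintegral => s; rewrite inE/= in_itv/= => /andP[s0 sx].
by rewrite gg// s0 (le_trans sx).
Qed.

Lemma weak_derivD f f' g g' : weak_deriv f g -> weak_deriv f' g' ->
  weak_deriv (fun x => f x + f' x) (fun x => g x + g' x).
Proof.
move=> [Lg fE] [Lg' fE']; split; first exact: L2D.
move=> x xI; have /andP[x0 x1] := xI.
rewrite fE// fE'// RintegralD//; last 2 first.
- exact/integrable_subitv/x1/lexx/L2_integrable.
- exact/integrable_subitv/x1/lexx/L2_integrable.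
- lra.
Qed.

Lemma weak_derivZ k f g : weak_deriv f g ->
  weak_deriv (fun x => k * f x) (fun x => k * g x).
Proof.
move=> [Lg fE]; split; first exact: L2Z.
move=> x xI; have /andP[x0 x1] := xI.
rewrite fE// RintegralZl//; last exact/integrable_subitv/x1/lexx/L2_integrable.
lra.
Qed.

Lemma weak_deriv_cst (k : R) : weak_deriv (fun=> k) (fun=> 0).
Proof.
split=> [|x _]; first exact: L2_cst.
by rewrite Rintegral_cst// mul0r addr0.
Qed.

(** [F G] minus the primitive of the expected derivative has increments over [[x, y]] bounded by
    [y - x] times the increment of the primitive of [f^2 + g^2]; by bisection it is constant. This
    bypasses differentiation almost everywhere. *)
Lemma weak_derivM F G f g : weak_deriv F f -> weak_deriv G g ->
  weak_deriv (fun x => F x * G x) (fun x => f x * G x + F x * g x).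
Proof.
move=> Ff Gg.
have cF := weak_deriv_continuous Ff; have cG := weak_deriv_continuous Gg.
have [[Lf _] [Lg _]] := (Ff, Gg).
have L1 : L2 (fun x => f x * G x).
  by apply: eq_L2 (L2M_continuous Lf cG) => x _; rewrite mulrC.
have L3 : L2 (fun x => F x * g x) by exact: L2M_continuous.
have Lk := L2D L1 L3; split => // x xI; apply/eqP.
have if2 : mu.-integrable I (EFin \o (fun x => f x ^+ 2)) by exact: (proj2 Lf).
have ig2 : mu.-integrable I (EFin \o (fun x => g x ^+ 2)) by exact: (proj2 Lg).
have iq := EFin_integrableD measurable_I if2 ig2.
pose k := fun x => f x * G x + F x * g x.
pose H x := F x * G x - \int[mu]_(s in `[0, x]) k s.
pose Q x := \int[mu]_(s in `[0, x]) (f s ^+ 2 + g s ^+ 2).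
suff /(_ x xI) : forall x, 0 <= x <= 1 -> H x = H 0.
  by rewrite /H set_itv1 Rintegral_set1 subr0 => <-; rewrite subrK.
apply: (@quadratic_variation_cst R H Q) => {xI} {}x y x0 xy y1.
have sub h : mu.-integrable I (EFin \o h) -> mu.-integrable `[x, y] (EFin \o h).
  by move=> ih; exact: integrable_subitv.
have mxy : measurable (`[x, y]%classic : set R) by [].
have yI : 0 <= y <= 1 by rewrite y1 (le_trans x0 xy).
rewrite /Q Rintegral_itvBcc// /H.
pose Phi := \int[mu]_(s in `[x, y]) `|f s|.
pose Gam := \int[mu]_(s in `[x, y]) `|g s|.
have iabs h : L2 h -> mu.-integrable I (EFin \o (fun s => `|h s|)).
  by move=> /L2_integrable ih; exact: (@integrable_norm _ _ _ mu _ h ih).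
have bnd h h' a b : weak_deriv h h' -> x <= a -> a <= b -> b <= y ->
    `|h b - h a| <= \int[mu]_(s in `[x, y]) `|h' s|.
  move=> hh xa ab b_y; have [Lh _] := hh.
  have a0 := le_trans x0 xa; have b1 := le_trans b_y y1.
  rewrite (weak_derivB hh)//.
  apply: (le_trans (le_normr_Rintegral _ _)) => //.
    by apply: integrable_subitv => //; exact: L2_integrable.
  rewrite -(Rintegral_itvBcc (iabs _ Lh) a0 ab b1).
  rewrite -(Rintegral_itvBcc (iabs _ Lh) x0 xy y1).
  have n1 : 0 <= \int[mu]_(s in `[x, a]) `|h' s| by exact: Rintegral_ge0.
  have n2 : 0 <= \int[mu]_(s in `[b, y]) `|h' s| by exact: Rintegral_ge0.
  rewrite -(Rintegral_itvBcc (iabs _ Lh) x0 xa (le_trans ab b1)) in n1.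
  rewrite -(Rintegral_itvBcc (iabs _ Lh) (le_trans a0 ab) b_y y1) in n2.
  lra.
have CS h : L2 h -> (\int[mu]_(s in `[x, y]) `|h s|) ^+ 2 <=
    (y - x) * \int[mu]_(s in `[x, y]) (h s ^+ 2).
  move=> Lh.
  have -> : \int[mu]_(s in `[x, y]) `|h s| = \int[mu]_(s in `[x, y]) (1 * `|h s|).
    by apply: eq_Rintegral => s _; rewrite mul1r.
  have e2 : \int[mu]_(s in `[x, y]) (`|h s| ^+ 2) = \int[mu]_(s in `[x, y]) (h s ^+ 2).
    by apply: eq_Rintegral => s _; rewrite real_normK// num_real.
  have e1 : \int[mu]_(s in `[x, y]) ((1 : R) ^+ 2) = y - x.
    by rewrite Rintegral_cst_itv// expr1n mul1r.
  rewrite -e1 -e2; apply: integral_CauchySchwarz => //.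
  - by apply: sub; have [_] := L2_cst (1 : R).
  - apply: sub; apply: EFin_eq_integrable (proj2 Lh) => // s _.
    by rewrite real_normK// num_real.
  - by apply: sub; apply: EFin_eq_integrable (iabs _ Lh) => // s _; rewrite mul1r.
(* With [G] frozen at [y] and [F] at [x], every remaining term is a derivative times an increment,
   hence of second order in the length of the interval. *)
have iE : F y * G y - F x * G x - \int[mu]_(s in `[x, y]) k s =
    \int[mu]_(s in `[x, y]) (f s * (G y - G s) + (F x - F s) * g s).
  have -> : F y * G y - F x * G x = (F y - F x) * G y + F x * (G y - G x) by ring.
  rewrite (weak_derivB Ff)// (weak_derivB Gg)//.
  have if' := sub _ (L2_integrable Lf); have ig := sub _ (L2_integrable Lg).
  rewrite -RintegralZr// -RintegralZl//.
  have i1 : mu.-integrable `[x, y] (EFin \o (fun s => f s * G y)).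
    apply: EFin_eq_integrable (EFin_integrableZl (G y) mxy if') => // s _.
    by rewrite mulrC.
  have i2 := EFin_integrableZl (F x) mxy ig.
  rewrite -RintegralD// -RintegralB//; last 2 first.
  - exact: EFin_integrableD.
  - exact/sub/L2_integrable.
  by apply: eq_Rintegral => s _; rewrite /k; ring.
have -> : F y * G y - \int[mu]_(s in `[0, y]) k s -
    (F x * G x - \int[mu]_(s in `[0, x]) k s) =
    F y * G y - F x * G x - \int[mu]_(s in `[x, y]) k s.
  by rewrite -(@Rintegral_itvBcc k x y (L2_integrable Lk))//; ring.
rewrite iE.
have Lr : L2 (fun s => f s * (G y - G s) + (F x - F s) * g s).
  apply: eq_L2 (L2B (L2D (L2Z (G y) Lf) (L2Z (F x) Lg)) Lk) => s _; rewrite /k; ring.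
apply: (le_trans (le_normr_Rintegral _ (sub _ (L2_integrable Lr)))) => //.
(* Increments of [G] and [F] are at most [Gam] and [Phi], so the integral is at most [2 Phi Gam],
   hence at most [Phi^2 + Gam^2], and Cauchy-Schwarz supplies the factor [y - x]. *)
apply: (@le_trans _ _ (\int[mu]_(s in `[x, y]) (Gam * `|f s| + Phi * `|g s|))).
  apply: le_Rintegral => //.
  - exact/sub/iabs.
  - by apply: EFin_integrableD => //; apply: EFin_integrableZl => //; exact/sub/iabs.
  - move=> s /=; rewrite in_itv/= => /andP[xs sy].
    apply: (le_trans (ler_normD _ _)); rewrite !normrM mulrC lerD//.
      by rewrite ler_wpM2r// bnd.
    by rewrite ler_wpM2r// distrC bnd.
rewrite RintegralD//; last 2 first.
- by apply: EFin_integrableZl => //; exact/sub/iabs.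
- by apply: EFin_integrableZl => //; exact/sub/iabs.
rewrite !RintegralZl//; [|exact/sub/iabs..].
rewrite -/Phi -/Gam RintegralD//; [|exact: sub..].
have := CS f Lf; have := CS g Lg; rewrite -/Phi -/Gam => c1 c2.
have := sqr_ge0 (Phi - Gam); nra.
Qed.

Lemma primitive0_patch g :
  (forall x : R, 0 <= x <= 1 -> \int[mu]_(s in `[0, x]) g s = 0) ->
  forall x : R, \int[mu]_(t in `[0, x]) (g \_ I) t = 0.
Proof.
move=> g0 x; rewrite -Rintegral_mkcondr.
have [x0|x0] := ltP x 0.
  by rewrite (_ : `[0, x]%classic = set0) ?set0I ?Rintegral_set0// set_itv_ge// bnd_simp -ltNge.
have [x1|/ltW x1] := leP x 1.
  rewrite setIidl ?g0 ?x0//; by apply: subset_itvl; rewrite bnd_simp.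
rewrite setIidr ?g0 ?ler01 ?lexx//; by apply: subset_itvl; rewrite bnd_simp.
Qed.

Lemma primitive0_ae g : mu.-integrable I (EFin \o g) ->
  (forall x : R, 0 <= x <= 1 -> \int[mu]_(s in `[0, x]) g s = 0) ->
  {ae mu, forall x, I x -> g x = 0}.
Proof.
move=> ig g0; pose h := g \_ I.
have ih : mu.-integrable setT (EFin \o h).
  by have := (@integrable_mkcond _ _ _ mu I _ measurable_I).1 ig; rewrite restrict_EFin.
have hb (y : R) : mu.-integrable `[0, y] (EFin \o h).
  exact: integrableS ih.
have hl : locally_integrable setT h by exact: integrable_locally.
have F0 := primitive0_patch g0.
have F0' : (fun x => \int[mu]_(t in `[0, x]) h t) = cst 0 by apply/funext.
have := @FTC1 R h (BLeft 0) hb hl; rewrite /= F0' => ae1.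
(* Differentiation of the primitive is available only strictly to the right of its base point; the
   point [0] is discarded as a null set. *)
have ae2 : {ae mu, forall x : R, x != 0}.
  exists [set 0]; split => //; first exact: lebesgue_measure_set1.
  by move=> x /= /negP; rewrite negbK => /eqP.
apply: (@filterS2 _ _ (ae_filter_ringOfSetsType mu) _ _ _ _ ae1 ae2) => x hx xn0 /= xI.
move: (xI); rewrite in_itv/= => /andP[x0 x1].
have [|_] := hx; first by rewrite lte_fin lt_neqAle eq_sym xn0.
by rewrite derive1_cst /h patchE mem_set.
Qed.

Definition ae01_eq f g := {ae mu, forall x, I x -> f x = g x}.

Lemma weak_deriv_unique f g g' : weak_deriv f g -> weak_deriv f g' -> ae01_eq g g'.
Proof.
move=> [Lg fE] [Lg' fE'].
have Ld := L2B Lg Lg'.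
have := @primitive0_ae _ (L2_integrable Ld).
have p x : 0 <= x <= 1 -> \int[mu]_(s in `[0, x]) (g s - g' s) = 0.
  move=> xI; have /andP[x0 x1] := xI.
  rewrite RintegralB//; try exact/integrable_subitv/x1/lexx/L2_integrable.
  by have := fE x xI; have := fE' x xI; lra.
by move=> /(_ p) H; apply: (@filterS _ _ (ae_filter_ringOfSetsType mu) _ _ _ H) => x h xI; have := h xI; lra.
Qed.

Lemma ae01_inner f f' h : measurable_fun I f -> measurable_fun I f' ->
  measurable_fun I h -> ae01_eq f f' -> inner f h = inner f' h.
Proof.
move=> mf mf' mh ff; congr fine; apply: ae_eq_integral => //.
- by apply/measurable_EFinP; exact: measurable_funM.
- by apply/measurable_EFinP; exact: measurable_funM.
- by apply: (@filterS _ _ (ae_filter_ringOfSetsType mu) _ _ _ ff) => x fx xI; rewrite fx.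
Qed.

Lemma ae01_inner2 f f' : measurable_fun I f -> measurable_fun I f' ->
  ae01_eq f f' -> inner f f = inner f' f'.
Proof.
by move=> mf mf' ff; rewrite (ae01_inner _ _ _ ff)// innerC (ae01_inner _ _ _ ff).
Qed.

(** [H1norm] relies on a weak derivative picked by choice; uniqueness almost everywhere allows any
    other one to be used. *)
Lemma sqr_H1norm f g : weak_deriv f g -> H1norm f ^+ 2 = inner f f + inner g g.
Proof.
move=> fg; rewrite sqr_sqrtr; last by rewrite addr_ge0// inner_ge0.
congr (_ + _).
have w : weak_deriv f (wderiv f) by exact: (xgetI (cst 0) fg).
by apply: ae01_inner2 (weak_deriv_unique w fg);
  [have [[] ] := w | have [[] ] := fg].
Qed.

(** Needed up to the endpoints, where boundary conditions are imposed: the interior comes from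
    differentiating the primitive of the difference, the endpoints from one-sided limits. *)
Lemma continuous_ae01_eq f g : {within `[0, 1], continuous f} ->
  {within `[0, 1], continuous g} -> ae01_eq f g ->
  forall x, 0 <= x <= 1 -> f x = g x.
Proof.
move=> cf cg fg.
pose h := fun x => f x - g x.
have ch : {within `[0, 1], continuous h} by move=> x; apply: cvgB; [exact: cf|exact: cg].
have ih := L2_integrable (continuous_L2 ch).
have h0 (y : R) : 0 <= y <= 1 -> \int[mu]_(t in `[0, y]) h t = 0.
  move=> /andP[y0 y1].
  have sub01 : `[0, y] `<=` I by apply: subset_itvl; rewrite bnd_simp.
  rewrite /Rintegral (@ae_eq_integral _ _ _ _ _ (cst 0%E)) ?integral0//.
    apply/measurable_EFinP; apply: measurable_funS sub01 _ => //.
    exact: within_continuous_measurable.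
  by apply: (@filterS _ _ (ae_filter_ringOfSetsType mu) _ _ _ fg) => x hx xI;
    rewrite /h hx ?subrr//; exact: sub01.
have [hoo h0' h1'] := (continuous_within_itvP h (@ltr01 R)).1 ch.
have hin x : 0 < x < 1 -> h x = 0.
  move=> /andP[x0 x1].
  have xI : x \in `]0, 1[ by rewrite in_itv/= x0.
  have ihp : mu.-integrable `[0, 1] (EFin \o (h \_ I)).
    apply: EFin_eq_integrable ih => // y yI; by rewrite patchE mem_set.
  have := @continuous_FTC1 R (h \_ I) (BLeft 0) x 1 x1 ihp.
  rewrite (_ : (fun _ => _) = cst 0); last by apply/funext => y; exact: primitive0_patch.
  rewrite /= derive1_cst patchE mem_set//; last by rewrite /= in_itv/= !ltW.
  rewrite lte_fin => /(_ x0) [|_ <-//].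
  rewrite /prop_for /continuous_at patchE mem_set; last by rewrite /= in_itv/= !ltW.
  by apply: cvg_patch => //; exact: ch.
suff : forall x, 0 <= x <= 1 -> h x = 0 by move=> H x /H; rewrite /h; lra.
move=> x /andP[x0 x1].
have [x00|x0'] := eqVneq x 0.
  rewrite x00; apply: (cvg_unique _ h0'); first exact: Rhausdorff.
  apply: cvg_near_cst; near=> y; apply: hin; apply/andP; split.
    by near: y; exact: nbhs_right_gt.
  by near: y; exact: nbhs_right_lt.
have [x11|x1'] := eqVneq x 1.
  rewrite x11; apply: (cvg_unique _ h1'); first exact: Rhausdorff.
  apply: cvg_near_cst; near=> y; apply: hin; apply/andP; split.
    by near: y; exact: nbhs_left_gt.
  by near: y; exact: nbhs_left_lt.
by apply: hin; rewrite !lt_neqAle x0 x1 x1' eq_sym x0'.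
Unshelve. all: by end_near. Qed.

Lemma C1_weak_deriv f f' : C1_01 f f' -> weak_deriv f f'.
Proof.
move=> [cf cf' ff']; split; first exact: continuous_L2.
move=> x /andP[x0 x1].
move: x0; rewrite le_eqVlt => /predU1P[<-|x0].
  by rewrite set_itv1 Rintegral_set1 addr0.
have sub01 : `[0, x] `<=` I by apply: subset_itvl; rewrite bnd_simp.
rewrite /Rintegral (@continuous_FTC2 R f' f 0 x)//=; first lra.
- exact: continuous_subspaceW cf'.
- have cfx : {within `[0, x], continuous f} by exact: continuous_subspaceW cf.
  have [c1 c2 c3] := (continuous_within_itvP f x0).1 cfx.
  split => // y; rewrite in_itv/= => /andP[y0 yx].
  by have [] := ff' y; rewrite ?y0 ?(lt_le_trans yx).
- move=> y; rewrite in_itv/= => /andP[y0 yx].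
  by rewrite derive1E; apply: derive_val; apply: ff'; rewrite y0 (lt_le_trans yx).
Qed.

End weak_derivatives.

(** * Convergence in L2 and Hilbert bases *)

Section L2_convergence.
Context {R : realType}.
Implicit Types f g h : R -> R.

Section Filters.
Context {T : Type} (F : set_system T) {FF : Filter F}.

Lemma L2_cvg_inner (f f' : T -> R -> R) g g' : L2_cvg F f g -> L2_cvg F f' g' ->
  inner (f s) (f' s) @[s --> F] --> inner g g'.
Proof.
move=> [Lf Lg fg] [Lf' Lg' fg'].
pose d s := L2norm (fun x => f s x - g x).
pose d' s := L2norm (fun x => f' s x - g' x).
have bnd : \forall s \near F, `|inner g g' - inner (f s) (f' s)| <=
    d s * d' s + d s * L2norm g' + L2norm g * d' s.
  near=> s.
  have L1 : L2 (f s) by near: s.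
  have L2' : L2 (f' s) by near: s.
  have B1 := L2B L1 Lg; have B2 := L2B L2' Lg'.
  rewrite distrC (_ : _ - _ = inner (fun x => f s x - g x) (fun x => f' s x - g' x)
    + inner (fun x => f s x - g x) g' + inner g (fun x => f' s x - g' x)); last first.
    by rewrite innerBl// !innerBr// innerBl//; ring.
  apply: (le_trans (ler_normD _ _)); rewrite lerD ?norm_inner_le//.
  by apply: (le_trans (ler_normD _ _)); rewrite lerD ?norm_inner_le.
apply/cvgrPdist_le => e e0.
have c0 : (d s * d' s + d s * L2norm g' + L2norm g * d' s) @[s --> F] --> (0 : R).
  rewrite -[0](_ : 0 * 0 + 0 * L2norm g' + L2norm g * 0 = 0); last by ring.
  apply: cvgD; last by apply: cvgM => //; exact: cvg_cst.
  by apply: cvgD; [exact: cvgM|apply: cvgM => //; exact: cvg_cst].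
move/cvgrPdist_le : c0 => /(_ e e0) c0.
near=> s.
have h1 : `|inner g g' - inner (f s) (f' s)| <=
    d s * d' s + d s * L2norm g' + L2norm g * d' s by near: s.
apply: (le_trans h1).
have h2 : `|0 - (d s * d' s + d s * L2norm g' + L2norm g * d' s)| <= e by near: s.
by apply: le_trans h2; rewrite sub0r normrN ler_norm.
Unshelve. all: by end_near. Qed.

Lemma L2_cvg_cst g : L2 g -> L2_cvg F (fun=> g) g.
Proof.
move=> Lg; split => //; first exact: nearW.
rewrite (_ : (fun=> _) = cst 0); first exact: cvg_cst.
apply/funext => s /=; rewrite /L2norm (@eq_inner _ _ (fun=> 0) _ (fun=> 0)).
- by rewrite inner0l sqrtr0.
- by move=> x _; rewrite subrr.
- by move=> x _; rewrite subrr.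
Qed.

Lemma L2_cvg_sqr (f : T -> R -> R) g : (\forall s \near F, L2 (f s)) -> L2 g ->
  inner (fun x => f s x - g x) (fun x => f s x - g x) @[s --> F] --> (0 : R) ->
  L2_cvg F f g.
Proof.
move=> Lf Lg fg; split => //; rewrite -[X in _ --> X]sqrtr0.
by rewrite /L2norm; apply: (continuous_cvg _ (@sqrt_continuous R 0)).
Qed.

(** The squared distance is expanded into inner products, each of which is known to converge. *)
Lemma L2_cvgD (f f' : T -> R -> R) g g' : L2_cvg F f g -> L2_cvg F f' g' ->
  L2_cvg F (fun s x => f s x + f' s x) (fun x => g x + g' x).
Proof.
move=> fg fg'; have [Lf Lg _] := fg; have [Lf' Lg' _] := fg'.
apply: L2_cvg_sqr; [by near=> s; apply: L2D; near: s|exact: L2D|].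
pose N s := inner (f s) (f s) + 2 * inner (f s) (f' s) + inner (f' s) (f' s)
  - 2 * (inner (f s) g + inner (f s) g' + inner (f' s) g + inner (f' s) g')
  + (inner g g + 2 * inner g g' + inner g' g').
have : N s @[s --> F] --> (0 : R).
  rewrite [X in _ --> X](_ : 0 = inner g g + 2 * inner g g' + inner g' g'
    - 2 * (inner g g + inner g g' + inner g' g + inner g' g')
    + (inner g g + 2 * inner g g' + inner g' g')); last by rewrite (innerC g' g); ring.
  have cg := L2_cvg_cst Lg; have cg' := L2_cvg_cst Lg'.
  apply: cvgD; last exact: cvg_cst.
  apply: cvgB.
    apply: cvgD; last exact: L2_cvg_inner.
    apply: cvgD; first exact: L2_cvg_inner.
    by apply: cvgM; [exact: cvg_cst|exact: L2_cvg_inner].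
  apply: cvgM; first exact: cvg_cst.
  do 3 (apply: cvgD; last exact: L2_cvg_inner).
  exact: L2_cvg_inner.
apply: cvg_trans; apply: near_eq_cvg; near=> s.
have L1 : L2 (f s) by near: s.
have L2' : L2 (f' s) by near: s.
have := (L2D L1 L2', L2D Lg Lg', L2B (L2D L1 L2') (L2D Lg Lg')) => -[[LD LD'] LB].
rewrite /N innerBl// !innerBr// !innerDl// !innerDr//.
by rewrite (innerC g' g) (innerC (f' s) (f s)) (innerC g (f s)) (innerC g (f' s))
  (innerC g' (f s)) (innerC g' (f' s)); ring.
Unshelve. all: by end_near. Qed.

Lemma L2_cvgZ (c : T -> R) (a : R) g : L2 g -> c s @[s --> F] --> a ->
  L2_cvg F (fun s x => c s * g x) (fun x => a * g x).
Proof.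
move=> Lg ca; apply: L2_cvg_sqr; [by near=> s; exact: L2Z|exact: L2Z|].
rewrite (_ : (fun s => _) = (fun s => (c s - a) ^+ 2 * inner g g)); last first.
  apply/funext => s.
  rewrite (@eq_inner _ _ (fun x => (c s - a) * g x) _ (fun x => (c s - a) * g x)).
  - have Lc := L2Z (c s - a) Lg.
    by rewrite innerZl// innerZr//; ring.
  - by move=> x _; rewrite mulrBl.
  - by move=> x _; rewrite mulrBl.
rewrite [X in _ --> X](_ : 0 = (a - a) ^+ 2 * inner g g); last by rewrite subrr; ring.
apply: cvgM; last exact: cvg_cst.
have h : (c s - a) @[s --> F] --> a - a by apply: cvgB => //; exact: cvg_cst.
by rewrite expr2; under eq_cvg do rewrite expr2; exact: cvgM.
Unshelve. all: by end_near. Qed.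

Lemma eq_L2_cvg (f f' : T -> R -> R) g g' : (\forall s \near F, f s = f' s) ->
  (forall x : R, 0 <= x <= 1 -> g x = g' x) -> L2_cvg F f g -> L2_cvg F f' g'.
Proof.
move=> ff gg [Lf Lg fg]; split; last first.
- apply: cvg_trans fg; apply: near_eq_cvg; near=> s.
  have -> : f s = f' s by near: s.
  by congr Num.sqrt; apply: eq_inner => x xI; rewrite gg.
- exact: eq_L2 Lg.
- near=> s; have <- : f s = f' s by near: s.
  by near: s.
Unshelve. all: by end_near. Qed.

End Filters.

Lemma L2_sum_coef (phi : nat -> R -> R) (c : nat -> R) g :
  (forall n, L2 (phi n)) -> (forall m n, inner (phi m) (phi n) = (m == n)%:R) ->
  L2_sum (fun n x => c n * phi n x) g -> forall k, inner g (phi k) = c k.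
Proof.
move=> Lphi orth sg k.
have := @L2_cvg_inner _ \oo eventually_filter _ _ _ _ sg
  (@L2_cvg_cst _ \oo eventually_filter _ (Lphi k)).
move=> /cvg_lim <- //; apply: lim_near_cst => //.
exists k.+1 => // m /= km.
have Lc n : L2 (fun x => c n * phi n x) by exact: L2Z.
rewrite inner_suml// (bigD1_seq k) ?iota_uniq ?mem_index_iota//=.
rewrite innerZl// orth eqxx mulr1 big1 ?addr0// => n nk.
by rewrite innerZl// orth (negbTE nk) mulr0.
Qed.

Section HilbertBasis.
Variable phi : nat -> R -> R.
Hypothesis hb : hilbert_basis phi.

Lemma hilbert_L2 n : L2 (phi n). Proof. by case: hb. Qed.

Lemma hilbert_orth m n : inner (phi m) (phi n) = (m == n)%:R.
Proof. by case: hb. Qed.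

Lemma L2_partial (c : nat -> R) m : L2 (fun x => \sum_(0 <= n < m) c n * phi n x).
Proof. by apply: L2_sumn => n; exact/L2Z/hilbert_L2. Qed.

Lemma inner_partial (c : nat -> R) m g : L2 g ->
  inner (fun x => \sum_(0 <= n < m) c n * phi n x) g =
  \sum_(0 <= n < m) c n * inner g (phi n).
Proof.
move=> Lg; have Lphi := hilbert_L2.
rewrite inner_suml//; last by move=> n; exact: L2Z.
by apply: eq_bigr => n _; rewrite innerZl// innerC.
Qed.

Lemma inner_partial_phi (c : nat -> R) m k :
  inner (fun x => \sum_(0 <= n < m) c n * phi n x) (phi k) =
  if (k < m)%N then c k else 0.
Proof.
rewrite inner_partial; last exact: hilbert_L2.
case: ifPn => km.
  rewrite (bigD1_seq k) ?iota_uniq ?mem_index_iota//= hilbert_orth eqxx mulr1.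
  by rewrite big1 ?addr0// => n nk; rewrite hilbert_orth eq_sym (negbTE nk) mulr0.
rewrite big_nat big1// => n nm; rewrite hilbert_orth.
case: eqP => [kn|_]; last by rewrite mulr0.
by move: km; rewrite kn; case/andP: nm => _ ->.
Qed.

Lemma Parseval f g : L2 f -> L2 g ->
  (\sum_(0 <= n < m) inner f (phi n) * inner g (phi n)) @[m --> \oo] --> inner f g.
Proof.
move=> Lf Lg; have [_ _ /(_ f Lf) sf] := hb.
have := @L2_cvg_inner _ \oo eventually_filter _ _ _ _ sf
  (@L2_cvg_cst _ \oo eventually_filter _ Lg).
by apply: cvg_trans; apply: near_eq_cvg; near=> m; rewrite inner_partial.
Unshelve. all: by end_near.
Qed.

Lemma Bessel f m : L2 f -> \sum_(0 <= n < m) inner f (phi n) ^+ 2 <= inner f f.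
Proof.
move=> Lf; set p := fun x => \sum_(0 <= n < m) inner f (phi n) * phi n x.
have Lp : L2 p by exact: L2_partial.
have := inner_ge0 (fun x => f x - p x).
have Lfp := L2B Lf Lp.
have e1 : inner p f = \sum_(0 <= n < m) inner f (phi n) ^+ 2.
  by rewrite inner_partial.
have e2 : inner p p = \sum_(0 <= n < m) inner f (phi n) ^+ 2.
  rewrite inner_partial//; apply: eq_big_nat => n /andP[_ nm].
  by rewrite inner_partial_phi nm.
rewrite innerBl// !innerBr// (innerC f p) e1 e2; lra.
Qed.

(** [residual] is a choice among possible $L^2$ sums. One exists, namely [f] minus its first [N]
    terms, and the coefficients of any sum are forced by orthonormality. *)
Lemma residualP N f : L2 f -> L2 (residual phi N f) /\
  forall k, inner (residual phi N f) (phi k) =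
    if (N <= k)%N then inner f (phi k) else 0.
Proof.
move=> Lf; pose c n := if (N <= n)%N then inner f (phi n) else 0.
have sE : (fun n x => if (N <= n)%N then inner f (phi n) * phi n x else 0) =
    (fun n x => c n * phi n x).
  by apply/funext => n; apply/funext => x; rewrite /c; case: ifP => // _; rewrite mul0r.
have [g sg] : exists g, L2_sum (fun n x => c n * phi n x) g.
  pose p := fun x => \sum_(0 <= n < N) inner f (phi n) * phi n x.
  exists (fun x => f x - p x).
  have [_ _ /(_ f Lf) sf] := hb.
  have Lp : L2 p by exact: L2_partial.
  apply: eq_L2_cvg (L2_cvgD sf (L2_cvg_cst (L2N Lp))) => //.
  exists N => // m /= Nm; apply/funext => x.
  rewrite (@big_cat_nat _ _ _ N 0 m)//= -/(p x) addrAC subrr add0r.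
  have z : \sum_(0 <= n < N) c n * phi n x = 0.
    by rewrite big_nat big1// => n /andP[_ nN]; rewrite /c leqNgt nN mul0r.
  rewrite [RHS](@big_cat_nat _ _ _ N 0 m)//= z add0r.
  by rewrite !big_nat; apply: eq_bigr => n /andP[Nn _]; rewrite /c Nn.
have h : L2_sum (fun n x => c n * phi n x) (residual phi N f).
  rewrite -sE /residual; apply: (@xgetPex _ (cst 0) [set g | L2_sum _ g]).
  by exists g; rewrite /= sE.
split; first by case: h.
exact: (L2_sum_coef hilbert_L2 hilbert_orth h).
Qed.

End HilbertBasis.

End L2_convergence.

(** * The Sturm-Liouville form *)

Lemma continuous_pos_min (R : realType) (f : R -> R) :
  {within `[0, 1], continuous f} -> (forall x : R, 0 <= x <= 1 -> 0 < f x) ->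
  exists2 c, 0 < c & forall x : R, 0 <= x <= 1 -> c <= f x.
Proof.
move=> cf f0; have [c cI hc] := EVT_min (@ler01 R) cf.
exists (f c); first by apply: f0; move: cI; rewrite in_itv.
by move=> x xI; apply: hc; rewrite in_itv.
Qed.

Lemma sqr_sum_CauchySchwarz (R : realFieldType) (T : Type) (r : seq T) (a b : T -> R) :
  (\sum_(n <- r) a n * b n) ^+ 2 <=
  (\sum_(n <- r) a n ^+ 2) * (\sum_(n <- r) b n ^+ 2).
Proof.
apply: quadratic_discr_le => [|t]; first by apply: sumr_ge0 => n _; exact: sqr_ge0.
rewrite !mulr_sumr -!big_split/=; apply: sumr_ge0 => n _.
by rewrite (_ : _ + _ = (a n + t * b n) ^+ 2) ?sqr_ge0//; ring.
Qed.

Section SturmLiouville_form.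
Context {R : realType}.
Implicit Types f g h : R -> R.
Local Notation mu := (@lebesgue_measure R).
Local Notation I := (`[0, 1]%classic : set R).
Variables (theta1 theta2 : R) (p p' q : R -> R).
Hypothesis theta1_itv : 0 < theta1 <= pi / 2.
Hypothesis theta2_itv : 0 <= theta2 <= pi / 2.
Hypothesis C1p : C1_01 p p'.
Hypothesis p_gt0 : forall x : R, 0 <= x <= 1 -> 0 < p x.
Hypothesis cq : {within `[0, 1], continuous q}.
Hypothesis q_gt0 : forall x : R, 0 <= x <= 1 -> 0 < q x.

Lemma sin_theta1_gt0 : 0 < sin theta1.
Proof.
have pi0 := pi_gt0 R; apply: sin_gt0_pi; have /andP[-> ?] := theta1_itv.
by rewrite /=; lra.
Qed.

Lemma cos_theta1_ge0 : 0 <= cos theta1.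
Proof.
have pi0 := pi_gt0 R; apply: cos_ge0_pihalf; have /andP[? ->] := theta1_itv.
by rewrite andbT; lra.
Qed.

Lemma sin_theta2_ge0 : 0 <= sin theta2.
Proof.
have pi0 := pi_gt0 R; apply: sin_ge0_pi; have /andP[-> ?] := theta2_itv.
by rewrite /=; lra.
Qed.

Lemma cos_theta2_ge0 : 0 <= cos theta2.
Proof.
have pi0 := pi_gt0 R; apply: cos_ge0_pihalf; have /andP[? ->] := theta2_itv.
by rewrite andbT; lra.
Qed.

Lemma cp : {within `[0, 1], continuous p}. Proof. by case: C1p. Qed.

(* The boundary weights vanish under a Dirichlet condition: for
   [theta2 = 0] the quotient is [0] by convention. *)
Definition bweight0 := p 0 * (cos theta1 / sin theta1).
Definition bweight1 := p 1 * (cos theta2 / sin theta2).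

Lemma bweight0_ge0 : 0 <= bweight0.
Proof.
by rewrite mulr_ge0 ?divr_ge0 ?cos_theta1_ge0 ?(ltW sin_theta1_gt0)// ltW// p_gt0// lexx ler01.
Qed.

Lemma bweight1_ge0 : 0 <= bweight1.
Proof.
by rewrite mulr_ge0 ?divr_ge0 ?cos_theta2_ge0 ?sin_theta2_ge0// ltW// p_gt0// lexx ler01.
Qed.

(* [f1] is the continuous representative of [f'], and [h = A f]. *)
Definition SL f f1 h := [/\ weak_deriv f f1, {within `[0, 1], continuous f1},
  weak_deriv (fun x => p x * f1 x) (fun x => q x * f x - h x),
  cos theta1 * f 0 - sin theta1 * f1 0 = 0 &
  cos theta2 * f 1 + sin theta2 * f1 1 = 0].

Lemma weak_deriv_L2 f f1 : weak_deriv f f1 -> L2 f.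
Proof. by move=> ff; exact/continuous_L2/weak_deriv_continuous/ff. Qed.

Lemma SL_L2 f f1 h : SL f f1 h -> [/\ L2 f, L2 f1 & L2 h].
Proof.
move=> [wf cf1 [Lr _] _ _]; have Lf := weak_deriv_L2 wf.
split => //; first by case: wf.
apply: eq_L2 (L2B (L2M_continuous Lf cq) Lr) => x _; ring.
Qed.

Lemma continuous_divp g : {within `[0, 1], continuous (fun x => p x * g x)} ->
  {within `[0, 1], continuous g}.
Proof.
move=> cpg.
apply: (@subspace_eq_continuous _ _ _ (fun x => (p x)^-1 * (p x * g x))).
  move=> x; rewrite inE/= in_itv/= => xI; rewrite /from_subspace mulKf//.
  by rewrite gt_eqF// p_gt0.
apply/subspace_continuousP => x xI; apply: cvgM.
  apply: cvgV; last by move/subspace_continuousP : cp; exact.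
  by rewrite gt_eqF// p_gt0//; move: xI; rewrite /= in_itv.
by move/subspace_continuousP : cpg; exact.
Qed.

(** Two representatives of the derivative meet here: the one in [domA] satisfies the boundary
    conditions, the one in [sl_expr] makes [p f'] weakly differentiable. Both are continuous, the
    second because [p > 0], so they agree everywhere on [[0, 1]]. *)
Lemma sl_expr_SL f h : domA theta1 theta2 f -> sl_expr p q f h ->
  exists f1, SL f f1 h.
Proof.
move=> [f1 [f2 [wf1 wf2 bc0 bc1]]] [g1 [wg1 wg2]].
exists f1.
have cf1 := weak_deriv_continuous wf2.
have cg1 : {within `[0, 1], continuous g1}.
  exact/continuous_divp/weak_deriv_continuous/wg2.
have fg := continuous_ae01_eq cf1 cg1 (weak_deriv_unique wf1 wg1).
split => //; apply: eq_weak_deriv wg2 => // x xI; by rewrite fg.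
Qed.

(** At time [0] only membership in the domain is given; the product rule then provides an image
    under [A]. *)
Lemma domA_SL f : domA theta1 theta2 f -> exists f1 h, SL f f1 h.
Proof.
move=> [f1 [f2 [wf1 wf2 bc0 bc1]]].
have := weak_derivM (C1_weak_deriv C1p) wf2.
pose k := fun x => p' x * f1 x + p x * f2 x; rewrite -/k => wk.
exists f1, (fun x => q x * f x - k x); split => //.
  exact: weak_deriv_continuous wf2.
by apply: eq_weak_deriv wk => // x _; ring.
Qed.

(** The bilinear form of [A], with the boundary terms of the integration by parts rewritten through
    the Robin conditions. Derivatives are arguments since each is only one representative. *)
Definition eform f f1 g g1 : R :=
  inner (fun x => p x * f1 x) g1 + inner (fun x => q x * f x) g +
  bweight0 * (f 0 * g 0) + bweight1 * (f 1 * g 1).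

Lemma eformC f f1 g g1 : eform f f1 g g1 = eform g g1 f f1.
Proof.
rewrite /eform (mulrC (f 0)) (mulrC (f 1)); congr (_ + _ + _ + _).
  by apply: eq_Rintegral => x _; ring.
by apply: eq_Rintegral => x _; ring.
Qed.

(** Integration by parts of [(p f')'] against [g]. The boundary conditions turn the fluxes at the
    endpoints into multiples of [f], except under a Dirichlet condition at [1]: there [f1 1] is free
    and [g 1] must vanish. *)
Lemma Green f f1 h g g1 : SL f f1 h -> weak_deriv g g1 ->
  (sin theta2 = 0 -> g 1 = 0) -> inner h g = eform f f1 g g1.
Proof.
move=> sf wg g10; have [Lf Lf1 Lh] := SL_L2 sf; have [wf cf1 wpf bc0 bc1] := sf.
have Lg := weak_deriv_L2 wg; have Lg1 : L2 g1 by case: wg.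
have [_ /(_ 1)] := weak_derivM wpf wg.
rewrite ler01 lexx => /(_ isT) E.
have Lqf := L2M_continuous Lf cq; have Lpf := L2M_continuous Lf1 cp.
rewrite RintegralD// in E; [|exact: L2_integrableM (L2B Lqf Lh) Lg|exact: L2_integrableM].
have e1 : inner (fun x => q x * f x - h x) g = inner (fun x => q x * f x) g - inner h g.
  by rewrite innerBl.
rewrite -/(inner _ g) -/(inner _ g1) e1 in E.
have b0 : p 0 * f1 0 * g 0 = bweight0 * (f 0 * g 0).
  have s0 := sin_theta1_gt0; rewrite /bweight0.
  have -> : f1 0 = cos theta1 / sin theta1 * f 0.
    by have -> : cos theta1 / sin theta1 * f 0 = f1 0 + (cos theta1 * f 0 - sin theta1 * f1 0) / sin theta1;
       [field; rewrite gt_eqF|rewrite bc0 mul0r addr0].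
  by ring.
have b1 : p 1 * f1 1 * g 1 = - (bweight1 * (f 1 * g 1)).
  have [s0|s0] := eqVneq (sin theta2) 0; first by rewrite g10//; ring.
  rewrite /bweight1.
  have -> : f1 1 = - (cos theta2 / sin theta2 * f 1).
    by have -> : - (cos theta2 / sin theta2 * f 1) =
      f1 1 - (cos theta2 * f 1 + sin theta2 * f1 1) / sin theta2;
       [field|rewrite bc1 mul0r subr0].
  by ring.
by rewrite b0 b1 in E; rewrite /eform; lra.
Qed.

Lemma SL_dirichlet f f1 h : SL f f1 h -> sin theta2 = 0 -> f 1 = 0.
Proof.
move=> [_ _ _ _ + ] s0; rewrite s0 mul0r addr0 => /eqP; rewrite mulf_eq0 => /orP[|/eqP//].
have := cos2Dsin2 theta2; rewrite s0 => + /eqP c0; rewrite c0; lra.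
Qed.

Lemma inner_SL f f1 h : SL f f1 h -> inner h f = eform f f1 f f1.
Proof.
by move=> sf; apply: Green => //; [case: sf|exact: SL_dirichlet sf].
Qed.

Lemma SL_sym f f1 h g g1 l : SL f f1 h -> SL g g1 l -> inner h g = inner l f.
Proof.
move=> sf sg; have [wf _ _ _ _] := sf; have [wg _ _ _ _] := sg.
rewrite (Green sf wg) ?(Green sg wf) 1?eformC//.
  exact: SL_dirichlet sf.
exact: SL_dirichlet sg.
Qed.

Lemma SL_lin k f f1 h g g1 l : SL f f1 h -> SL g g1 l ->
  SL (fun x => f x + k * g x) (fun x => f1 x + k * g1 x) (fun x => h x + k * l x).
Proof.
move=> [wf cf wpf f0 f1'] [wg cg wpg g0 g1']; split.
- exact: weak_derivD (weak_derivZ k wg).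
- by move=> x; apply: cvgD; [exact: cf|apply: cvgM; [exact: cvg_cst|exact: cg]].
- by apply: eq_weak_deriv (weak_derivD wpf (weak_derivZ k wpg)) => x _; ring.
- by rewrite (_ : _ - _ = (cos theta1 * f 0 - sin theta1 * f1 0) +
    k * (cos theta1 * g 0 - sin theta1 * g1 0)); [rewrite f0 g0; ring|ring].
- by rewrite (_ : _ + _ = (cos theta2 * f 1 + sin theta2 * f1 1) +
    k * (cos theta2 * g 1 + sin theta2 * g1 1)); [rewrite f1' g1'; ring|ring].
Qed.

Lemma SL0 : SL (fun=> 0) (fun=> 0) (fun=> 0).
Proof.
split; [exact: weak_deriv_cst| | |ring|ring].
  by move=> x; exact: cvg_cst.
by apply: eq_weak_deriv (weak_deriv_cst 0) => x _; ring.
Qed.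

Lemma SL_partial (c : nat -> R) (F F1 H : nat -> R -> R) m :
  (forall n, SL (F n) (F1 n) (H n)) ->
  SL (fun x => \sum_(0 <= n < m) c n * F n x)
     (fun x => \sum_(0 <= n < m) c n * F1 n x)
     (fun x => \sum_(0 <= n < m) c n * H n x).
Proof.
move=> sF; elim: m => [|m IHm].
  have := SL0; congr SL; apply/funext => x; by rewrite big_nil.
have := SL_lin (c m) IHm (sF m).
by congr SL; apply/funext => x; rewrite big_nat_recr.
Qed.

(** For every [s], [f x ^+ 2] is at most [2 * f s ^+ 2] plus twice the squared norm of the
    derivative; averaging over [s] in [[0, 1]] gives the claim. *)
Lemma weak_deriv_sqr_le f f1 x : weak_deriv f f1 -> 0 <= x <= 1 ->
  f x ^+ 2 <= 2 * inner f f + 2 * inner f1 f1.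
Proof.
move=> wf /andP[x0 x1].
have Lf := weak_deriv_L2 wf; have Lf1 : L2 f1 by case: wf.
have bnd a b : 0 <= a -> a <= b -> b <= 1 -> (f b - f a) ^+ 2 <= inner f1 f1.
  move=> a0 ab b1; rewrite (weak_derivB wf)//.
  have sub g : mu.-integrable I (EFin \o g) -> mu.-integrable `[a, b] (EFin \o g).
    by move=> ig; exact: integrable_subitv.
  have i1 := sub _ (proj2 Lf1).
  have := @integral_CauchySchwarz R `[a, b] f1 (fun=> 1).
  have -> : \int[mu]_(s in `[a, b]) (f1 s * 1) = \int[mu]_(s in `[a, b]) f1 s.
    by apply: eq_Rintegral => s _; rewrite mulr1.
  rewrite expr1n Rintegral_cst_itv// mul1r => CS.
  apply: le_trans (CS _ i1 _ _) _ => //.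
  - by apply: sub; exact/L2_integrable/L2_cst.
  - apply: EFin_eq_integrable (sub _ (L2_integrable Lf1)) => // s _.
    by rewrite mulr1.
  have l0 : 0 <= \int[mu]_(s in `[a, b]) f1 s ^+ 2.
    by apply: Rintegral_ge0 => s _; exact: sqr_ge0.
  have le1 : \int[mu]_(s in `[a, b]) f1 s ^+ 2 <= inner f1 f1.
    have -> : inner f1 f1 = \int[mu]_(s in `[0, 1]) (f1 s ^+ 2).
      by apply: eq_Rintegral => s _; rewrite expr2.
    have i2 := proj2 Lf1.
    have n1 : 0 <= \int[mu]_(s in `[0, a]) f1 s ^+ 2.
      by apply: Rintegral_ge0 => s _; exact: sqr_ge0.
    have n2 : 0 <= \int[mu]_(s in `[b, 1]) f1 s ^+ 2.
      by apply: Rintegral_ge0 => s _; exact: sqr_ge0.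
    rewrite -(Rintegral_itvBcc i2 (le_trans a0 ab) b1 (lexx 1)) in n2.
    rewrite subr_ge0 in n2; apply: le_trans n2.
    by rewrite -(Rintegral_itvBcc i2 a0 ab b1) gerBl.
  apply: le_trans le1; rewrite ler_piMr//.
  by apply: le_trans b1; rewrite gerBl.
have sq s : 0 <= s <= 1 -> f x ^+ 2 <= 2 * f s ^+ 2 + 2 * inner f1 f1.
  move=> /andP[s0 s1].
  have : (f x - f s) ^+ 2 <= inner f1 f1.
    have [sx|/ltW xs] := leP s x; first exact: bnd.
    by rewrite -sqrrN opprB; exact: bnd.
  have := sqr_ge0 (f x - 2 * f s); nra.
have -> : f x ^+ 2 = \int[mu]_(s in I) (f x ^+ 2).
  by rewrite Rintegral_cst_itv// subr0 mulr1.
have -> : 2 * inner f f + 2 * inner f1 f1 =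
    \int[mu]_(s in I) (2 * f s ^+ 2 + 2 * inner f1 f1).
  rewrite RintegralD//; [|exact/EFin_integrableZl/(proj2 Lf)|exact/L2_integrable/L2_cst].
  rewrite Rintegral_cst_itv// RintegralZl//; last exact: (proj2 Lf).
  by rewrite subr0 mulr1.
apply: le_Rintegral => //.
- exact/L2_integrable/L2_cst.
- apply: EFin_integrableD => //; last exact/L2_integrable/L2_cst.
  exact/EFin_integrableZl/(proj2 Lf).
Qed.

Lemma eform_lower : exists2 c, 0 < c & forall f f1, weak_deriv f f1 ->
  c * (inner f f + inner f1 f1) <= eform f f1 f f1.
Proof.
have [cp' cp0 hp] := continuous_pos_min cp p_gt0.
have [cq' cq0 hq] := continuous_pos_min cq q_gt0.
exists (Num.min cp' cq'); first by rewrite lt_min cp0.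
move=> f f1 wf; have Lf := weak_deriv_L2 wf; have Lf1 : L2 f1 by case: wf.
have b0 : 0 <= bweight0 * (f 0 * f 0) by rewrite mulr_ge0 ?bweight0_ge0// -expr2 sqr_ge0.
have b1 : 0 <= bweight1 * (f 1 * f 1) by rewrite mulr_ge0 ?bweight1_ge0// -expr2 sqr_ge0.
have low (r : R -> R) g (c : R) : L2 g -> {within `[0, 1], continuous r} ->
    (forall x : R, 0 <= x <= 1 -> c <= r x) ->
    c * inner g g <= inner (fun x => r x * g x) g.
  move=> Lg cr hr; rewrite -innerZl//.
  have Lc := L2Z c Lg; have Lr := L2M_continuous Lg cr.
  apply: le_Rintegral => //; [exact: L2_integrableM|exact: L2_integrableM|].
  move=> x /=; rewrite in_itv/= => xI; rewrite -!mulrA ler_wpM2r ?hr//.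
  by rewrite -expr2 sqr_ge0.
have := low p f1 (Num.min cp' cq') Lf1 cp; have := low q f (Num.min cp' cq') Lf cq.
move=> l1 l2; rewrite mulrDr /eform.
have m1 : Num.min cp' cq' <= cp' by rewrite ge_min lexx.
have m2 : Num.min cp' cq' <= cq' by rewrite ge_min lexx orbT.
have {}l1 := l1 (fun x xI => le_trans m2 (hq x xI)).
have {}l2 := l2 (fun x xI => le_trans m1 (hp x xI)).
lra.
Qed.

(** The boundary terms are point values, so the trace inequality bounds them by the $H^1$ norm; this
    accounts for the factors 2 on the weights. *)
Lemma eform_upper : exists2 c, 0 < c & forall f f1, weak_deriv f f1 ->
  eform f f1 f f1 <= c * (inner f f + inner f1 f1).
Proof.
have [cp' cp0 hp] := within_continuous_bounded cp.
have [cq' cq0 hq] := within_continuous_bounded cq.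
have [b0 b1] := (bweight0_ge0, bweight1_ge0).
exists (cp' + cq' + 2 * bweight0 + 2 * bweight1).
  by lra.
move=> f f1 wf; have Lf := weak_deriv_L2 wf; have Lf1 : L2 f1 by case: wf.
have h0 := @weak_deriv_sqr_le f f1 0 wf; have h1 := @weak_deriv_sqr_le f f1 1 wf.
rewrite lexx ler01 in h0; rewrite ler01 lexx in h1.
have upp (r : R -> R) g (c : R) : L2 g -> {within `[0, 1], continuous r} ->
    (forall x : R, 0 <= x <= 1 -> `|r x| <= c) ->
    inner (fun x => r x * g x) g <= c * inner g g.
  move=> Lg cr hr; rewrite -innerZl//.
  have Lc := L2Z c Lg; have Lr := L2M_continuous Lg cr.
  apply: le_Rintegral => //; [exact: L2_integrableM|exact: L2_integrableM|].
  move=> x /=; rewrite in_itv/= => xI; rewrite -!mulrA ler_wpM2r//.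
    by rewrite -expr2 sqr_ge0.
  by rewrite (le_trans (ler_norm _))// hr.
have := upp p f1 cp' Lf1 cp hp; have := upp q f cq' Lf cq hq.
rewrite /eform -!expr2.
have := h0 isT; have := h1 isT.
have := inner_ge0 f; have := inner_ge0 f1 => i1 i2 h0' h1' u1 u2.
have m0 : bweight0 * f 0 ^+ 2 <= bweight0 * (2 * inner f f + 2 * inner f1 f1).
  by rewrite ler_wpM2l.
have m1 : bweight1 * f 1 ^+ 2 <= bweight1 * (2 * inner f f + 2 * inner f1 f1).
  by rewrite ler_wpM2l.
have m2 : 0 <= cp' * inner f f by rewrite mulr_ge0// ltW.
have m3 : 0 <= cq' * inner f1 f1 by rewrite mulr_ge0// ltW.
lra.
Qed.

(** The trace inequality combined with coercivity: point evaluation is continuous for the energy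
    norm. *)
Lemma point_eval_bound : exists2 C, 0 < C & forall f f1 h x, SL f f1 h ->
  0 <= x <= 1 -> f x ^+ 2 <= C * inner h f.
Proof.
have [c c0 hc] := eform_lower; exists (2 / c); first by rewrite divr_gt0.
move=> f f1 h x sf xI; have [wf _ _ _ _] := sf.
rewrite (inner_SL sf) mulrAC ler_pdivlMr//.
have := hc _ _ wf; have := weak_deriv_sqr_le wf xI => a b.
apply: le_trans (_ : 2 * (c * (inner f f + inner f1 f1)) <= _); last lra.
nra.
Qed.

End SturmLiouville_form.

(** * Spectrum and tail estimates *)

Lemma seq_lim_le (R : realType) (u : nat -> R) (l b : R) :
  u n @[n --> \oo] --> l -> (\forall n \near \oo, u n <= b) -> l <= b.
Proof. by move=> ul; apply: cvgr_to_le. Qed.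

Lemma seq_lim_ge (R : realType) (u : nat -> R) (l b : R) :
  u n @[n --> \oo] --> l -> (\forall n \near \oo, b <= u n) -> b <= l.
Proof. by move=> ul; apply: cvgr_to_ge. Qed.

Section SturmLiouville_spectrum.
Context {R : realType}.
Implicit Types f g h : R -> R.
Local Notation mu := (@lebesgue_measure R).
Variables (theta1 theta2 : R) (p p' q : R -> R).
Variables (lam : nat -> R) (phi : nat -> R -> R).
Hypothesis theta1_itv : 0 < theta1 <= pi / 2.
Hypothesis theta2_itv : 0 <= theta2 <= pi / 2.
Hypothesis C1p : C1_01 p p'.
Hypothesis p_gt0 : forall x : R, 0 <= x <= 1 -> 0 < p x.
Hypothesis cq : {within `[0, 1], continuous q}.
Hypothesis q_gt0 : forall x : R, 0 <= x <= 1 -> 0 < q x.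
Hypothesis spec : sl_spectrum theta1 theta2 p q lam phi.

Local Notation SL := (SL theta1 theta2 p q).

Lemma spectrum_basis : hilbert_basis phi. Proof. by case: spec. Qed.
Local Notation hb := spectrum_basis.

Lemma spectrum_SL : exists phi1 : nat -> R -> R,
  forall n, SL (phi n) (phi1 n) (fun x => lam n * phi n x).
Proof.
have h n : exists f1, SL (phi n) f1 (fun x => lam n * phi n x).
  have [_ _ /(_ n)[d s] _] := spec.
  exact: (sl_expr_SL C1p p_gt0 d s).
by have [phi1] := choice h; exists phi1.
Qed.

Lemma eigenvalue_gt0 n : 0 < lam n.
Proof.
have [phi1 /(_ n) s] := spectrum_SL.
have := inner_SL theta1_itv C1p cq s.
rewrite innerZl; [|exact: hilbert_L2 hb n..].
rewrite (hilbert_orth hb) eqxx mulr1 => ->.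
have [c c0 hc] := eform_lower theta1_itv theta2_itv C1p p_gt0 cq q_gt0.
have [w _ _ _ _] := s; apply: lt_le_trans (hc _ _ w).
by rewrite mulr_gt0// (hilbert_orth hb) eqxx ltr_pwDl ?inner_ge0.
Qed.

Lemma inner_SL_phi f f1 h n : SL f f1 h -> inner h (phi n) = lam n * inner f (phi n).
Proof.
move=> sf; have [phi1 /(_ n) s] := spectrum_SL.
rewrite (SL_sym theta1_itv C1p cq sf s) innerZl ?(innerC (phi n))//.
  exact: hilbert_L2 hb n.
by have [] := SL_L2 cq sf.
Qed.

Lemma SL_phi_partial (c : nat -> R) m : exists f1,
  SL (fun x => \sum_(0 <= n < m) c n * phi n x) f1
     (fun x => \sum_(0 <= n < m) (c n * lam n) * phi n x).
Proof.
have [phi1 s] := spectrum_SL.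
exists (fun x => \sum_(0 <= n < m) c n * phi1 n x).
have := SL_partial c m s; congr SL; apply/funext => x.
by apply: eq_bigr => n _; rewrite mulrA.
Qed.

(* Testing the bound on point evaluation against the truncated Green function
   [sum phi_n(x) phi_n / lam_n], whose energy equals its value at [x]. *)
Lemma Green_partial_bound : exists2 C, 0 < C & forall x m, 0 <= x <= 1 ->
  \sum_(0 <= n < m) phi n x ^+ 2 / lam n <= C.
Proof.
have [C C0 hC] := point_eval_bound theta1_itv theta2_itv C1p p_gt0 cq q_gt0.
exists C => // x m xI.
set S := \sum_(0 <= n < m) _.
have S0 : 0 <= S.
  by apply: sumr_ge0 => n _; rewrite divr_ge0 ?sqr_ge0// ltW// eigenvalue_gt0.
pose c n := phi n x / lam n.
have [f1 s] := SL_phi_partial c m.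
have := hC _ _ _ _ s xI.
have -> : \sum_(0 <= n < m) c n * phi n x = S.
  by apply: eq_bigr => n _; rewrite /c expr2 mulrAC.
rewrite inner_partial; [|exact: hb|exact: L2_partial hb _ _].
have -> : \sum_(0 <= n < m) c n * lam n *
    inner (fun x => \sum_(0 <= n < m) c n * phi n x) (phi n) = S.
  apply: eq_big_nat => n /andP[_ nm]; rewrite inner_partial_phi ?nm; last exact: hb.
  by rewrite /c divfK ?gt_eqF ?eigenvalue_gt0// expr2 mulrA.
move=> SC; rewrite leNgt; apply/negP => CS.
have S1 : 0 < S by apply: lt_trans CS.
by move: SC; rewrite expr2 ler_pM2r// leNgt CS.
Qed.

(** The diagonal of the truncated Green function is bounded uniformly in [x]; integrating it over
    [[0, 1]] leaves the sum of inverses, as the [phi n] have unit norm. *)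
Lemma eigenvalue_trace_bound : exists2 C, 0 < C & forall m,
  \sum_(0 <= n < m) (lam n)^-1 <= C.
Proof.
have [C C0 hC] := Green_partial_bound; exists C => // m.
have Lphi := hilbert_L2 hb.
pose u m x := \sum_(0 <= n < m) phi n x ^+ 2 / lam n.
have [iu <-] : mu.-integrable `[0, 1] (EFin \o u m) /\
    \int[mu]_(x in `[0, 1]) u m x = \sum_(0 <= n < m) (lam n)^-1.
  elim: m => [|m [iu IHm]].
    have u0 x : u 0%N x = 0 by rewrite /u big_nil.
    split; first by apply: EFin_eq_integrable (L2_integrable (L2_cst 0)).
    rewrite big_nil (_ : u 0%N = fun=> 0); last exact/funext.
    by rewrite Rintegral_cst_itv// mul0r.
  have uS : u m.+1 = fun x => u m x + (lam m)^-1 * phi m x ^+ 2.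
    by apply/funext => x; rewrite /u big_nat_recr//= [in RHS]mulrC.
  have i2 : mu.-integrable `[0, 1] (EFin \o (fun x => (lam m)^-1 * phi m x ^+ 2)).
    exact/EFin_integrableZl/(proj2 (Lphi m)).
  split; first by rewrite uS; exact: EFin_integrableD.
  rewrite uS RintegralD// IHm big_nat_recr//= RintegralZl//; last exact: (proj2 (Lphi m)).
  have -> : \int[mu]_(x in `[0, 1]) (phi m x ^+ 2) = inner (phi m) (phi m).
    by apply: eq_Rintegral => x _; rewrite expr2.
  by rewrite (hilbert_orth hb) eqxx mulr1.
have -> : C = \int[mu]_(x in `[0, 1]) C by rewrite Rintegral_cst_itv// subr0 mulr1.
apply: le_Rintegral => //; first exact/L2_integrable/L2_cst.
by move=> x /=; rewrite in_itv/= => xI; exact: hC.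
Qed.

(** Source of the divergence of [lam], which [sl_spectrum] does not state: by monotonicity
    [m / lam m] is at most the sum of the first [m] inverses, and these sums are bounded. *)
Lemma eigenvalue_linear_growth : exists2 C, 0 < C & forall m : nat, m%:R <= C * lam m.
Proof.
have [C C0 hC] := eigenvalue_trace_bound; exists C => // m.
have l0 := eigenvalue_gt0.
rewrite -ler_pdivrMr//; apply: le_trans (hC m).
have -> : m%:R / lam m = \sum_(0 <= n < m) (lam m)^-1.
  by rewrite sumr_const_nat subn0 mulr_natl.
rewrite big_nat [leRHS]big_nat; apply: ler_sum => n /andP[_ nm].
rewrite lef_pV2 ?posrE// ltW//.
by have [+ _ _ _] := spec; apply.
Qed.


Lemma M_phi_le : exists2 C, 0 < C & forall N, (M_phi lam phi N <= C%:E)%E.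
Proof.
have [C C0 hC] := Green_partial_bound; exists C => // N.
have t0 n : (0 <= (`|phi n 0| ^+ 2 / lam n)%:E)%E.
  by rewrite lee_fin divr_ge0 ?sqr_ge0// ltW// eigenvalue_gt0.
apply: lime_le; first by apply: is_cvg_nneseries => n _ _; exact: t0.
apply: nearW => m; rewrite sumEFin lee_fin.
have x0 : 0 <= (0 : R) <= 1 by rewrite lexx ler01.
have [Nm|mN] := leqP N m; last by rewrite big_geq ?ltW// ltnW.
apply: le_trans (hC 0 m x0).
rewrite [leRHS](@big_cat_nat _ _ _ N 0 m)//=.
rewrite (eq_bigr (fun n => phi n 0 ^+ 2 / lam n)); last first.
  by move=> n _; rewrite real_normK// num_real.
rewrite lerDr; apply: sumr_ge0 => n _.
by rewrite divr_ge0 ?sqr_ge0// ltW// eigenvalue_gt0.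
Qed.

Lemma M_phi_lty N : (M_phi lam phi N < +oo)%E.
Proof.
by have [C _ /(_ N) h] := M_phi_le; apply: le_lt_trans h _; rewrite ltry.
Qed.

Lemma M_phi_ge0 N : (0 <= M_phi lam phi N)%E.
Proof.
apply: nneseries_ge0 => n _ _.
by rewrite lee_fin divr_ge0 ?sqr_ge0// ltW// eigenvalue_gt0.
Qed.

Lemma fine_M_phi_ge0 N : 0 <= fine (M_phi lam phi N).
Proof. exact: fine_ge0 (M_phi_ge0 N). Qed.

Lemma fine_M_phi_le : exists2 C, 0 < C & forall N, fine (M_phi lam phi N) <= C.
Proof.
have [C C0 hC] := M_phi_le; exists C => // N.
rewrite -lee_fin fineK//; rewrite ge0_fin_numE ?M_phi_ge0//; exact: M_phi_lty.
Qed.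

Lemma partial_M_phi N m :
  \sum_(N <= n < m) phi n 0 ^+ 2 / lam n <= fine (M_phi lam phi N).
Proof.
rewrite -lee_fin fineK; last by rewrite ge0_fin_numE ?M_phi_ge0//; exact: M_phi_lty.
rewrite (eq_bigr (fun n => `|phi n 0| ^+ 2 / lam n)); last first.
  by move=> n _; rewrite real_normK// num_real.
rewrite -sumEFin; apply: nneseries_lim_ge => n _ _.
by rewrite lee_fin divr_ge0 ?sqr_ge0// ltW// eigenvalue_gt0.
Qed.

Section Tail.
Variables (f f1 h : R -> R) (N : nat).
Hypothesis sf : SL f f1 h.

Let c n := inner f (phi n).

Let Lf : L2 f. Proof. by have [] := SL_L2 cq sf. Qed.
Let Lh : L2 h. Proof. by have [] := SL_L2 cq sf. Qed.

(** Total minus head rather than a series: along a trajectory only the energy and finitely many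
    modes then have to be differentiated. *)
Definition tail_energy := inner h f - \sum_(0 <= n < N) lam n * c n ^+ 2.
Definition tail_image x := h x - \sum_(0 <= n < N) (lam n * c n) * phi n x.

Lemma energy_cvg :
  (\sum_(0 <= n < m) lam n * c n ^+ 2) @[m --> \oo] --> inner h f.
Proof.
have := Parseval hb Lh Lf; apply: cvg_trans; apply: near_eq_cvg; near=> m.
by apply: eq_bigr => n _; rewrite (inner_SL_phi _ sf) /c expr2 mulrA.
Unshelve. all: by end_near. Qed.

Lemma tail_energy_cvg :
  (\sum_(N <= n < m) lam n * c n ^+ 2) @[m --> \oo] --> tail_energy.
Proof.
have h0 : (\sum_(0 <= n < m) lam n * c n ^+ 2 - \sum_(0 <= n < N) lam n * c n ^+ 2)
  @[m --> \oo] --> tail_energy by apply: cvgB; [exact: energy_cvg|exact: cvg_cst].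
apply: cvg_trans h0; apply: near_eq_cvg; near=> m.
have Nm : (N <= m)%N by near: m; exact: nbhs_infty_ge.
by rewrite (@big_cat_nat _ _ _ N 0 m)//= addrAC subrr add0r.
Unshelve. all: by end_near. Qed.

Lemma tail_partial_le m : \sum_(N <= n < m) lam n * c n ^+ 2 <= tail_energy.
Proof.
apply: (seq_lim_ge tail_energy_cvg); near=> k.
have mk : (m <= k)%N by near: k; exact: nbhs_infty_ge.
have t0 n : 0 <= lam n * c n ^+ 2 by rewrite mulr_ge0 ?sqr_ge0// ltW// eigenvalue_gt0.
have [Nm|mN] := leqP N m; last by rewrite big_geq ?sumr_ge0// ltnW.
by rewrite [leRHS](@big_cat_nat _ _ _ m N k)//= lerDl sumr_ge0.
Unshelve. all: by end_near. Qed.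

Lemma tail_energy_ge0 : 0 <= tail_energy.
Proof. by apply: le_trans (tail_partial_le N); rewrite big_geq. Qed.

(** Convergence in $L^2$ says nothing at a point. The remainder of the expansion stays in the domain
    of [A], so its value at [0] is controlled by its energy, which is a tail of the convergent
    energy series. *)
Lemma point_eval_cvg :
  (\sum_(0 <= n < m) c n * phi n 0) @[m --> \oo] --> f 0.
Proof.
have [C C0 hC] := point_eval_bound theta1_itv theta2_itv C1p p_gt0 cq q_gt0.
have x0 : 0 <= (0 : R) <= 1 by rewrite lexx ler01.
have bnd m : (f 0 - \sum_(0 <= n < m) c n * phi n 0) ^+ 2 <=
    C * (inner h f - \sum_(0 <= n < m) lam n * c n ^+ 2).
  have [g1 sg] := SL_phi_partial c m.
  have := hC _ _ _ _ (SL_lin (-1) sf sg) x0.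
  have Lp := L2_partial hb c m; have Lq := L2_partial hb (fun n => c n * lam n) m.
  rewrite !mulN1r.
  have -> : inner (fun x => h x + -1 * \sum_(0 <= n < m) c n * lam n * phi n x)
     (fun x => f x + -1 * \sum_(0 <= n < m) c n * phi n x) =
     inner h f - \sum_(0 <= n < m) lam n * c n ^+ 2.
    have LNp := L2Z (-1) Lp; have LNq := L2Z (-1) Lq.
    rewrite innerDl//; last exact: L2D.
    rewrite innerZl//; last exact: L2D.
    rewrite !innerDr// !innerZr// (SL_sym theta1_itv C1p cq sf sg).
    rewrite !(inner_partial hb)//.
    have e1 : \sum_(0 <= n < m) c n * lam n * inner f (phi n) =
        \sum_(0 <= n < m) lam n * c n ^+ 2.
      by apply: eq_bigr => n _; rewrite /c; ring.
    have e2 : \sum_(0 <= n < m) c n * lam n *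
        inner (fun x => \sum_(0 <= n < m) c n * phi n x) (phi n) =
        \sum_(0 <= n < m) lam n * c n ^+ 2.
      apply: eq_big_nat => n /andP[_ nm].
      by rewrite inner_partial_phi ?nm; [rewrite /c; ring|exact: hb].
    by rewrite e1 e2; ring.
  by [].
have E0 : (C * (inner h f - \sum_(0 <= n < m) lam n * c n ^+ 2)) @[m --> \oo] --> (0 : R).
  rewrite [X in _ --> X](_ : 0 = C * (inner h f - inner h f)); last by rewrite subrr mulr0.
  by apply: cvgM; [exact: cvg_cst|apply: cvgB; [exact: cvg_cst|exact: energy_cvg]].
apply/cvgrPdist_lt => e e0.
have /cvgrPdist_lt/(_ _ (exprn_gt0 2 e0)) H := E0.
near=> m.
have : `|0 - C * (inner h f - \sum_(0 <= n < m) lam n * c n ^+ 2)| < e ^+ 2 by near: m.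
rewrite sub0r normrN => /(le_lt_trans (ler_norm _)) /(le_lt_trans (bnd m)).
rewrite -(real_normK (num_real (f 0 - _))) ltr_pXn2r ?nnegrE// ltW//.
Unshelve. all: by end_near. Qed.

Lemma tail_point_eval :
  (f 0 - \sum_(0 <= n < N) c n * phi n 0) ^+ 2 <=
  fine (M_phi lam phi N) * tail_energy.
Proof.
have h0 : ((\sum_(0 <= n < m) c n * phi n 0 - \sum_(0 <= n < N) c n * phi n 0) ^+ 2)
    @[m --> \oo] --> (f 0 - \sum_(0 <= n < N) c n * phi n 0) ^+ 2.
  have h1 : (\sum_(0 <= n < m) c n * phi n 0 - \sum_(0 <= n < N) c n * phi n 0)
    @[m --> \oo] --> f 0 - \sum_(0 <= n < N) c n * phi n 0.
    by apply: cvgB; [exact: point_eval_cvg|exact: cvg_cst].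
  by rewrite expr2; under eq_cvg do rewrite expr2; exact: cvgM.
apply: (seq_lim_le h0); near=> m.
have Nm : (N <= m)%N by near: m; exact: nbhs_infty_ge.
rewrite (@big_cat_nat _ _ _ N 0 m)//= addrAC subrr add0r.
have l0 := eigenvalue_gt0.
have -> : \sum_(N <= n < m) c n * phi n 0 =
    \sum_(N <= n < m) (phi n 0 / Num.sqrt (lam n)) * (Num.sqrt (lam n) * c n).
  apply: eq_bigr => n _; rewrite mulrA divfK 1?mulrC//.
  by rewrite gt_eqF// sqrtr_gt0.
apply: le_trans (sqr_sum_CauchySchwarz _ _ _) _.
apply: ler_pM; try by apply: sumr_ge0 => n _; exact: sqr_ge0.
  apply: le_trans (partial_M_phi N m); apply: ler_sum => n _.
  by rewrite expr_div_n sqr_sqrtr// ltW.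
apply: le_trans (tail_partial_le m); apply: ler_sum => n _.
by rewrite exprMn sqr_sqrtr// ltW.
Unshelve. all: by end_near. Qed.

Lemma tail_image_L2 : L2 tail_image.
Proof. exact: L2B (L2_partial hb _ _). Qed.

Lemma inner_tail_phi n :
  inner tail_image (phi n) = if (N <= n)%N then lam n * c n else 0.
Proof.
have Lphi := hilbert_L2 hb n.
rewrite innerBl//; last exact: L2_partial hb _ _.
rewrite (inner_SL_phi _ sf) inner_partial_phi; last exact: hb.
by rewrite ltnNge; case: leqP => _ /=; rewrite ?subr0 ?subrr.
Qed.

(** Spectral gap: beyond [N] each coefficient of the image carries one more factor at least [lam N]
    than the energy. This is the damping that appears in [Theta2]. *)
Lemma tail_image_norm : lam N * tail_energy <= inner tail_image tail_image.
Proof.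
have LT := tail_image_L2.
have h0 : (lam N * \sum_(N <= n < m) lam n * c n ^+ 2) @[m --> \oo] -->
    lam N * tail_energy.
  by apply: cvgM; [exact: cvg_cst|exact: tail_energy_cvg].
apply: (seq_lim_le h0); near=> m.
apply: le_trans (Bessel hb m LT).
have Nm : (N <= m)%N by near: m; exact: nbhs_infty_ge.
rewrite [leRHS](@big_cat_nat _ _ _ N 0 m)//= ler_wpDl//.
  by apply: sumr_ge0 => n _; exact: sqr_ge0.
rewrite mulr_sumr; apply: ler_sum_nat => n /andP[Nn _].
rewrite inner_tail_phi Nn exprMn mulrA ler_wpM2r ?sqr_ge0// expr2.
have l0 := eigenvalue_gt0; rewrite ler_wpM2r ?(ltW (l0 _))//.
move: Nn; rewrite leq_eqVlt => /predU1P[->//|Nn]; rewrite ltW//.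
by have [+ _ _ _] := spec; apply.
Unshelve. all: by end_near. Qed.

(** The tail image has no mode below [N], so the input functions act on it only through their
    residuals; hence the norms occurring in [Theta1]. *)
Lemma tail_inner_residual a : L2 a ->
  inner tail_image a = inner tail_image (residual phi N a).
Proof.
move=> La; have [Lr rE] := residualP hb N La; have LT := tail_image_L2.
have h1 := Parseval hb LT La; have h2 := Parseval hb LT Lr.
apply: (cvg_unique _ h1); first exact: Rhausdorff.
apply: cvg_trans h2; apply: near_eq_cvg; near=> m.
apply: eq_bigr => n _; rewrite inner_tail_phi rE.
by case: leqP => _; rewrite ?mul0r.
Unshelve. all: by end_near. Qed.

End Tail.

Lemma residual_norm_le a N : L2 a -> L2norm (residual phi N a) <= L2norm a.
Proof.
move=> La; rewrite ler_wsqrtr//.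
have [Lr rE] := residualP hb N La.
apply: (seq_lim_le (Parseval hb Lr Lr)); near=> m.
apply: le_trans (Bessel hb m La); apply: ler_sum => n _.
rewrite rE; case: leqP => _; first by rewrite -expr2.
by rewrite mul0r sqr_ge0.
Unshelve. all: by end_near. Qed.

End SturmLiouville_spectrum.

(** * Quadratic forms and Lyapunov matrices *)

Section quadratic_forms.
Context {R : realType}.

Definition sqn n (x : 'cV[R]_n) : R := \sum_i x i 0 ^+ 2.

Lemma sqn_ge0 n (x : 'cV[R]_n) : 0 <= sqn x.
Proof. by apply: sumr_ge0 => i _; exact: sqr_ge0. Qed.

Lemma sqnE n (x : 'cV[R]_n) : sqn x = (x^T *m x) 0 0.
Proof. by rewrite mxE; apply: eq_bigr => i _; rewrite mxE expr2. Qed.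

Lemma sqr_le_sqn n (x : 'cV[R]_n) i : x i 0 ^+ 2 <= sqn x.
Proof. by rewrite /sqn (bigD1 i)//= lerDl sumr_ge0// => j _; exact: sqr_ge0. Qed.

Lemma sqn_col_mx m n (x : 'cV[R]_m) (y : 'cV[R]_n) :
  sqn (col_mx x y) = sqn x + sqn y.
Proof.
rewrite /sqn big_split_ord/=; congr (_ + _); apply: eq_bigr => i _.
  by rewrite col_mxEu.
by rewrite col_mxEd.
Qed.

Lemma qformE m n (x : 'cV[R]_m) (M : 'M[R]_(m, n)) (y : 'cV[R]_n) :
  (x^T *m M *m y) 0 0 = \sum_i \sum_j x i 0 * M i j * y j 0.
Proof.
rewrite -mulmxA mxE; apply: eq_bigr => i _; rewrite !mxE mulr_sumr.
by apply: eq_bigr => j _; rewrite mulrA.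
Qed.

Lemma qformC m n (x : 'cV[R]_m) (M : 'M[R]_(m, n)) (y : 'cV[R]_n) :
  (x^T *m M *m y) 0 0 = (y^T *m M^T *m x) 0 0.
Proof.
transitivity ((x^T *m M *m y)^T 0 0); first by rewrite [RHS]mxE.
by rewrite !trmx_mul trmxK mulmxA.
Qed.

Lemma bilinear_bound m n (M : 'M[R]_(m, n)) : exists2 C, 0 < C &
  forall x y, `|(x^T *m M *m y) 0 0| <= C * (sqn x + sqn y).
Proof.
exists (1 + \sum_i \sum_j `|M i j|).
  rewrite ltr_pwDl// sumr_ge0// => i _; exact: sumr_ge0.
move=> x y; rewrite qformE; apply: le_trans (ler_norm_sum _ _ _) _.
apply: le_trans (_ : (\sum_i \sum_j `|M i j|) * (sqn x + sqn y) <= _); last first.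
  by rewrite ler_wpM2r ?addr_ge0 ?sqn_ge0// lerDr.
rewrite mulr_suml; apply: ler_sum => i _.
apply: le_trans (ler_norm_sum _ _ _) _; rewrite mulr_suml; apply: ler_sum => j _.
rewrite mulrAC normrM mulrC ler_wpM2l//.
have := sqr_le_sqn x i; have := sqr_le_sqn y j.
rewrite normrM -(real_normK (num_real (x i 0))) -(real_normK (num_real (y j 0))).
have := sqr_ge0 (`|x i 0| - `|y j 0|); have := sqr_ge0 (`|x i 0| + `|y j 0|); nra.
Qed.

Lemma qform_bound n (M : 'M[R]_n) : exists2 C, 0 < C &
  forall x : 'cV[R]_n, (x^T *m M *m x) 0 0 <= C * sqn x.
Proof.
have [C C0 hC] := bilinear_bound M; exists (2 * C); first by rewrite mulr_gt0.
move=> x; apply: le_trans (ler_norm _) _; apply: le_trans (hC x x) _; lra.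
Qed.

Lemma qform_lin n (P : 'M[R]_n) (x y : 'cV[R]_n) t : P^T = P ->
  ((x + t *: y)^T *m P *m (x + t *: y)) 0 0 =
  (x^T *m P *m x) 0 0 + 2 * t * (x^T *m P *m y) 0 0 + t ^+ 2 * (y^T *m P *m y) 0 0.
Proof.
move=> Ps; have -> : (x + t *: y)^T = x^T + t *: y^T by rewrite linearD linearZ.
rewrite !mulmxDl !mulmxDr -!scalemxAl -!scalemxAr.
have e : (y^T *m P *m x) 0 0 = (x^T *m P *m y) 0 0 by rewrite qformC Ps.
rewrite scalerA.
have -> (A B C D : 'M[R]_1) : (A + B + (C + D)) 0 0 = A 0 0 + B 0 0 + (C 0 0 + D 0 0).
  by rewrite !mxE.
have sE (k : R) (A : 'M[R]_1) : (k *: A) 0 0 = k * A 0 0 by rewrite mxE.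
by rewrite !sE e; ring.
Qed.

Lemma posdef_ge0 n (P : 'M[R]_n) (x : 'cV[R]_n) : posdef P -> 0 <= (x^T *m P *m x) 0 0.
Proof.
move=> [_ P0]; have [->|x0] := eqVneq x 0; first by rewrite mulmx0 mxE.
exact/ltW/P0.
Qed.

Lemma posdef_CauchySchwarz n (P : 'M[R]_n) (x y : 'cV[R]_n) : posdef P ->
  ((x^T *m P *m y) 0 0) ^+ 2 <= (x^T *m P *m x) 0 0 * (y^T *m P *m y) 0 0.
Proof.
move=> Pp; apply: quadratic_discr_le => [|t]; first exact: posdef_ge0.
by rewrite -qform_lin; [exact: posdef_ge0|case: Pp].
Qed.

Lemma posdef_unitmx n (P : 'M[R]_n) : posdef P -> P \in unitmx.
Proof.
move=> [Ps P0]; rewrite -row_free_unit -kermx_eq0; apply/eqP/row_matrixP => i.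
rewrite row0; apply/eqP/negPn/negP => v0.
have := P0 (row i (kermx P))^T; rewrite trmx_eq0 => /(_ v0).
by rewrite trmxK -row_mul mulmx_ker row0 mul0mx mxE ltxx.
Qed.

(** Cauchy-Schwarz for the form [P] between [x] and [invmx P *m x] bounds $|x|^4$ by the product of
    the forms of [P] and of its inverse at [x], and the latter is at most [C * sqn x]. *)
Lemma posdef_lower n (P : 'M[R]_n) : posdef P -> exists2 c, 0 < c &
  forall x : 'cV[R]_n, c * sqn x <= (x^T *m P *m x) 0 0.
Proof.
move=> Pp; have Pu := posdef_unitmx Pp.
have [C C0 hC] := qform_bound (invmx P)^T.
exists C^-1; first by rewrite invr_gt0.
move=> x; rewrite ler_pdivrMl//.
have [s0|s0] := eqVneq (sqn x) 0; first by rewrite s0 mulr_ge0 ?(ltW C0)// posdef_ge0.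
have sp : 0 < sqn x by rewrite lt_neqAle eq_sym s0 sqn_ge0.
have := posdef_CauchySchwarz x (invmx P *m x) Pp.
have -> : x^T *m P *m (invmx P *m x) = x^T *m x.
  by rewrite mulmxA -(mulmxA _ P) mulmxV// mulmx1.
have -> : (invmx P *m x)^T *m P *m (invmx P *m x) = x^T *m (invmx P)^T *m x.
  by rewrite trmx_mul -!mulmxA (mulmxA P) mulmxV// mul1mx.
rewrite -sqnE.
set V := (x^T *m P *m x) 0 0 => h.
have V0 : 0 <= V by exact: posdef_ge0.
have h2 : sqn x ^+ 2 <= V * (C * sqn x) by apply: le_trans h _; rewrite ler_wpM2l.
rewrite -(ler_pM2r sp) -expr2; apply: le_trans h2 _.
by rewrite mulrA (mulrC V).
Qed.

End quadratic_forms.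

Lemma finite_strict_bound (R : realFieldType) n (f : 'I_n -> R) (b : R) :
  (forall i, f i < b) -> exists2 eta, 0 < eta & forall i, f i <= b - eta.
Proof.
elim: n f => [|n IHn] f hf; first by exists 1 => // -[].
have [eta e0 he] := IHn (fun i => f (lift ord0 i)) (fun i => hf _).
exists (Num.min eta (b - f ord0)); first by rewrite lt_min e0 subr_gt0 hf.
move=> i; have [j ->|->] := unliftP ord0 i.
  have : Num.min eta (b - f ord0) <= eta by rewrite ge_min lexx.
  have := he j; lra.
have : Num.min eta (b - f ord0) <= b - f ord0 by rewrite ge_min lexx orbT.
lra.
Qed.

Section Lyapunov.
Context {R : realType}.

(** The bracket on the left is the real part of $\bar v_i T_{ij} v_j$ for $v_i = y + iz$, $v_j = y'
    + iz'$ and $T_{ij} = t_a + i t_b$. Since [si] is at most [eps * sj], Young's inequality leaves a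
    small factor [eps]. *)
Lemma rotation_term_bound (si sj eps tau ta tb y z y' z' : R) :
  0 < si -> 0 < sj -> 0 < eps -> si <= eps * sj -> `|ta| <= tau -> `|tb| <= tau ->
  si ^+ 2 * (ta * (y * y' + z * z') + tb * (z * y' - y * z')) <=
  eps * tau * (si ^+ 2 * (y ^+ 2 + z ^+ 2) + sj ^+ 2 * (y' ^+ 2 + z' ^+ 2)).
Proof.
move=> si0 sj0 eps0 sij hta htb.
set S := si ^+ 2 * _ + _; set m := y * y' + z * z'; set m' := z * y' - y * z'.
have tau0 : 0 <= tau by apply: le_trans hta.
have hm : si * sj * `|m| <= S / 2.
  rewrite -(ger0_norm (ltW (mulr_gt0 si0 sj0))) -normrM ler_norml /S /m.
  have := sqr_ge0 (si * y - sj * y'); have := sqr_ge0 (si * z - sj * z').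
  have := sqr_ge0 (si * y + sj * y'); have := sqr_ge0 (si * z + sj * z').
  by move=> *; apply/andP; split; nra.
have hm' : si * sj * `|m'| <= S / 2.
  rewrite -(ger0_norm (ltW (mulr_gt0 si0 sj0))) -normrM ler_norml /S /m'.
  have := sqr_ge0 (si * y - sj * z'); have := sqr_ge0 (si * z - sj * y').
  have := sqr_ge0 (si * y + sj * z'); have := sqr_ge0 (si * z + sj * y').
  by move=> *; apply/andP; split; nra.
apply: le_trans (ler_norm _) _; rewrite normrM ger0_norm ?sqr_ge0//.
have h1 : `|ta * m + tb * m'| <= tau * (`|m| + `|m'|).
  apply: le_trans (ler_normD _ _) _; rewrite !normrM mulrDr.
  by rewrite lerD// ler_wpM2r.
apply: le_trans (ler_wpM2l (sqr_ge0 si) h1) _.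
have mm : 0 <= tau * (`|m| + `|m'|) by rewrite mulr_ge0// addr_ge0.
have h2 : si ^+ 2 <= eps * (si * sj).
  by rewrite expr2 mulrCA ler_wpM2l// ltW.
apply: le_trans (ler_wpM2r mm h2) _.
have -> : eps * (si * sj) * (tau * (`|m| + `|m'|)) =
  eps * tau * (si * sj * `|m| + si * sj * `|m'|) by ring.
have et : 0 <= eps * tau by rewrite mulr_ge0// ltW.
by rewrite ler_wpM2l//; lra.
Qed.

(** Schur triangularization over [R[i]], split into real and imaginary parts so that all later
    estimates are real. The triangular factor is lower triangular, and invertibility of the change
    of basis is kept as joint injectivity on real vectors. *)
Lemma Hurwitz_real_triangular n (A : 'M[R]_n) (d : R) :
  spectral_abscissa_lt A d ->
  exists (Qa Qb Ta Tb : 'M[R]_n),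
  [/\ Qa *m A = Ta *m Qa - Tb *m Qb, Qb *m A = Ta *m Qb + Tb *m Qa,
      forall i j : 'I_n, (i < j)%N -> Ta i j = 0 /\ Tb i j = 0,
      forall i, Ta i i < d &
      forall x : 'cV[R]_n, Qa *m x = 0 -> Qb *m x = 0 -> x = 0].
Proof.
move=> specA; have [n0|n0] := posnP n.
  move: A specA; rewrite n0 => A _; exists 0, 0, 0, 0.
  by split=> [| |[]//|[]//|x _ _]; rewrite ?mul0mx ?subrr ?addr0//; apply/matrixP => -[].
pose Ac := map_mx (real_complex R) A.
have [Q /unitarymx_unit Qu Qt] := Schur Ac n0.
have cE := conjumx Ac Qu.
set T := conjmx Q Ac in cE Qt.
have Tt : is_trig_mx T by exact: Qt.
have QA : Q *m Ac = T *m Q by rewrite cE mulmxKV.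
have ReM (a b : R[i]) : complex.Re (a * b) =
  complex.Re a * complex.Re b - complex.Im a * complex.Im b by case: a b => [? ?] [? ?].
have ImM (a b : R[i]) : complex.Im (a * b) =
  complex.Re a * complex.Im b + complex.Im a * complex.Re b by case: a b => [? ?] [? ?].
have ReS (F : 'I_n -> R[i]) : complex.Re (\sum_i F i) = \sum_i complex.Re (F i).
  by apply: (big_morph (@complex.Re R)) => // -[? ?] [? ?].
have ImS (F : 'I_n -> R[i]) : complex.Im (\sum_i F i) = \sum_i complex.Im (F i).
  by apply: (big_morph (@complex.Im R)) => // -[? ?] [? ?].
exists (map_mx (@complex.Re R) Q), (map_mx (@complex.Im R) Q),
  (map_mx (@complex.Re R) T), (map_mx (@complex.Im R) T); split.
- apply/matrixP => i j; have /(congr1 (@complex.Re R)) := congr1 (fun M => fun_of_matrix M i j) QA.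
  rewrite !mxE !ReS -sumrB => E; transitivity (\sum_i0 complex.Re (Q i i0 * Ac i0 j)).
    by apply: eq_bigr => k _; rewrite ReM !mxE /= mulr0 subr0.
  by rewrite E; apply: eq_bigr => k _; rewrite ReM !mxE.
- apply/matrixP => i j; have /(congr1 (@complex.Im R)) := congr1 (fun M => fun_of_matrix M i j) QA.
  rewrite !mxE !ImS -big_split/= => E; transitivity (\sum_i0 complex.Im (Q i i0 * Ac i0 j)).
    by apply: eq_bigr => k _; rewrite ImM !mxE /= mulr0 add0r.
  by rewrite E; apply: eq_bigr => k _; rewrite ImM !mxE.
- by move=> i j ij; have T0 := is_trig_mxP Tt _ _ ij; split; rewrite mxE T0.
- move=> i; rewrite mxE; apply: specA.
  (* A diagonal entry of the triangular form is an eigenvalue of it, hence of the conjugate matrix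
     [A]. *)
  apply: (@eigenvalue_conjmx _ _ _ Q); rewrite ?row_free_unit ?stablemx_unit//.
  suff : eigenvalue T (T i i) by [].
  rewrite eigenvalue_root_char char_poly_trig// rootE horner_prod (bigD1 i)//=.
  by rewrite !hornerE subrr mul0r.
- move=> x Qa0 Qb0; have : Q *m map_mx (real_complex R) x = 0.
    apply/matrixP => i j; apply/eqP; rewrite eq_complex; apply/andP; split; apply/eqP.
      rewrite [in RHS]mxE /=; have := congr1 (fun M => fun_of_matrix M i j) Qa0.
      rewrite !mxE ReS => E; rewrite -[RHS]E.
      by apply: eq_bigr => k _; rewrite ReM !mxE /= mulr0 subr0.
    rewrite [in RHS]mxE /=; have := congr1 (fun M => fun_of_matrix M i j) Qb0.
    rewrite !mxE ImS => E; rewrite -[RHS]E.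
    by apply: eq_bigr => k _; rewrite ImM !mxE /= mulr0 add0r.
  move/(congr1 (mulmx (invmx Q))); rewrite mulmxA mulVmx// mul1mx mulmx0.
  by move/matrixP => x0; apply/matrixP => i j; have := x0 i j; rewrite !mxE => -[].
Qed.

Lemma weighted_gram n (Q : 'M[R]_n) (d : 'rV[R]_n) (x y : 'cV[R]_n) :
  (x^T *m (Q^T *m diag_mx d *m Q) *m y) 0 0 =
  \sum_i d 0 i * (Q *m x) i 0 * (Q *m y) i 0.
Proof.
have -> : x^T *m (Q^T *m diag_mx d *m Q) *m y = (Q *m x)^T *m diag_mx d *m (Q *m y).
  by rewrite trmx_mul !mulmxA.
rewrite mxE; apply: eq_bigr => i _; congr (_ * _).
by rewrite mul_mx_diag mxE mulrC; congr (_ * _); rewrite mxE.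
Qed.

(** [P] is the real part of $Q^* D Q$ with [Q] triangularizing [A] and [D] the geometric weights
    [eps ^+ (2 * i)]. A small [eps] makes the off-diagonal couplings negligible against the
    diagonal, whose real parts stay below [- delta - eta]. *)
Lemma Lyapunov_Hurwitz n (A : 'M[R]_n) (delta : R) :
  spectral_abscissa_lt A (- delta) ->
  exists (P : 'M[R]_n), posdef P /\ exists2 c, 0 < c & forall x : 'cV[R]_n,
    2 * (x^T *m P *m (A *m x)) 0 0 + 2 * delta * (x^T *m P *m x) 0 0 <=
    - c * sqn x.
Proof.
move=> /Hurwitz_real_triangular[Qa [Qb [Ta [Tb [QaA QbA trig diag Qinj]]]]].
have [eta eta0 heta] := finite_strict_bound diag.
pose tau := 1 + \sum_i \sum_j (`|Ta i j| + `|Tb i j|).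
have tau_ge i j : `|Ta i j| + `|Tb i j| <= tau.
  rewrite /tau (bigD1 i)//= (bigD1 j)//=.
  have : 0 <= \sum_(k | k != j) (`|Ta i k| + `|Tb i k|) by apply: sumr_ge0 => *; exact: addr_ge0.
  have : 0 <= \sum_(k | k != i) \sum_l (`|Ta k l| + `|Tb k l|).
    by apply: sumr_ge0 => k _; apply: sumr_ge0 => *; exact: addr_ge0.
  lra.
have tau0 : 0 < tau.
  by rewrite ltr_pwDl// sumr_ge0// => i _; apply: sumr_ge0 => j _; exact: addr_ge0.
(* Chosen so that the total coupling [2 * n%:R * (eps * tau)] is at most [eta / 2]; the added 1
   keeps [D] positive when [n = 0]. *)
pose D := 4 * n%:R * tau + 1 : R.
have D0 : 0 < D by rewrite /D ltr_wpDl// !mulr_ge0// ltW.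
pose eps := Num.min 1 (eta / D).
have eps0 : 0 < eps by rewrite lt_min ltr01 divr_gt0.
have eps1 : eps <= 1 by rewrite ge_min lexx.
have epsD : 2 * n%:R * (eps * tau) <= eta / 2.
  have : eps <= eta / D by rewrite ge_min lexx orbT.
  rewrite ler_pdivlMr// /D => h.
  have : 0 <= eps by exact: ltW.
  lra.
pose s (i : 'I_n) := eps ^+ i.
have s0 i : 0 < s i by exact: exprn_gt0.
pose d : 'rV[R]_n := \row_i s i ^+ 2.
pose P := Qa^T *m diag_mx d *m Qa + Qb^T *m diag_mx d *m Qb.
have Psym : P^T = P.
  by rewrite /P linearD/= !trmx_mul !trmxK tr_diag_mx !mulmxA.
have PE (x y : 'cV[R]_n) : (x^T *m P *m y) 0 0 = \sum_i s i ^+ 2 *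
    ((Qa *m x) i 0 * (Qa *m y) i 0 + (Qb *m x) i 0 * (Qb *m y) i 0).
  rewrite /P mulmxDr mulmxDl mxE !weighted_gram -big_split/=.
  by apply: eq_bigr => i _; rewrite !mxE; ring.
have Ppos : posdef P.
  split => // x x0; rewrite PE lt_neqAle; apply/andP; split; last first.
    apply: sumr_ge0 => i _; rewrite mulr_ge0 ?sqr_ge0//.
    by rewrite -!expr2 addr_ge0// sqr_ge0.
  apply: contra x0; rewrite eq_sym psumr_eq0; last first.
    by move=> i _; rewrite mulr_ge0 ?sqr_ge0// -!expr2 addr_ge0// sqr_ge0.
  move=> /allP h; apply/eqP; apply: Qinj; apply/matrixP => i j; rewrite (ord1 j) [RHS]mxE.
    have := h i (mem_index_enum _); rewrite mulf_eq0 gt_eqF ?exprn_gt0//=.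
    by rewrite -!expr2 paddr_eq0 ?sqr_ge0// !sqrf_eq0 => /andP[/eqP].
  have := h i (mem_index_enum _); rewrite mulf_eq0 gt_eqF ?exprn_gt0//=.
  by rewrite -!expr2 paddr_eq0 ?sqr_ge0// !sqrf_eq0 => /andP[_ /eqP].
exists P; split => //.
have [c c0 hc] := posdef_lower Ppos.
exists (eta * c); first by rewrite mulr_gt0.
move=> x; pose V := (x^T *m P *m x) 0 0; rewrite -/V.
(* Half of the margin [eta] pays for the couplings; after doubling, [- eta * V] is left, and
   coercivity of [P] converts it into [- (eta * c) * sqn x]. *)
suff : (x^T *m P *m (A *m x)) 0 0 <= - (delta + eta) * V + 2 * n%:R * (eps * tau) * V.
  have V0 : 0 <= V by exact: posdef_ge0.
  have := hc x; rewrite -/V; nra.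
pose r (i : 'I_n) := (Qa *m x) i 0 ^+ 2 + (Qb *m x) i 0 ^+ 2.
have VE : V = \sum_i s i ^+ 2 * r i.
  by rewrite /V PE; apply: eq_bigr => i _; rewrite /r !expr2.
have r0 i : 0 <= r i by rewrite addr_ge0 ?sqr_ge0.
rewrite PE.
have E i : s i ^+ 2 * ((Qa *m x) i 0 * (Qa *m (A *m x)) i 0 + (Qb *m x) i 0 * (Qb *m (A *m x)) i 0) =
    \sum_j s i ^+ 2 * (Ta i j * ((Qa *m x) i 0 * (Qa *m x) j 0 + (Qb *m x) i 0 * (Qb *m x) j 0) +
       Tb i j * ((Qb *m x) i 0 * (Qa *m x) j 0 - (Qa *m x) i 0 * (Qb *m x) j 0)).
  rewrite !mulmxA QaA QbA mulmxBl mulmxDl -!mulmxA.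
  have mE (B C : 'cV[R]_n) : (B - C) i 0 = B i 0 - C i 0 by rewrite !mxE.
  have mE' (B C : 'cV[R]_n) : (B + C) i 0 = B i 0 + C i 0 by rewrite !mxE.
  have mS (M : 'M[R]_n) (v : 'cV[R]_n) : (M *m v) i 0 = \sum_j M i j * v j 0 by rewrite mxE.
  rewrite mE mE' !(mS Ta) !(mS Tb) -!mulr_sumr; congr (_ * _).
  rewrite -sumrB -big_split/= !mulr_sumr -big_split/=.
  by apply: eq_bigr => j _; ring.
(* On the diagonal the [Tb] part cancels; above it the entries vanish; below it [s i <= eps * s j],
   and the rotation bound applies. *)
have bnd i j : s i ^+ 2 * (Ta i j * ((Qa *m x) i 0 * (Qa *m x) j 0 + (Qb *m x) i 0 * (Qb *m x) j 0) +
       Tb i j * ((Qb *m x) i 0 * (Qa *m x) j 0 - (Qa *m x) i 0 * (Qb *m x) j 0)) <=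
    (if i == j then - (delta + eta) * (s i ^+ 2 * r i) else 0) +
    eps * tau * (s i ^+ 2 * r i + s j ^+ 2 * r j).
  have sr k : 0 <= s k ^+ 2 * r k by rewrite mulr_ge0 ?sqr_ge0.
  have et : 0 <= eps * tau by rewrite mulr_ge0 ?ltW.
  have [<-|ij] := eqVneq i j.
    have -> : s i ^+ 2 * (Ta i i * ((Qa *m x) i 0 * (Qa *m x) i 0 + (Qb *m x) i 0 * (Qb *m x) i 0) +
      Tb i i * ((Qb *m x) i 0 * (Qa *m x) i 0 - (Qa *m x) i 0 * (Qb *m x) i 0)) =
      Ta i i * (s i ^+ 2 * r i) by rewrite /r; ring.
    have := heta i; have := sr i; have := mulr_ge0 et (addr_ge0 (sr i) (sr i)); nra.
  rewrite add0r; have [lij|] := ltnP i j.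
    have [-> ->] := trig _ _ lij; rewrite !mul0r addr0 mulr0.
    by rewrite mulr_ge0// addr_ge0.
  rewrite leq_eqVlt => /predU1P[ji|ji]; first by move: ij; rewrite -val_eqE/= ji eqxx.
  apply: rotation_term_bound => //.
  - rewrite /s -[X in eps ^+ X <= _](subnK ji) exprD exprS ler_piMl//.
      by rewrite mulr_ge0 ?exprn_ge0 ?ltW.
    by rewrite exprn_ile1// ltW.
  - by apply: le_trans (tau_ge i j); rewrite lerDl.
  - by apply: le_trans (tau_ge i j); rewrite lerDr.
rewrite (eq_bigr _ (fun i _ => E i)).
apply: le_trans (ler_sum _ (fun i _ => ler_sum _ (fun j _ => bnd i j))) _.
have -> : \sum_i \sum_j ((if i == j then - (delta + eta) * (s i ^+ 2 * r i) else 0) +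
    eps * tau * (s i ^+ 2 * r i + s j ^+ 2 * r j)) =
    - (delta + eta) * V + 2 * n%:R * (eps * tau) * V; last by [].
pose a i := s i ^+ 2 * r i.
transitivity (\sum_i (- (delta + eta) * a i + eps * tau * (n%:R * a i + \sum_j a j))).
  apply: eq_bigr => i _; rewrite big_split/=; congr (_ + _).
    rewrite -big_mkcond/= (big_pred1 i)// => j; by rewrite eq_sym.
  by rewrite -mulr_sumr big_split/= sumr_const card_ord mulr_natl.
rewrite big_split/= -!mulr_sumr big_split/= sumr_const card_ord -mulr_sumr.
by rewrite VE -/(\sum_i a i) -mulr_natl; ring.
Qed.

End Lyapunov.

(** * Curves in L2 *)

Section curves_in_L2.
Context {R : realType}.
Implicit Types f g : R -> R.

Lemma is_derive_cvg (f : R -> R) (t df : R) :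
  (h^-1 * (f (t + h) - f t)) @[h --> (0 : R)^'] --> df -> is_derive t 1 f df.
Proof.
move=> fdf.
have E : (fun h : R => h^-1 *: (f (h *: 1 + t) - f t)) =
    (fun h => h^-1 * (f (t + h) - f t)).
  by apply/funext => h /=; rewrite [h *: _]mulr1 [_ + t]addrC.
apply: DeriveDef.
  by apply/cvg_ex; exists df; rewrite E.
by rewrite /derive E; apply/cvg_lim; first exact: Rhausdorff.
Qed.

Lemma cvg_is_derive (f : R -> R) (t df : R) : is_derive t 1 f df ->
  (h^-1 * (f (t + h) - f t)) @[h --> (0 : R)^'] --> df.
Proof.
move=> [+ <-]; rewrite /derivable /derive.
have -> : (fun h : R => h^-1 *: ((f \o shift t) (h *: 1) - f t)) =
    (fun h => h^-1 * (f (t + h) - f t)) => //.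
by apply/funext => h /=; rewrite [h *: _]mulr1 [_ + t]addrC.
Qed.

Lemma L2_cvg_comp (T U : Type) (F : set_system T) (G : set_system U) (k : T -> U)
  (f : U -> R -> R) g : Filter F -> Filter G ->
  k @ F --> G -> L2_cvg G f g -> L2_cvg F (f \o k) g.
Proof.
move=> FF FG kFG [Lf Lg fg]; split => //; first exact: (kFG _ Lf).
exact: (cvg_comp _ _ kFG fg).
Qed.

Lemma cvg_shift (t : R) : (t + h) @[h --> (0 : R)^'] --> t.
Proof.
rewrite -[X in _ --> X]addr0; apply: cvgD; first exact: cvg_cst.
exact: (@nbhs_dnbhs _ (0 : R)).
Qed.

Lemma near_shift_gt0 (t : R) : 0 < t -> \forall h \near (0 : R)^', 0 < t + h.
Proof. by move=> t0; apply: (cvgr_gt t) => //; exact: cvg_shift. Qed.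

Lemma cvg_shift_dnbhs (t : R) : 0 < t ->
  (t + h) @[h --> (0 : R)^'] --> within `]0, +oo[ (nbhs t).
Proof.
move=> t0 P; rewrite /within /= => wP.
have h1 := cvg_shift wP; have h2 := near_shift_gt0 t0.
rewrite /nbhs /=; near=> h.
have : (t + h \in `]0, +oo[) -> P (t + h) by near: h; exact: h1.
by apply; rewrite in_itv/= andbT; near: h.
Unshelve. all: by end_near. Qed.

Lemma L2_derivative_inner (f : R -> R -> R) (t : R) g psi :
  (forall s, 0 < s -> L2 (f s)) -> 0 < t -> L2 psi -> L2_derivative f t g ->
  is_derive t 1 (fun s => inner (f s) psi) (inner g psi).
Proof.
move=> Lf t0 Lpsi dfg; apply: is_derive_cvg.
have := @L2_cvg_inner _ _ _ (dnbhs_filter (0 : R)) _ _ _ _ dfg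
  (@L2_cvg_cst _ _ _ (dnbhs_filter (0 : R)) _ Lpsi).
apply: cvg_trans; apply: near_eq_cvg.
have h2 := near_shift_gt0 t0.
near=> h.
have th : 0 < t + h by near: h.
have LB := L2B (Lf _ th) (Lf _ t0).
by rewrite innerZl// innerBl//; exact: Lf.
Unshelve. all: by end_near. Qed.

(** By symmetry the difference quotient of the form equals the inner product of [Af (t + h) + Af t]
    with the difference quotient of [f]. Continuity of [Af] in time therefore suffices, and the
    factor 2 is its limit. *)
Lemma L2_derivative_form (f Af : R -> R -> R) (t : R) g :
  (forall s, 0 < s -> L2 (f s)) -> (forall s, 0 < s -> L2 (Af s)) -> 0 < t ->
  (forall r s, 0 < r -> 0 < s -> inner (Af r) (f s) = inner (Af s) (f r)) ->
  L2_continuous_on `]0, +oo[ Af -> L2_derivative f t g ->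
  is_derive t 1 (fun s => inner (Af s) (f s)) (2 * inner (Af t) g).
Proof.
move=> Lf LAf t0 sym cAf dfg; apply: is_derive_cvg.
have tI : `]0, +oo[%classic t by rewrite /= in_itv/= t0.
have FF := dnbhs_filter (0 : R).
have c1 := @L2_cvg_comp _ _ _ _ _ _ _ FF (within_filter _ (nbhs_filter t)) (cvg_shift_dnbhs t0) (cAf t tI).
have c2 := @L2_cvg_inner _ _ _ FF _ _ _ _
  (@L2_cvgD _ _ _ FF _ _ _ _ c1 (@L2_cvg_cst _ _ _ FF _ (LAf _ t0))) dfg.
have -> : 2 * inner (Af t) g = inner (fun x => Af t x + Af t x) g.
  by have [_ Lg _] := dfg; rewrite innerDl//; [ring|exact: LAf..].
apply: cvg_trans c2; apply: near_eq_cvg.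
have h2 := near_shift_gt0 t0.
near=> h.
have th : 0 < t + h by near: h.
have [[[L1 L2'] L3] L4] := (Lf _ th, Lf _ t0, LAf _ th, LAf _ t0).
have LB := L2B L1 L2'; have LD := L2D L3 L4.
rewrite innerZr// innerBr// !innerDl// (sym (t + h) t)//.
by congr (_ * _); ring.
Unshelve. all: by end_near. Qed.

Lemma L2_continuous_inner (f : R -> R -> R) psi : L2 psi ->
  L2_continuous_on `[0, +oo[ f ->
  {within `[0, +oo[, continuous (fun s => inner (f s) psi)}.
Proof.
move=> Lpsi cf; apply/subspace_continuousP => t t0.
by apply: L2_cvg_inner; [exact: cf|exact: L2_cvg_cst].
Qed.

Lemma L2_continuous_sqnorm (f : R -> R -> R) :
  L2_continuous_on `[0, +oo[ f ->
  {within `[0, +oo[, continuous (fun s => inner (f s) (f s))}.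
Proof.
move=> cf; apply/subspace_continuousP => t t0.
by apply: L2_cvg_inner; exact: cf.
Qed.

Lemma is_derive_linear (k t : R) : is_derive t 1 (fun s => k * s) k.
Proof.
apply: is_derive_cvg; apply: cvg_near_cst; near=> h.
have h0 : h != 0 by near: h; exact: nbhs_dnbhs_neq.
by field.
Unshelve. all: by end_near. Qed.

Lemma is_derive_to (f : R -> R) (t d d' : R) :
  is_derive t 1 f d -> d = d' -> is_derive t 1 f d'.
Proof. by move=> ? <-. Qed.

Lemma is_derive_mul (f g : R -> R) (t df dg : R) :
  is_derive t 1 f df -> is_derive t 1 g dg ->
  is_derive t 1 (fun s => f s * g s) (df * g t + f t * dg).
Proof.
move=> hf hg; apply: (is_derive_to (is_deriveM hf hg)).
by rewrite addrC [g t *: df]mulrC.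
Qed.

Lemma is_derive_scale (k : R) (f : R -> R) (t df : R) :
  is_derive t 1 f df -> is_derive t 1 (fun s => k * f s) (k * df).
Proof.
move=> hf; apply: (is_derive_to (is_derive_mul (is_derive_cst k t 1) hf)).
by rewrite /= mul0r add0r.
Qed.

Lemma is_derive_sub (f g : R -> R) (t df dg : R) :
  is_derive t 1 f df -> is_derive t 1 g dg ->
  is_derive t 1 (fun s => f s - g s) (df - dg).
Proof. by move=> hf hg; have := is_deriveB hf hg. Qed.

Lemma is_derive_add (f g : R -> R) (t df dg : R) :
  is_derive t 1 f df -> is_derive t 1 g dg ->
  is_derive t 1 (fun s => f s + g s) (df + dg).
Proof. by move=> hf hg; have := is_deriveD hf hg. Qed.

(** The derivative is known only for [t > 0]; continuity up to [0] lets the mean value theorem for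
    [expR (2 * d * t) * V t] start at the initial time. *)
Lemma exponential_decay (V V' : R -> R) (d : R) :
  {within `[0, +oo[, continuous V} ->
  (forall t : R, 0 < t -> is_derive t 1 V (V' t)) ->
  (forall t : R, 0 < t -> V' t + 2 * d * V t <= 0) ->
  forall t : R, 0 <= t -> V t <= expR (- 2 * d * t) * V 0.
Proof.
move=> cV dV V'le t; rewrite le_eqVlt => /predU1P[<-|t0].
  by rewrite mulr0 expR0 mul1r.
pose W s := expR (2 * d * s) * V s.
have dW (s : R) : 0 < s -> is_derive s 1 W (expR (2 * d * s) * (V' s + 2 * d * V s)).
  move=> s0; have dVs := dV s s0.
  have d1 : is_derive s 1 (fun s => expR (2 * d * s)) (2 * d * expR (2 * d * s)).
    have d2 := is_derive_linear (2 * d) s.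
    have := @is_derive1_comp _ expR (fun s => 2 * d * s) s _ _ (is_derive_expR _) d2.
    by rewrite [expR _ * _]mulrC.
  by apply: is_derive_to (is_derive_mul d1 dVs) _; ring.
have cW : {within `[0, t], continuous W}.
  move=> s; apply: cvgM; last first.
    by apply: (continuous_subspaceW _ cV) => r /=; rewrite !in_itv/= => /andP[->].
  apply: continuous_subspaceT => r; apply: continuous_comp; last exact: continuous_expR.
  by apply: cvgM; [exact: cvg_cst|exact: cvg_id].
have [||c /[!in_itv]/= /andP[c0 ct]] := @MVT R W (fun s => expR (2 * d * s) * (V' s + 2 * d * V s)) 0 t t0.
- by move=> s; rewrite in_itv/= => /andP[s0 _]; exact: dW.
- exact: cW.
move=> E; have W0 : W t <= W 0.
  rewrite -subr_le0 E subr0 pmulr_lle0// pmulr_rle0 ?expR_gt0//.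
  exact: V'le.
move: W0; rewrite /W mulr0 expR0 mul1r => W0.
rewrite (_ : - 2 * d * t = - (2 * d * t)); last by ring.
by rewrite expRN mulrC ler_pdivlMr ?expR_gt0// mulrC.
Qed.

End curves_in_L2.

(** * The homogenized plant *)

Section input_operators.
Context {R : realType}.
Local Notation mu := (@lebesgue_measure R).
Variables (theta1 theta2 : R) (p p' q qt : R -> R) (qc : R).
Hypothesis theta1_itv : 0 < theta1 <= pi / 2.
Hypothesis theta2_itv : 0 <= theta2 <= pi / 2.
Hypothesis C1p : C1_01 p p'.
Hypothesis p_gt0 : forall x : R, 0 <= x <= 1 -> 0 < p x.
Hypothesis cq : {within `[0, 1], continuous q}.
Hypothesis cqt : {within `[0, 1], continuous qt}.
Hypothesis qtE : forall x : R, 0 <= x <= 1 -> qt x = q x - qc.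

Local Notation c0 := (cos theta2 + 2 * sin theta2).

Lemma weak_deriv_id : weak_deriv (fun x : R => x) (fun=> 1).
Proof.
split=> [|x /andP[x0 _]]; first exact: L2_cst.
by rewrite Rintegral_cst_itv// mul1r subr0 add0r.
Qed.

Definition b_deriv (x : R) : R := - (2 * x / c0).

Lemma b_fun_weak_deriv : weak_deriv (b_fun theta2) b_deriv.
Proof.
apply: eq_weak_deriv (weak_derivZ (- c0^-1) (weak_derivM weak_deriv_id weak_deriv_id)).
  by move=> x _; rewrite /b_fun; ring.
by move=> x _; rewrite /b_deriv; ring.
Qed.

Lemma b_fun_L2 : L2 (b_fun theta2).
Proof. exact: weak_deriv_L2 b_fun_weak_deriv. Qed.

Lemma b_deriv_continuous : {within `[0, 1], continuous b_deriv}.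
Proof.
apply: (@weak_deriv_continuous _ _ (fun=> - (2 / c0))).
apply: eq_weak_deriv (weak_derivZ (- (2 / c0)) weak_deriv_id).
  by move=> x _; rewrite /b_deriv; ring.
by move=> x _; ring.
Qed.

(** [a_fun] with the continuous [p'] in place of [derive1 p], whose values at the endpoints are not
    controlled. The two agree on the open interval. *)
Definition lift_a (x : R) : R := (2 * p x + 2 * x * p' x - x ^+ 2 * qt x) / c0.

Lemma pb_deriv_weak_deriv : weak_deriv (fun x => p x * b_deriv x)
  (fun x => - ((2 * p x + 2 * x * p' x) / c0)).
Proof.
apply: eq_weak_deriv (weak_derivZ (- (2 / c0))
  (weak_derivM (C1_weak_deriv C1p) weak_deriv_id)).
  by move=> x _; rewrite /b_deriv; ring.
by move=> x _; ring.
Qed.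

Lemma lift_a_L2 : L2 lift_a.
Proof.
have [L1 _] := pb_deriv_weak_deriv.
have cx2 : {within `[0, 1], continuous (fun x : R => x * x)}.
  exact: weak_deriv_continuous (weak_derivM weak_deriv_id weak_deriv_id).
have L2' := L2M_continuous (continuous_L2 cqt) cx2.
apply: eq_L2 (L2B (L2N L1) (L2Z c0^-1 L2')) => x _; rewrite /lift_a; ring.
Qed.

Lemma a_fun_interior x : 0 < x < 1 -> a_fun theta2 p qt x = lift_a x.
Proof.
move=> xI; rewrite /a_fun /lift_a derive1E; have [_ _ /(_ x xI) dp] := C1p.
by rewrite (@derive_val _ _ _ x 1 p (p' x) dp).
Qed.

Lemma L2_indic1 (r : R) : L2 (\1_[set r] : R -> R).
Proof.
apply: (@L2_bounded _ _ 1).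
  by apply: measurable_indic; exact: measurable_set1.
by move=> x _; rewrite indicE; case: (_ \in _); rewrite /= ?normr1 ?normr0.
Qed.

Lemma a_fun_L2 : L2 (a_fun theta2 p qt).
Proof.
(* The discrepancy can be nonzero only at [0] and [1], so two indicators of points correct it. *)
pose e r := a_fun theta2 p qt r - lift_a r.
apply: eq_L2 (L2D lift_a_L2 (L2D (L2Z (e 0) (L2_indic1 0)) (L2Z (e 1) (L2_indic1 1)))).
move=> x /andP[x0 x1].
have mE (r : R) : (x \in [set r]) = (x == r) by apply/idP/eqP; rewrite inE.
rewrite !indicE !mE.
have [->|x0'] := eqVneq x 0; first by rewrite [0 == 1]eq_sym oner_eq0 /e mulr1n mulr0n; ring.
have [->|x1'] := eqVneq x 1; first by rewrite /e mulr1n mulr0n; ring.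
rewrite a_fun_interior ?mulr0 ?addr0//.
by rewrite !lt_neqAle x0 x1 x1' eq_sym x0'.
Qed.

Lemma a_fun_ae : ae01_eq (a_fun theta2 p qt) lift_a.
Proof.
have ae r : {ae mu, forall x : R, x != r}.
  exists [set r]; split => //; first exact: lebesgue_measure_set1.
  by move=> x /= /negP; rewrite negbK => /eqP.
apply: (@filterS2 _ _ (ae_filter_ringOfSetsType mu) _ _ _ _ (ae 0) (ae 1)).
move=> x x0' x1' /=; rewrite in_itv/= => /andP[x0 x1].
by apply: a_fun_interior; rewrite !lt_neqAle x0 x1 x1' eq_sym x0'.
Qed.

(* With [w = z + b u], the lifted state satisfies [- A~ z = - A w + qc w + a u]:
   the boundary input has been moved into the equation. *)
Lemma lifted_generator (z w f1 h g : R -> R) (u : R) :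
  (forall x, w x = z x + b_fun theta2 x * u) ->
  SL theta1 theta2 p q w f1 h -> sl_expr p qt z g ->
  forall psi, L2 psi -> inner (fun x => - g x) psi =
    - inner h psi + qc * inner w psi + u * inner (a_fun theta2 p qt) psi.
Proof.
move=> wE sw [z1 [wz wpz]] psi Lpsi.
have [ww cf1 wpw _ _] := sw; have [Lw Lf1 Lh] := SL_L2 cq sw.
have wz' : weak_deriv z (fun x => f1 x + - u * b_deriv x).
  apply: eq_weak_deriv (weak_derivD ww (weak_derivZ (- u) b_fun_weak_deriv)) => // x _.
  by rewrite wE; ring.
have cz1 : {within `[0, 1], continuous z1}.
  exact: (continuous_divp C1p p_gt0 (weak_deriv_continuous wpz)).
have cz1' : {within `[0, 1], continuous (fun x => f1 x + - u * b_deriv x)}.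
  move=> x; apply: cvgD; first exact: cf1.
  by apply: cvgM; [exact: cvg_cst|exact: b_deriv_continuous].
(* Both derivatives of [z] are continuous, so equality holds pointwise and survives the
   multiplication by [p] before the second differentiation. *)
have z1E := continuous_ae01_eq cz1 cz1' (weak_deriv_unique wz wz').
have wpz' : weak_deriv (fun x => p x * z1 x)
    (fun x => (q x * w x - h x) + - u * - ((2 * p x + 2 * x * p' x) / c0)).
  apply: eq_weak_deriv (weak_derivD wpw (weak_derivZ (- u) pb_deriv_weak_deriv)) => // x xI.
  by rewrite z1E//; ring.
have aeE := weak_deriv_unique wpz wpz'.
have La := a_fun_L2; have Lla := lift_a_L2.
have Lz : L2 z by exact: weak_deriv_L2 wz.
have Lg : L2 g.
  apply: eq_L2 (L2B (L2M_continuous Lz cqt) (proj1 wpz)) => x _; ring.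
pose r x := - h x + qc * w x + u * lift_a x.
have Lr : L2 r by apply: L2D; [apply: L2D; [exact: L2N|exact: L2Z]|exact: L2Z].
transitivity (inner r psi).
  apply: ae01_inner; [exact: L2_meas (L2N Lg)|exact: L2_meas|exact: L2_meas|].
  apply: (@filterS _ _ (ae_filter_ringOfSetsType mu) _ _ _ aeE) => x E xI.
  have {}E := E xI; move: xI; rewrite /= in_itv/= => xI.
  have zE : z x = w x - b_fun theta2 x * u by rewrite wE; ring.
  rewrite /r /lift_a; rewrite zE qtE// /b_fun in E; rewrite qtE//.
  have -> : - g x = (q x - qc) * (w x - - (x ^+ 2 / c0) * u) - g x -
      (q x - qc) * (w x - - (x ^+ 2 / c0) * u) by ring.
  by rewrite E; ring.
rewrite /r innerDl//; [|by apply: L2D; [exact: L2N|exact: L2Z]|exact: L2Z].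
rewrite innerDl//; [|exact: L2N|exact: L2Z].
rewrite innerNl// !innerZl//; congr (_ + _ * _).
by apply/esym/ae01_inner; [exact: L2_meas|exact: L2_meas|exact: L2_meas|exact: a_fun_ae].
Qed.

End input_operators.

Section closed_loop.
Context {R : realType}.
Variables (theta1 theta2 : R) (p p' q qt : R -> R) (qc : R).
Variables (lam : nat -> R) (phi : nat -> R -> R).
Hypothesis theta1_itv : 0 < theta1 <= pi / 2.
Hypothesis theta2_itv : 0 <= theta2 <= pi / 2.
Hypothesis C1p : C1_01 p p'.
Hypothesis p_gt0 : forall x : R, 0 <= x <= 1 -> 0 < p x.
Hypothesis cq : {within `[0, 1], continuous q}.
Hypothesis cqt : {within `[0, 1], continuous qt}.
Hypothesis qtE : forall x : R, 0 <= x <= 1 -> qt x = q x - qc.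
Hypothesis q_gt0 : forall x : R, 0 <= x <= 1 -> 0 < q x.
Hypothesis spec : sl_spectrum theta1 theta2 p q lam phi.
Variables (N0 N : nat) (K : 'rV[R]_N0) (L : 'cV[R]_N0).
Variables (zh : nat -> R -> R) (z : R -> R -> R).
Hypothesis plant : plant_eq theta1 theta2 p qt K zh z.
Hypothesis wreg : w_regularity theta1 theta2 p q lam phi K zh z.

Local Notation SL := (SL theta1 theta2 p q).
Local Notation w := (homogenized theta2 K zh z).
Local Notation u := (control K zh).
Local Notation a := (a_fun theta2 p qt).
Local Notation b := (b_fun theta2).

Lemma w_SL (t : R) : 0 <= t -> exists f1 h, SL (w t) f1 h.
Proof. by have [_ _ d _ _] := wreg; move=> /d; exact: domA_SL C1p _. Qed.

Lemma w_L2 (t : R) : 0 <= t -> L2 (w t).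
Proof. by move=> /w_SL[f1 [h s]]; have [] := SL_L2 cq s. Qed.

Lemma w_generator : exists2 Aw : R -> R -> R, L2_continuous_on `]0, +oo[ Aw &
  forall t : R, 0 < t -> exists f1, SL (w t) f1 (Aw t).
Proof.
have [_ _ d [Aw [cAw sAw]] _] := wreg; exists Aw => // t t0.
exact: sl_expr_SL C1p p_gt0 _ _ (d _ (ltW t0)) (sAw _ t0).
Qed.

(** The derivative comes from the plant equation plus [u' * b]. It is identified by testing against
    $L^2$ functions, since the images under the generators are known only almost everywhere. *)
Lemma w_derivative (t : R) u' Awt f1 : 0 < t -> is_derive t 1 u u' -> SL (w t) f1 Awt ->
  exists2 wt, L2_derivative w t wt & forall psi, L2 psi -> inner wt psi =
    - inner Awt psi + qc * inner (w t) psi + u t * inner a psi + u' * inner b psi.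
Proof.
move=> t0 du sw; have [_ [g sg dz]] := plant t0.
exists (fun x => - g x + u' * b x).
  have FF := dnbhs_filter (0 : R).
  have du' := cvg_is_derive du.
  have Lb := b_fun_L2 theta2.
  apply: eq_L2_cvg (@L2_cvgD _ _ _ FF _ _ _ _ dz (@L2_cvgZ _ _ _ FF _ _ _ Lb du')) => //.
  by near=> h; apply/funext => x; rewrite /homogenized; ring.
move=> psi Lpsi; have [_ Lg _] := dz.
rewrite innerDl//; last exact/L2Z/b_fun_L2.
rewrite innerZl//; last exact: b_fun_L2.
congr (_ + _).
by rewrite (lifted_generator C1p p_gt0 cq cqt qtE _ sw sg Lpsi (u := u t)).
Unshelve. all: by end_near. Qed.

Lemma mode_is_derive n (t : R) u' : 0 < t -> is_derive t 1 u u' ->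
  is_derive t 1 (fun s => inner (w s) (phi n))
    ((- lam n + qc) * inner (w t) (phi n) + u t * a_coef theta2 p qt phi n
      + u' * b_coef theta2 phi n).
Proof.
move=> t0 du; have [Aw _ /(_ t t0)[f1 sw]] := w_generator.
have [wt dw wE] := w_derivative t0 du sw.
have Lphi := hilbert_L2 (spectrum_basis spec) n.
have := L2_derivative_inner (fun s s0 => w_L2 (ltW s0)) t0 Lphi dw.
rewrite wE// (inner_SL_phi theta1_itv C1p p_gt0 cq spec n sw).
by move=> H; apply: is_derive_to H _; rewrite /a_coef /b_coef; ring.
Qed.

(* The energy [<A w, w>], expressed through [A^{1/2} w], is continuous up to [0]. *)
Lemma energy_exists : exists En : R -> R,
  [/\ {within `[0, +oo[, continuous En},
      forall (t : R) f1 h, 0 <= t -> SL (w t) f1 h -> inner h (w t) = En t &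
      forall (t : R) u' f1 h, 0 < t -> is_derive t 1 u u' -> SL (w t) f1 h ->
        is_derive t 1 En (2 * (- inner h h + qc * inner h (w t) +
          u t * inner a h + u' * inner b h))].
Proof.
have hb := spectrum_basis spec.
have [_ _ _ _ [v [cv sv]]] := wreg.
have EE (t : R) f1 h : 0 <= t -> SL (w t) f1 h -> inner h (w t) = inner (v t) (v t).
  move=> t0 sw; have [_ vs] := sv t t0; have [_ Lv _] := vs.
  have h1 := energy_cvg theta1_itv C1p p_gt0 cq spec sw.
  apply: (cvg_unique _ h1); first exact: Rhausdorff.
  apply: cvg_trans (Parseval hb Lv Lv); apply: near_eq_cvg; near=> m.
  apply: eq_bigr => n _.
  rewrite (L2_sum_coef (hilbert_L2 hb) (hilbert_orth hb) vs).
  have l0 := eigenvalue_gt0 theta1_itv theta2_itv C1p p_gt0 cq q_gt0 spec n.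
  by rewrite mulrACA -expr2 sqr_sqrtr ?(ltW l0)// expr2.
exists (fun t => inner (v t) (v t)); split.
- exact: L2_continuous_sqnorm.
- exact: EE.
move=> t u' f1 h t0 du sw.
have [Aw cAw sAw] := w_generator.
have [g1 sg] := sAw t t0.
have [wt dw wE] := w_derivative t0 du sg.
have [_ _ LA] := SL_L2 cq sg; have [_ _ Lh] := SL_L2 cq sw.
have D : is_derive t 1 (fun s => inner (Aw s) (w s)) (2 * inner (Aw t) wt).
  apply: L2_derivative_form => //.
  - by move=> s s0; exact/w_L2/ltW.
  - by move=> s s0; have [? /(SL_L2 cq)[]] := sAw s s0.
  - move=> r s r0 s0; have [? s1] := sAw r r0; have [? s2] := sAw s s0.
    exact: SL_sym theta1_itv C1p cq _ _ _ _ _ _ s1 s2.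
(* [h] and [Aw t] are two representatives of the image of the same [w t]; their coefficients
   coincide, hence so do all their inner products. *)
have hA psi : L2 psi -> inner h psi = inner (Aw t) psi.
  move=> Lpsi; have h1 := Parseval hb Lh Lpsi; apply: (cvg_unique _ h1).
    exact: Rhausdorff.
  apply: cvg_trans (Parseval hb LA Lpsi); apply: near_eq_cvg; near=> m.
  apply: eq_bigr => n _.
  by rewrite !(inner_SL_phi theta1_itv C1p p_gt0 cq spec n sw,
    inner_SL_phi theta1_itv C1p p_gt0 cq spec n sg).
(* The energy is defined through the square root of [A]; it agrees with the form only at positive
   times near [t], which is enough to transfer the derivative. *)
apply: (@near_eq_is_derive _ _ _ (fun s => inner (Aw s) (w s))).
  near=> s; have s0 : 0 < s by near: s; exact: lt_nbhsr.
  by have [? ss] := sAw s s0; exact: EE (ltW s0) ss.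
apply: is_derive_to D _; congr (_ * _).
have La := a_fun_L2 theta2 C1p cqt; have Lb := b_fun_L2 theta2; have Lw := w_L2 (ltW t0).
rewrite innerC wE// (hA h)// (innerC (Aw t) h) (hA (Aw t))// (hA (w t))//.
rewrite (innerC a h) (hA a)// (innerC b h) (hA b)//.
by rewrite (innerC (w t)) (innerC a) (innerC b).
Unshelve. all: by end_near. Qed.

End closed_loop.

(** * The reduced state *)

Lemma tr_scalar11 (R : realType) (x : 'M[R]_1) : x^T = x.
Proof. by apply/matrixP => i j; rewrite mxE !ord1. Qed.

Lemma Schur_block_qform (R : realType) n (F P : 'M[R]_n) (Lm : 'cV[R]_n)
    (Km : 'rV[R]_n) (Em : 'rV[R]_(n + 1)) (d2 ca cb beta : R) (X : 'cV[R]_n) (y : R) :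
  P^T = P ->
  ((col_mx X y%:M)^T *m
     (block_mx (F^T *m P + P *m F + d2 *: P + ca *: (Km^T *m Km)) (P *m Lm)
        (Lm^T *m P) (- beta)%:M + cb *: (Em^T *m Em)) *m
     col_mx X y%:M) 0 0 =
  2 * (X^T *m P *m (F *m X)) 0 0 + d2 * (X^T *m P *m X) 0 0 +
  ca * ((Km *m X) 0 0) ^+ 2 +
  2 * (X^T *m P *m (Lm *m y%:M)) 0 0 - beta * y ^+ 2 +
  cb * ((Em *m col_mx X y%:M) 0 0) ^+ 2.
Proof.
move=> Ps.
have sq m (B : 'rV[R]_m) (x : 'cV[R]_m) :
    (x^T *m (B^T *m B) *m x) 0 0 = ((B *m x) 0 0) ^+ 2.
  rewrite !mulmxA -trmx_mul -mulmxA mxE big_ord1 expr2.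
  by rewrite tr_scalar11.
have sc m (M : 'M[R]_m) (k : R) (x : 'cV[R]_m) :
    (x^T *m (k *: M) *m x) 0 0 = k * (x^T *m M *m x) 0 0.
  by rewrite -scalemxAr -scalemxAl mxE.
have ad m (M M' : 'M[R]_m) (x : 'cV[R]_m) :
    (x^T *m (M + M') *m x) 0 0 = (x^T *m M *m x) 0 0 + (x^T *m M' *m x) 0 0.
  by rewrite mulmxDr mulmxDl mxE.
rewrite ad sc sq; congr (_ + _).
rewrite tr_col_mx mul_row_block mul_row_col !mulmxDl.
have s4 (A B C D : 'M[R]_1) : (A + B + (C + D)) 0 0 = A 0 0 + B 0 0 + (C 0 0 + D 0 0).
  by rewrite !mxE.
rewrite s4 !ad !sc sq tr_scalar_mx.
have e1 : (X^T *m (F^T *m P) *m X) 0 0 = (X^T *m P *m (F *m X)) 0 0.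
  by rewrite mulmxA -trmx_mul qformC Ps.
have e2 : (y%:M *m (Lm^T *m P) *m X) 0 0 = (X^T *m P *m (Lm *m y%:M)) 0 0.
  by rewrite mulmxA -{1}(tr_scalar_mx _ y) -trmx_mul qformC Ps.
have e3 : (y%:M *m (- beta)%:M *m y%:M : 'M[R]_1) 0 0 = - beta * y ^+ 2.
  by rewrite -!scalar_mxM mxE eqxx mulr1n; ring.
rewrite e1 e2 e3 -!mulmxA; ring.
Qed.

Section block_algebra.
Context {R : realType}.
Variables (theta2 : R) (p qt : R -> R) (qc : R).
Variables (lam : nat -> R) (phi : nat -> R -> R).
Variables (N0 N : nat) (K : 'rV[R]_N0) (L : 'cV[R]_N0).
Implicit Types (Z E : 'cV[R]_N0) (S T : 'cV[R]_(N - N0)).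

Local Notation A0 := (A0 qc lam N0).
Local Notation A1 := (A1 qc lam N0 N).
Local Notation B0 := (B0 theta2 p qt qc lam phi N0).
Local Notation B1 := (B1 theta2 p qt qc lam phi N0 N).
Local Notation C0 := (C0 phi N0).
Local Notation C1 := (C1 lam phi N0 N).
Local Notation F := (Fmx theta2 p qt qc lam phi N K L).
Local Notation Lm := (Lmx N L).
Local Notation Km := (Kmx N K).
Local Notation Em := (Emx theta2 p qt qc lam phi N K L).

Definition state Z E S T : 'cV[R]_(dimX N0 N) := col_mx (col_mx Z E) (col_mx S T).

Lemma Fmx_state Z E S T : F *m state Z E S T =
  state ((A0 + B0 *m K) *m Z + L *m C0 *m E + L *m C1 *m T)
        ((A0 - L *m C0) *m E - L *m C1 *m T)
        (B1 *m K *m Z + A1 *m S) (A1 *m T).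
Proof.
rewrite /Fmx /state /dimX !mul_block_col !add_col_mx !mul0mx ?addr0 ?add0r.
by rewrite mulNmx.
Qed.

Lemma Lmx_mul (y : 'M[R]_1) : Lm *m y = state (L *m y) (- (L *m y)) 0 0.
Proof. by rewrite /Lmx /state /dimX !mul_col_mx mulNmx mul0mx col_mx0. Qed.

Lemma Kmx_state Z E S T : Km *m state Z E S T = K *m Z.
Proof. by rewrite /Kmx /state /dimX !mul_row_col !mul0mx !addr0. Qed.

Lemma Emx_state Z E S T (y : 'M[R]_1) : Em *m col_mx (state Z E S T) y =
  K *m ((A0 + B0 *m K) *m Z + L *m C0 *m E + L *m C1 *m T + L *m y).
Proof.
by rewrite /Emx /state /dimX -mulmxA !mul_row_col !mul0mx ?addr0 ?add0r.
Qed.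

Lemma sqn_state Z E S T : sqn (state Z E S T) = sqn Z + sqn E + (sqn S + sqn T).
Proof. by rewrite /state /dimX !sqn_col_mx. Qed.

Lemma A0_entry Z i : (A0 *m Z) i 0 = (- lam i + qc) * Z i 0.
Proof. by rewrite mul_diag_mx !mxE. Qed.

Lemma A1_entry S i : (A1 *m S) i 0 = (- lam (N0 + i)%N + qc) * S i 0.
Proof. by rewrite mul_diag_mx !mxE. Qed.

Lemma rank1_entry m (B : 'cV[R]_m) (y : 'M[R]_1) i : (B *m y) i 0 = B i 0 * y 0 0.
Proof. by rewrite mxE big_ord1. Qed.

Lemma Theta1_qform delta (P : 'M[R]_(dimX N0 N)) alpha beta gamma
    (X : 'cV[R]_(dimX N0 N)) (y : R) : P^T = P ->
  ((col_mx X y%:M)^T *m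
     Theta1 theta2 p qt qc lam phi K L delta P alpha beta gamma *m
     col_mx X y%:M) 0 0 =
  2 * (X^T *m P *m (F *m X)) 0 0 + 2 * delta * (X^T *m P *m X) 0 0 +
  alpha * gamma * L2norm (residual phi N (a_fun theta2 p qt)) ^+ 2 *
    ((Km *m X) 0 0) ^+ 2 +
  2 * (X^T *m P *m (Lm *m y%:M)) 0 0 - beta * y ^+ 2 +
  alpha * gamma * L2norm (residual phi N (b_fun theta2)) ^+ 2 *
    ((Em *m col_mx X y%:M) 0 0) ^+ 2.
Proof. by move=> Ps; rewrite /Theta1 Schur_block_qform. Qed.

End block_algebra.

Section vector_curves.
Context {R : realType}.

Lemma is_derive_sumR n (h : 'I_n -> R -> R) (t : R) (dh : 'I_n -> R) :
  (forall i, is_derive t 1 (h i) (dh i)) ->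
  is_derive t 1 (fun s => \sum_i h i s) (\sum_i dh i).
Proof.
move=> hh; have := is_derive_sum hh; congr is_derive.
by apply/funext => s; rewrite fct_sumE.
Qed.

Lemma qform_is_derive n (P : 'M[R]_n) (X : R -> 'cV[R]_n) (Y : 'cV[R]_n) (t : R) :
  P^T = P -> (forall i, is_derive t 1 (fun s => X s i 0) (Y i 0)) ->
  is_derive t 1 (fun s => ((X s)^T *m P *m X s) 0 0) (2 * ((X t)^T *m P *m Y) 0 0).
Proof.
move=> Ps dX.
have -> : (fun s => ((X s)^T *m P *m X s) 0 0) =
    (fun s => \sum_i \sum_j (P i j * X s i 0) * X s j 0).
  apply/funext => s; rewrite qformE; apply: eq_bigr => i _; apply: eq_bigr => j _.
  by rewrite (mulrC (P i j)).
have D := is_derive_sumR (fun i => is_derive_sumR (fun j => is_derive_mul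
  (is_derive_mul (is_derive_cst (P i j) t 1) (dX i)) (dX j))).
apply: is_derive_to D _.
rewrite mulr_natl mulr2n {1}qformC Ps !qformE -big_split/=.
apply: eq_bigr => i _; rewrite -big_split/=; apply: eq_bigr => j _.
by rewrite /=; ring.
Qed.

Lemma sum_ord_cat (f : nat -> R) (N0 N : nat) : (N0 <= N)%N ->
  \sum_(k < N) f k = \sum_(k < N0) f k + \sum_(k < N - N0) f (N0 + k)%N.
Proof.
move=> N0N; rewrite -!(big_mkord xpredT f) (@big_cat_nat _ _ _ N0)//=.
congr (_ + _); rewrite -{1}[N0]add0n big_addn big_mkord.
by apply: eq_bigr => k _; rewrite addnC.
Qed.

End vector_curves.

(** * Decay of the Lyapunov functional *)

(** Here [s] will be the squared norm of the tail image and [r] the norm of a residual. The weight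
    is chosen so that [s] always returns with coefficient [alpha^-1], whatever [r]; the case [r = 0]
    is separate because the square being completed divides by [r]. *)
Lemma Young_scaled (R : realFieldType) (alpha s x y r : R) :
  0 < alpha -> 0 <= s -> y ^+ 2 <= r ^+ 2 * s ->
  2 * (x * y) <= alpha * r ^+ 2 * x ^+ 2 + s / alpha.
Proof.
move=> a0 s0 h.
rewrite -(ler_pM2l a0) mulrDr (mulrC alpha (s / alpha)) divfK ?gt_eqF//.
have [r0|r0] := eqVneq r 0.
  have -> : y = 0.
    by move: h; rewrite r0 expr0n mul0r => h; apply/eqP; rewrite -sqrf_eq0 eq_le h sqr_ge0.
  by rewrite r0 expr0n !mulr0 mul0r mulr0 add0r.
have r2 : 0 < r ^+ 2 by rewrite lt_neqAle eq_sym sqrf_eq0 r0 sqr_ge0.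
have h2 : y ^+ 2 / r ^+ 2 <= s by rewrite ler_pdivrMr// mulrC.
have : 0 <= (alpha * r * x - y / r) ^+ 2 by exact: sqr_ge0.
have -> : (alpha * r * x - y / r) ^+ 2 =
  alpha * (alpha * r ^+ 2 * x ^+ 2) - alpha * (2 * (x * y)) + y ^+ 2 / r ^+ 2 by field.
lra.
Qed.

(** [H] is the squared norm of the tail image. The two Young terms consume [2 * ga * H / al] of the
    damping [2 * ga * H]; the rest is at least [2 * ga * (1 - al^-1) * lN * W] and pays for growth,
    decay rate and [be * ze ^+ 2]. The quadratic costs in [v] and [v'] are already inside the first
    inequality. *)
Lemma dissipation (R : realFieldType)
    (al be ga de lN qc M c1 c2 c3 ra rb v v' H ia ib W ze : R) :
  0 < be -> 0 < ga -> 1 < al ->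
  2 * c1 + 2 * de * c3 + al * ga * ra ^+ 2 * v ^+ 2 + 2 * c2 - be * ze ^+ 2 +
    al * ga * rb ^+ 2 * v' ^+ 2 <= 0 ->
  2 * (v * ia) <= al * ra ^+ 2 * v ^+ 2 + H / al ->
  2 * (v' * ib) <= al * rb ^+ 2 * v' ^+ 2 + H / al ->
  0 <= W -> lN * W <= H -> ze ^+ 2 <= M * W ->
  2 * ga * (- (1 - al^-1) * lN + qc + de) + be * M <= 0 ->
  2 * (c1 + c2) + ga * (2 * (- H + qc * W + v * ia + v' * ib)) +
    2 * de * (c3 + ga * W) <= 0.
Proof.
move=> be0 ga0 al1 I1 y1 y2 W0 Wn zW T2.
have h1 := ler_wpM2l (ltW ga0) y1; have h2 := ler_wpM2l (ltW ga0) y2.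
have h3 := ler_wpM2l (ltW be0) zW.
have al0 : 0 < al by apply: lt_trans al1.
have a1' : 0 <= 1 - al^-1 by rewrite subr_ge0 invf_le1// ltW.
have h4 := ler_wpM2l (mulr_ge0 (ltW ga0) a1') Wn.
have h5 := mulr_le0_ge0 T2 W0.
lra.
Qed.

Lemma within_continuous_sum (R : realType) (D : set R) (T : Type) (r : seq T) (h : T -> R -> R) :
  (forall i, {within D, continuous (h i)}) ->
  {within D, continuous (fun s => \sum_(i <- r) h i s)}.
Proof.
move=> ch; elim: r => [|i r IHr].
  rewrite (_ : (fun s => _) = cst 0); last by apply/funext => s; rewrite big_nil.
  by move=> s; exact: cvg_cst.
rewrite (_ : (fun s => _) = (fun s => h i s + \sum_(i <- r) h i s)); last first.
  by apply/funext => s; rewrite big_cons.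
by move=> s; apply: cvgD; [exact: ch|exact: IHr].
Qed.

Lemma within_continuousM (R : realType) (D : set R) (f g : R -> R) :
  {within D, continuous f} -> {within D, continuous g} ->
  {within D, continuous (fun s => f s * g s)}.
Proof. by move=> cf cg s; apply: cvgM; [exact: cf|exact: cg]. Qed.

Lemma within_continuousZ (R : realType) (D : set R) (k : R) (f : R -> R) :
  {within D, continuous f} -> {within D, continuous (fun s => k * f s)}.
Proof. by move=> cf s; apply: cvgM; [exact: cvg_cst|exact: cf]. Qed.

Lemma within_continuousB (R : realType) (D : set R) (f g : R -> R) :
  {within D, continuous f} -> {within D, continuous g} ->
  {within D, continuous (fun s => f s - g s)}.
Proof. by move=> cf cg s; apply: cvgB; [exact: cf|exact: cg]. Qed.

Section Lyapunov_function.
Context {R : realType}.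
Variables (theta1 theta2 : R) (p p' q qt : R -> R) (qc : R).
Variables (lam : nat -> R) (phi : nat -> R -> R).
Hypothesis theta1_itv : 0 < theta1 <= pi / 2.
Hypothesis theta2_itv : 0 <= theta2 <= pi / 2.
Hypothesis C1p : C1_01 p p'.
Hypothesis p_gt0 : forall x : R, 0 <= x <= 1 -> 0 < p x.
Hypothesis cq : {within `[0, 1], continuous q}.
Hypothesis cqt : {within `[0, 1], continuous qt}.
Hypothesis qtE : forall x : R, 0 <= x <= 1 -> qt x = q x - qc.
Hypothesis q_gt0 : forall x : R, 0 <= x <= 1 -> 0 < q x.
Hypothesis spec : sl_spectrum theta1 theta2 p q lam phi.
Variables (N0 N : nat) (K : 'rV[R]_N0) (L : 'cV[R]_N0).
Hypothesis N0N : (N0 <= N)%N.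
Variables (zh : nat -> R -> R) (z : R -> R -> R).
Hypothesis plant : plant_eq theta1 theta2 p qt K zh z.
Hypothesis ctrl : controller_eq theta2 p qt qc lam phi N K L zh z.
Hypothesis zreg : zhat_regularity N zh.
Hypothesis wreg : w_regularity theta1 theta2 p q lam phi K zh z.

Local Notation SL := (SL theta1 theta2 p q).
Local Notation w := (homogenized theta2 K zh z).
Local Notation u := (control K zh).
Local Notation a := (a_fun theta2 p qt).
Local Notation b := (b_fun theta2).
Local Notation b_ := (b_coef theta2 phi).
Local Notation a_ := (a_coef theta2 p qt phi).
Local Notation be := (beta_coef theta2 p qt qc lam phi).
Local Notation F := (Fmx theta2 p qt qc lam phi N K L).
Local Notation Em := (Emx theta2 p qt qc lam phi N K L).
Local Notation l0 := (eigenvalue_gt0 theta1_itv theta2_itv C1p p_gt0 cq q_gt0 spec).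

Definition mode (n : nat) (t : R) := inner (w t) (phi n).
(** Observation error on the original plant: [mode n t - b_ n * u t] is the coefficient of [z], not
    of [w]. *)
Definition err (n : nat) (t : R) := mode n t - b_ n * u t - zh n t.
(** The part of the output produced by the modes beyond the observer; it enters the reduced dynamics
    as a perturbation. *)
Definition zeta (t : R) := w t 0 - \sum_(0 <= n < N) mode n t * phi n 0.
(** [beta_coef] contains [lam n * b_coef n], so higher observer modes are divided by [lam n]; the
    errors are multiplied by the square root of [lam n], so that the squared norm of the output row
    becomes a partial sum of [M_phi]. *)
Definition Xst (t : R) : 'cV[R]_(dimX N0 N) := state
  (\col_(i < N0) zh i t) (\col_(i < N0) err i t)
  (\col_(i < N - N0) (zh (N0 + i)%N t / lam (N0 + i)%N))
  (\col_(i < N - N0) (Num.sqrt (lam (N0 + i)%N) * err (N0 + i)%N t)).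

Lemma controlE t : (K *m \col_(i < N0) zh i t) 0 0 = u t.
Proof. by rewrite mxE; apply: eq_bigr => k _; rewrite mxE. Qed.

Lemma innovationE t :
  innovation theta2 phi N K zh z t = - (\sum_(k < N) err k t * phi k 0) - zeta t.
Proof.
rewrite /innovation /output /zeta big_mkord.
(* [b] vanishes at [0]: the change of unknown does not affect the measurement. *)
have -> : w t 0 = z t 0.
  by rewrite /homogenized /b_fun expr0n /= mul0r oppr0 mul0r addr0.
suff -> : \sum_(k < N) what theta2 phi K zh k t * phi k 0 =
  \sum_(k < N) mode k t * phi k 0 - \sum_(k < N) err k t * phi k 0 by ring.
by rewrite -sumrB; apply: eq_bigr => k _; rewrite /what /err; ring.
Qed.

Definition errvec t := (\col_(i < N0) err i t : 'cV[R]_N0).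
Definition errtail t :=
  (\col_(i < N - N0) (Num.sqrt (lam (N0 + i)%N) * err (N0 + i)%N t) : 'cV[R]_(N - N0)).

Lemma outputerrE t : (C0 phi N0 *m errvec t) 0 0 + (C1 lam phi N0 N *m errtail t) 0 0 =
  \sum_(k < N) err k t * phi k 0.
Proof.
rewrite (sum_ord_cat (fun k => err k t * phi k 0) N0N) !mxE; congr (_ + _).
  by apply: eq_bigr => k _; rewrite !mxE mulrC.
apply: eq_bigr => k _; rewrite !mxE mulrA divfK 1?mulrC//.
by rewrite gt_eqF// sqrtr_gt0 l0.
Qed.

Lemma zh_is_derive (t : R) n : 0 < t -> (n < N)%N -> exists d, is_derive t 1 (zh n) d.
Proof.
move=> t0 nN; have [_ d _] := zreg nN; exists ('D_1 (zh n) t).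
by apply: DeriveDef => //; exact: d.
Qed.

Lemma u_is_derive (t : R) : 0 < t -> exists u', is_derive t 1 u u'.
Proof.
move=> t0.
have h (k : 'I_N0) : exists d, is_derive t 1 (zh k) d.
  by apply: zh_is_derive => //; exact: leq_trans (ltn_ord k) N0N.
have [d hd] := choice h.
exists (\sum_(k < N0) K 0 k * d k).
by apply: is_derive_sumR => k; exact: is_derive_scale.
Qed.

(** The term in [u'] cancels against the derivative of [b_ n * u], and what remains of the input
    recombines into [be n]. *)
Lemma err_is_derive (t : R) n dz : 0 < t -> is_derive t 1 (zh n) dz ->
  is_derive t 1 (err n)
    ((- lam n + qc) * (mode n t - b_ n * u t) + be n * u t - dz).
Proof.
move=> t0 hz; have [u' du] := u_is_derive t0.
have dm := mode_is_derive theta1_itv C1p p_gt0 cq cqt qtE spec plant wreg n t0 du.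
have dbu := is_derive_scale (b_ n) du.
have := is_derive_sub (is_derive_sub dm dbu) hz.
move=> H; apply: is_derive_to H _; rewrite /= /beta_coef /mode.
by ring.
Qed.

Lemma Xst_is_derive (t : R) i : 0 < t -> is_derive t 1 (fun s => Xst s i 0)
  ((F *m Xst t + Lmx N L *m (zeta t)%:M) i 0).
Proof.
move=> t0; rewrite /Xst Fmx_state Lmx_mul -/(errvec t) -/(errtail t).
have [ctrl1 ctrl2] := ctrl.
have z11 : ((zeta t)%:M : 'M[R]_1) 0 0 = zeta t by rewrite mxE eqxx mulr1n.
have cE := outputerrE t.
rewrite /state !add_col_mx.
have sub2 m (A B : 'cV[R]_m) k : (A - B) k 0 = A k 0 - B k 0 by rewrite !mxE.
have add2 m (A B : 'cV[R]_m) k : (A + B) k 0 = A k 0 + B k 0 by rewrite !mxE.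
have opp1 m (A : 'cV[R]_m) k : (- A) k 0 = - A k 0 by rewrite !mxE.
have ue := controlE t.
case: (split_ordP i) => {i} j ->; case: (split_ordP j) => {j} j ->.
- rewrite (_ : (fun s => _) = zh j); last first.
    by apply/funext => s; rewrite !col_mxEu mxE.
  rewrite !col_mxEu; apply: is_derive_to (ctrl1 j t t0) _.
  rewrite innovationE -cE add2 !add2 mulmxDl add2 A0_entry -!mulmxA !rank1_entry.
  by rewrite ue z11 !mxE; ring.
- rewrite (_ : (fun s => _) = err j); last first.
    by apply/funext => s; rewrite col_mxEu col_mxEd mxE.
  rewrite col_mxEu col_mxEd; apply: is_derive_to (err_is_derive t0 (ctrl1 j t t0)) _.
  rewrite innovationE -cE add2 sub2 mulmxBl sub2 opp1 A0_entry -!mulmxA !rank1_entry.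
  by rewrite z11 [errvec t j 0]mxE /err; ring.
- have jN : (N0 <= N0 + j < N)%N by rewrite leq_addr/= -ltn_subRL.
  rewrite (_ : (fun s => _) = (fun s => zh (N0 + j)%N s * (lam (N0 + j)%N)^-1)); last first.
    by apply/funext => s; rewrite col_mxEd col_mxEu mxE.
  rewrite col_mxEd col_mxEu.
  apply: is_derive_to (is_derive_mul (ctrl2 _ _ jN t0)
    (is_derive_cst (lam (N0 + j)%N)^-1 t 1)) _.
  rewrite addr0 add2 -mulmxA rank1_entry ue A1_entry !mxE /=; ring.
- have jN : (N0 <= N0 + j < N)%N by rewrite leq_addr/= -ltn_subRL.
  rewrite (_ : (fun s => _) = (fun s => Num.sqrt (lam (N0 + j)%N) * err (N0 + j)%N s)); last first.
    by apply/funext => s; rewrite !col_mxEd mxE.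
  rewrite !col_mxEd.
  apply: is_derive_to (is_derive_scale _
    (err_is_derive t0 (ctrl2 _ _ jN t0))) _.
  by rewrite addr0 A1_entry [errtail t j 0]mxE /err; ring.
Qed.

(** This is the origin of [Emx]: [u'] is [K] applied to the first block of the reduced dynamics,
    hence linear in the state and [zeta], so the action of [u'] on the tail can be charged to the
    quadratic form of [Theta1]. *)
Lemma u_derivativeE (t : R) : 0 < t ->
  is_derive t 1 u ((Em *m col_mx (Xst t) (zeta t)%:M) 0 0).
Proof.
move=> t0; have dX := fun i => Xst_is_derive i t0.
rewrite /Xst Emx_state.
have h (k : 'I_N0) : is_derive t 1 (zh k)
    ((F *m Xst t + Lmx N L *m (zeta t)%:M) (lshift _ (lshift _ k)) 0).
  have := dX (lshift _ (lshift _ k)).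
  by congr is_derive; apply/funext => s; rewrite /Xst /state !col_mxEu mxE.
have := is_derive_sumR (fun k => is_derive_scale (K 0 k) (h k)).
move=> H; apply: is_derive_to H _; rewrite mxE; apply: eq_bigr => k _; congr (_ * _).
by rewrite /Xst Fmx_state Lmx_mul /state !add_col_mx !col_mxEu.
Qed.

Lemma zeta_sqr_le (t : R) f1 h : 0 <= t -> SL (w t) f1 h ->
  zeta t ^+ 2 <= fine (M_phi lam phi N) * tail_energy lam phi (w t) h N.
Proof.
move=> t0 sw.
exact: (tail_point_eval theta1_itv theta2_itv C1p p_gt0 cq q_gt0 spec N sw).
Qed.

Lemma sum_mode_sqr_is_derive (t : R) (u' : R) : 0 < t -> is_derive t 1 u u' ->
  is_derive t 1 (fun s => \sum_(0 <= n < N) lam n * mode n s ^+ 2)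
    (2 * \sum_(0 <= n < N) lam n * mode n t *
      ((- lam n + qc) * mode n t + u t * a_ n + u' * b_ n)).
Proof.
move=> t0 du.
have dm n := mode_is_derive theta1_itv C1p p_gt0 cq cqt qtE spec plant wreg n t0 du.
have D := is_derive_sumR (fun n : 'I_N => is_derive_scale (lam n) (is_derive_mul (dm n) (dm n))).
rewrite !big_mkord.
rewrite (_ : (fun s => _) = (fun s => \sum_(n < N) lam n * (mode n s * mode n s))).
  apply: is_derive_to D _; rewrite mulr_sumr; apply: eq_bigr => n _.
  by rewrite /mode; ring.
by apply/funext => s; rewrite big_mkord; apply: eq_bigr => n _; rewrite expr2.
Qed.

Local Notation Rplus := (`[0, +oo[%classic : set R).

Lemma zh_continuous n : (n < N)%N -> {within Rplus, continuous (zh n)}.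
Proof. by move=> /zreg[]. Qed.

Lemma mode_continuous n : {within Rplus, continuous (mode n)}.
Proof.
have [cw _ _ _ _] := wreg.
exact: L2_continuous_inner (hilbert_L2 (spectrum_basis spec) n) cw.
Qed.

Lemma u_continuous : {within Rplus, continuous u}.
Proof.
apply: within_continuous_sum => k; apply: within_continuousZ.
by apply: zh_continuous; exact: leq_trans (ltn_ord k) N0N.
Qed.

Lemma err_continuous n : (n < N)%N -> {within Rplus, continuous (err n)}.
Proof.
move=> nN; apply: within_continuousB; last exact: zh_continuous.
by apply: within_continuousB; [exact: mode_continuous|exact/within_continuousZ/u_continuous].
Qed.

Lemma Xst_continuous i : {within Rplus, continuous (fun s => Xst s i 0)}.
Proof.
rewrite /Xst /state.
have hN (j : 'I_N0) : (j < N)%N by exact: leq_trans (ltn_ord j) N0N.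
have hN' (j : 'I_(N - N0)) : (N0 + j < N)%N by rewrite -ltn_subRL.
case: (split_ordP i) => {i} j ->; case: (split_ordP j) => {j} j ->.
- rewrite (_ : (fun s => _) = zh j); first exact: zh_continuous.
  by apply/funext => s; rewrite !col_mxEu mxE.
- rewrite (_ : (fun s => _) = err j); first exact: err_continuous.
  by apply/funext => s; rewrite col_mxEu col_mxEd mxE.
- rewrite (_ : (fun s => _) = (fun s => (lam (N0 + j)%N)^-1 * zh (N0 + j)%N s)).
    exact/within_continuousZ/zh_continuous.
  by apply/funext => s; rewrite col_mxEd col_mxEu mxE mulrC.
- rewrite (_ : (fun s => _) = (fun s => Num.sqrt (lam (N0 + j)%N) * err (N0 + j)%N s)).
    exact/within_continuousZ/err_continuous.
  by apply/funext => s; rewrite !col_mxEd mxE.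
Qed.

Variables (delta : R) (P : 'M[R]_(dimX N0 N)) (alpha beta gamma : R).
Hypothesis lmi : LMI theta2 p qt qc lam phi K L delta P alpha beta gamma.

Lemma Lyapunov_decay : exists En : R -> R,
  [/\ {within `[0, +oo[, continuous En},
      forall (t : R) f1 h, 0 <= t -> SL (w t) f1 h -> inner h (w t) = En t &
      let V t := ((Xst t)^T *m P *m Xst t) 0 0 +
        gamma * (En t - \sum_(0 <= n < N) lam n * mode n t ^+ 2) in
      forall t : R, 0 <= t -> V t <= expR (- 2 * delta * t) * V 0].
Proof.
have hb := spectrum_basis spec.
have [[Ps Ppos] a1 [beta0 gamma0] [T1s T1le] T2le] := lmi.
have [En [cEn EnE dEn]] := energy_exists theta1_itv theta2_itv C1p p_gt0 cq cqt qtE q_gt0 spec plant wreg.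
exists En; split => //; set V := fun t => _.
pose u' t := (Em *m col_mx (Xst t) (zeta t)%:M) 0 0.
(* [h] stands for a representative of [A w] at time [t]; the finite sum is the derivative of the
   head. *)
pose dW t (h : R -> R) := 2 * (- inner h h + qc * inner h (w t) + u t * inner a h + u' t * inner b h) -
  2 * \sum_(0 <= n < N) lam n * mode n t * ((- lam n + qc) * mode n t + u t * a_ n + u' t * b_ n).
have [Aw cAw sAw] := w_generator C1p p_gt0 wreg.
pose V' t := 2 * ((Xst t)^T *m P *m (F *m Xst t + Lmx N L *m (zeta t)%:M)) 0 0 +
  gamma * dW t (Aw t).
apply: (@exponential_decay _ V V').
- rewrite (_ : V = fun s => \sum_i \sum_j (P i j * (Xst s i 0 * Xst s j 0)) -
      - gamma * (En s - \sum_(0 <= n < N) lam n * (mode n s * mode n s))).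
    apply: within_continuousB.
      apply: within_continuous_sum => i; apply: within_continuous_sum => j.
      by apply: within_continuousZ; apply: within_continuousM; exact: Xst_continuous.
    apply: within_continuousZ; apply: within_continuousB => //.
    apply: within_continuous_sum => n; apply: within_continuousZ.
    by apply: within_continuousM; exact: mode_continuous.
  apply/funext => s; rewrite /V mulNr opprK qformE; congr (_ + _).
  by apply: eq_bigr => i _; apply: eq_bigr => j _; ring.
- move=> t t0; have [f1 sw] := sAw t t0; have du := u_derivativeE t0.
  have d1 := qform_is_derive Ps (fun i => Xst_is_derive i t0).
  have d2 := dEn t _ f1 _ t0 du sw.
  have d3 := sum_mode_sqr_is_derive t0 du.
  exact: (is_derive_add d1 (is_derive_scale gamma (is_derive_sub d2 d3))).
move=> t t0; have [f1 sw] := sAw t t0.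
set h := Aw t in sw.
pose ht := tail_image lam phi (w t) h N.
pose W := tail_energy lam phi (w t) h N.
have La := a_fun_L2 theta2 C1p cqt; have Lb := b_fun_L2 theta2.
have [Lw _ Lh] := SL_L2 cq sw.
have Lp := L2_partial hb (fun n => lam n * mode n t) N.
have Lht : L2 ht by exact: L2B.
have hta psi : L2 psi -> inner psi ht = inner psi h -
    \sum_(0 <= n < N) lam n * mode n t * inner psi (phi n).
  move=> Lpsi; rewrite innerC innerBl// innerC; congr (_ - _).
  by rewrite (inner_partial hb).
(* The tail image is orthogonal to the first [N] eigenfunctions, so the mixed terms disappear. *)
have htht : inner ht ht = inner h h - \sum_(0 <= n < N) (lam n * mode n t) ^+ 2.
  rewrite hta//.
  rewrite [X in _ - X]big_nat big1 ?subr0; last first.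
    move=> n /andP[_ nN].
    rewrite (inner_tail_phi theta1_itv C1p p_gt0 cq spec N sw) leqNgt nN.
    by rewrite mulr0.
  rewrite innerC hta//; congr (_ - _); apply: eq_bigr => n _.
  by rewrite (inner_SL_phi theta1_itv C1p p_gt0 cq spec n sw) /mode expr2.
have WE : W = En t - \sum_(0 <= n < N) lam n * mode n t ^+ 2.
  by rewrite /W /tail_energy (EnE t f1 h (ltW t0) sw).
(* The head's derivative removes exactly the first [N] modes from each inner product, so the tail
   energy obeys the full energy's law with [ht] and [W] in place of [h] and the energy. *)
have dWE : dW t h = 2 * (- inner ht ht + qc * W + u t * inner a ht + u' t * inner b ht).
  rewrite htht (hta a La) (hta b Lb) WE -(EnE t f1 h (ltW t0) sw) /dW.
  have -> : \sum_(0 <= n < N) lam n * mode n t *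
      ((- lam n + qc) * mode n t + u t * a_ n + u' t * b_ n) =
     - (\sum_(0 <= n < N) (lam n * mode n t) ^+ 2) +
     qc * (\sum_(0 <= n < N) lam n * mode n t ^+ 2) +
     u t * (\sum_(0 <= n < N) lam n * mode n t * inner a (phi n)) +
     u' t * (\sum_(0 <= n < N) lam n * mode n t * inner b (phi n)).
    rewrite -sumrN !mulr_sumr -!big_split/=; apply: eq_bigr => n _.
    by rewrite /a_coef /b_coef; ring.
  ring.
have res psi : L2 psi -> inner psi ht ^+ 2 <= L2norm (residual phi N psi) ^+ 2 * inner ht ht.
  move=> Lpsi; rewrite innerC (tail_inner_residual theta1_itv C1p p_gt0 cq spec N sw)//.
  by rewrite mulrC sqr_L2norm; apply: inner_CauchySchwarz => //; have [] := residualP hb N Lpsi.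
have W0 := tail_energy_ge0 theta1_itv theta2_itv C1p p_gt0 cq q_gt0 spec N sw.
have Wn := tail_image_norm theta1_itv theta2_itv C1p p_gt0 cq q_gt0 spec N sw.
have zW := zeta_sqr_le (ltW t0) sw.
rewrite -/W in W0 Wn zW; rewrite -/ht in Wn.
have I1 := T1le (col_mx (Xst t) (zeta t)%:M).
rewrite (Theta1_qform _ _ _ _ _ _ _ _ _ _ _ _ _ _ Ps) in I1.
have uE : (Kmx N K *m Xst t) 0 0 = u t by rewrite /Xst Kmx_state controlE.
rewrite uE -/(u' t) in I1.
rewrite /V' /V -WE dWE.
rewrite mulmxDr.
have add00 (A B : 'M[R]_1) : (A + B) 0 0 = A 0 0 + B 0 0 by rewrite mxE.
rewrite add00.
have a0 : 0 < alpha by apply: lt_trans a1.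
have y1 := Young_scaled (u t) a0 (inner_ge0 ht) (res a La).
have y2 := Young_scaled (u' t) a0 (inner_ge0 ht) (res b Lb).
exact: (dissipation beta0 gamma0 a1 I1 y1 y2 W0 Wn zW T2le).
Qed.

End Lyapunov_function.

(** * Equivalence of norms and stability *)

Lemma sqr_sum3 (R : realDomainType) (x y z : R) :
  (x + y + z) ^+ 2 <= 3 * (x ^+ 2 + y ^+ 2 + z ^+ 2).
Proof.
have := sqr_ge0 (x - y); have := sqr_ge0 (y - z); have := sqr_ge0 (x - z).
rewrite !sqrrB !sqrrD mulrDl !mulr2n; lra.
Qed.

Lemma sqr_H1norm_le (R : realType) (f f1 g g1 h : R -> R) (k : R) :
  weak_deriv f f1 -> weak_deriv g g1 ->
  (forall x : R, 0 <= x <= 1 -> h x = f x + k * g x) ->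
  H1norm h ^+ 2 <= 2 * H1norm f ^+ 2 + 2 * k ^+ 2 * H1norm g ^+ 2.
Proof.
move=> df dg hE; have dh := weak_derivD df (weak_derivZ k dg).
have dh' := eq_weak_deriv (fun x xI => esym (hE x xI)) (fun _ _ => erefl) dh.
rewrite (sqr_H1norm dh') (sqr_H1norm df) (sqr_H1norm dg) (eq_inner hE hE).
have [Lf Lg] := (weak_deriv_L2 df, weak_deriv_L2 dg).
have [[Lf1 _] [Lg1 _]] := (df, dg).
have := inner_sqrDle Lf (L2Z k Lg); have := inner_sqrDle Lf1 (L2Z k Lg1).
rewrite !innerZl ?innerZr//; [lra|exact: L2Z..].
Qed.

(* S, W: squared norm of the reduced state and tail energy; Sz, Se: squared
   norms of the observer modes and of the observation errors. *)
Lemma norm_from_energy (R : realFieldType) (Mx B Hb cl kK c1 c2 : R) :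
  0 <= Mx -> 0 <= B -> 0 <= Hb -> 0 < cl -> 0 <= kK -> 0 < c1 -> 0 < c2 ->
  exists2 C, 0 < C & forall H Hw u2 Sz Se S W En : R,
    Sz <= c1 * S -> Se <= c2 * S -> u2 <= kK * Sz ->
    En <= W + Mx * (3 * (Se + Sz + B * u2)) -> cl * Hw <= En ->
    H <= 2 * Hw + 2 * u2 * Hb -> 0 <= S -> 0 <= W -> H + Sz <= C * (S + W).
Proof.
move=> Mx0 B0 Hb0 cl0 kK0 c10 c20.
pose D := 1 + Mx * (3 * (c2 + c1 + B * (kK * c1))).
have kc := mulr_ge0 kK0 (ltW c10).
have Bk := mulr_ge0 B0 kc.
have s0 : 0 <= 3 * (c2 + c1 + B * (kK * c1)) by lra.
have D0 : 0 < D by rewrite /D ltr_pwDl// mulr_ge0.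
exists (2 * (D / cl) + 2 * (kK * c1) * Hb + c1).
  have h1 := mulr_ge0 kc Hb0; have h2 := divr_gt0 D0 cl0; lra.
move=> H Hw u2 Sz Se S W En hz he hu hE hw hH S0 W0.
have hu' : u2 <= kK * c1 * S by rewrite -mulrA; apply: le_trans hu _; exact: ler_wpM2l.
have hB := ler_wpM2l B0 hu'.
have hE2 : En <= D * (S + W).
  have h : Mx * (3 * (Se + Sz + B * u2)) <= Mx * (3 * (c2 + c1 + B * (kK * c1)) * S).
    by apply: ler_wpM2l => //; lra.
  have h0 : 0 <= Mx * (3 * (c2 + c1 + B * (kK * c1)) * W).
    by rewrite mulr_ge0// mulr_ge0.
  by rewrite /D; lra.
have hHw : Hw <= D / cl * (S + W).
  by rewrite mulrAC ler_pdivlMr// mulrC; exact: le_trans hE2.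
have hu3 : u2 * Hb <= kK * c1 * S * Hb by exact: ler_wpM2r.
have h1 : 0 <= kK * c1 * W * Hb by apply: mulr_ge0 => //; exact: mulr_ge0.
have h2 := mulr_ge0 (ltW c10) W0.
lra.
Qed.

(** Converse comparison: [H] and [Hw] are the squared $H^1$ norms of [z] and [w], [B] and [Hb] the
    squared $L^2$ and $H^1$ norms of [b], [u2] the squared control. As [u2] is bounded by the
    observer modes, so are [w] and then the errors. *)
Lemma energy_from_norm (R : realFieldType) (B Hb cu kK c1 c2 : R) :
  0 <= B -> 0 <= Hb -> 0 < cu -> 0 <= kK -> 0 < c1 -> 0 < c2 ->
  exists2 C, 0 < C & forall H Hw u2 Sz Se S En : R,
    S <= c1 * Sz + c2 * Se -> u2 <= kK * Sz -> Se <= 3 * (Hw + Sz + B * u2) ->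
    En <= cu * Hw -> Hw <= 2 * H + 2 * u2 * Hb -> 0 <= H -> 0 <= Sz ->
    S + En <= C * (H + Sz).
Proof.
move=> B0 Hb0 cu0 kK0 c10 c20.
pose D := 2 + 2 * kK * Hb.
have kHb := mulr_ge0 kK0 Hb0.
have D0 : 0 < D by rewrite /D; lra.
have BkK := mulr_ge0 B0 kK0.
exists (c1 + c2 * (3 * (D + 1 + B * kK)) + cu * D).
  have h1 : 0 <= c2 * (3 * (D + 1 + B * kK)) by rewrite mulr_ge0 ?ltW//; lra.
  have h2 := mulr_gt0 cu0 D0; lra.
move=> H Hw u2 Sz Se S En hS hu hSe hE hw H0 Sz0.
have hu1 := ler_wpM2r Hb0 hu; have hu2 := ler_wpM2l B0 hu.
have hw2 : Hw <= D * (H + Sz).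
  have : 0 <= kK * Hb * H by exact: mulr_ge0.
  by rewrite /D; lra.
have hSe2 : Se <= 3 * (D + 1 + B * kK) * (H + Sz).
  have : 0 <= B * kK * H by exact: mulr_ge0.
  by lra.
have h1 := ler_wpM2l (ltW c20) hSe2.
have h2 := ler_wpM2l (ltW cu0) hw2.
have h3 := mulr_ge0 (ltW c10) H0.
lra.
Qed.

Section norm_equivalence.
Context {R : realType}.
Variables (theta1 theta2 : R) (p p' q : R -> R).
Variables (lam : nat -> R) (phi : nat -> R -> R).
Hypothesis theta1_itv : 0 < theta1 <= pi / 2.
Hypothesis theta2_itv : 0 <= theta2 <= pi / 2.
Hypothesis C1p : C1_01 p p'.
Hypothesis p_gt0 : forall x : R, 0 <= x <= 1 -> 0 < p x.
Hypothesis cq : {within `[0, 1], continuous q}.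
Hypothesis q_gt0 : forall x : R, 0 <= x <= 1 -> 0 < q x.
Hypothesis spec : sl_spectrum theta1 theta2 p q lam phi.
Variables (N0 N : nat) (K : 'rV[R]_N0).
Hypothesis N0N : (N0 <= N)%N.

Local Notation SL := (SL theta1 theta2 p q).
Local Notation w := (homogenized theta2 K).
Local Notation u := (control K).
Local Notation b := (b_fun theta2).
Local Notation l0 := (eigenvalue_gt0 theta1_itv theta2_itv C1p p_gt0 cq q_gt0 spec).
Local Notation Xst := (Xst theta2 lam phi N K).
Local Notation mode := (mode theta2 phi K).
Local Notation err := (err theta2 phi K).

Lemma lam_le m n : (m <= n)%N -> lam m <= lam n.
Proof.
case: spec => mono _ _ _; rewrite leq_eqVlt => /predU1P[->//|mn].
exact/ltW/mono.
Qed.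

Lemma sqn_Xst zh z t : sqn (Xst zh z t) =
  \sum_(i < N0) zh i t ^+ 2 + \sum_(i < N0) err zh z i t ^+ 2 +
  (\sum_(i < N - N0) (zh (N0 + i)%N t / lam (N0 + i)%N) ^+ 2 +
   \sum_(i < N - N0) lam (N0 + i)%N * err zh z (N0 + i)%N t ^+ 2).
Proof.
rewrite /Xst sqn_state /sqn; congr (_ + _ + (_ + _)); apply: eq_bigr => i _;
  by rewrite mxE// exprMn sqr_sqrtr// ltW// l0.
Qed.

Lemma control_sqr_le zh (t : R) :
  u zh t ^+ 2 <= (\sum_(k < N0) K 0 k ^+ 2) * \sum_(n < N) zh n t ^+ 2.
Proof.
apply: le_trans (sqr_sum_CauchySchwarz _ _ _) _.
apply: ler_wpM2l; first by apply: sumr_ge0 => i _; exact: sqr_ge0.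
rewrite (sum_ord_cat (fun n => zh n t ^+ 2) N0N) lerDl.
by apply: sumr_ge0 => i _; exact: sqr_ge0.
Qed.

(** Removing the weights costs at most the square of the largest eigenvalue involved. Dependence on
    [N] is harmless here: the stability constant is taken for fixed [N]. *)
Lemma zh_le_state : exists2 C : R, 0 < C & forall (zh : nat -> R -> R) (z : R -> R -> R) (t : R),
  \sum_(n < N) zh n t ^+ 2 <= C * sqn (Xst zh z t).
Proof.
exists (1 + lam N ^+ 2); first by rewrite ltr_pwDl// sqr_ge0.
move=> zh z t; rewrite sqn_Xst (sum_ord_cat (fun n => zh n t ^+ 2) N0N).
set s1 := \sum_(i < N0) _; set s2 := \sum_(i < N0) _.
set s3 := \sum_(i < N - N0) _; set s4 := \sum_(i < N - N0) _.
set s5 := \sum_(i < N - N0) _.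
have [h1 h2 h4] : [/\ 0 <= s1, 0 <= s2 & 0 <= s4].
  by split; apply: sumr_ge0 => i _; rewrite sqr_ge0.
have h5 : 0 <= s5 by apply: sumr_ge0 => i _; rewrite mulr_ge0 ?sqr_ge0// ltW// l0.
have h3 : s3 <= lam N ^+ 2 * s4.
  rewrite mulr_sumr; apply: ler_sum => i _.
  rewrite -{1}(divfK (lt0r_neq0 (l0 (N0 + i)%N)) (zh (N0 + i)%N t)) exprMn mulrC.
  apply: ler_wpM2r; first exact: sqr_ge0.
  apply: lerXn2r; rewrite ?nnegrE ?(ltW (l0 _))//.
  by rewrite lam_le// ltnW// -ltn_subRL.
have : 0 <= lam N ^+ 2 by exact: sqr_ge0.
have h6 := mulr_ge0 (sqr_ge0 (lam N)) h1.
have h7 := mulr_ge0 (sqr_ge0 (lam N)) h2.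
have h8 := mulr_ge0 (sqr_ge0 (lam N)) h5.
lra.
Qed.

Lemma err_le_state : exists2 C : R, 0 < C & forall (zh : nat -> R -> R) (z : R -> R -> R) (t : R),
  \sum_(n < N) err zh z n t ^+ 2 <= C * sqn (Xst zh z t).
Proof.
have l00 := l0 0; have l0i : 0 < (lam 0)^-1 by rewrite invr_gt0.
exists (1 + (lam 0)^-1); first by rewrite ltr_pwDl// ltW.
move=> zh z t; rewrite sqn_Xst (sum_ord_cat (fun n => err zh z n t ^+ 2) N0N).
set s1 := \sum_(i < N0) _; set s2 := \sum_(i < N - N0) _.
set s3 := \sum_(i < N0) _.
set s4 := \sum_(i < N - N0) _; set s5 := \sum_(i < N - N0) _.
have [h1 h2 h4] : [/\ 0 <= s1, 0 <= s3 & 0 <= s4].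
  by split; apply: sumr_ge0 => i _; rewrite sqr_ge0.
have h5 : 0 <= s5 by apply: sumr_ge0 => i _; rewrite mulr_ge0 ?sqr_ge0// ltW// l0.
have h3 : s2 <= (lam 0)^-1 * s5.
  rewrite mulr_sumr; apply: ler_sum => i _.
  rewrite mulrA ler_peMl ?sqr_ge0// mulrC ler_pdivlMr// mul1r.
  exact: lam_le.
have h6 := mulr_ge0 (ltW l0i) h1.
have h7 := mulr_ge0 (ltW l0i) h2.
have h8 := mulr_ge0 (ltW l0i) h4.
lra.
Qed.

Lemma state_le : exists c1 c2 : R,
  [/\ 0 < c1, 0 < c2 & forall (zh : nat -> R -> R) (z : R -> R -> R) (t : R),
  sqn (Xst zh z t) <=
    c1 * (\sum_(n < N) zh n t ^+ 2) + c2 * (\sum_(n < N) err zh z n t ^+ 2)].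
Proof.
have l00 := l0 0; have l0i : 0 < (lam 0)^-1 by rewrite invr_gt0.
exists (1 + (lam 0)^-1 ^+ 2), (1 + lam N); split.
- by rewrite ltr_pwDl// sqr_ge0.
- by rewrite ltr_pwDl// ltW// l0.
move=> zh z t; rewrite sqn_Xst (sum_ord_cat (fun n => err zh z n t ^+ 2) N0N).
rewrite (sum_ord_cat (fun n => zh n t ^+ 2) N0N).
set s1 := \sum_(i < N0) _; set s3 := \sum_(i < N0) _.
set s4 := \sum_(i < N - N0) _; set s5 := \sum_(i < N - N0) _.
set s2 := \sum_(i < N - N0) _; set s6 := \sum_(i < N - N0) _.
have [h1 h2 h4 h5] : [/\ 0 <= s1, 0 <= s3, 0 <= s2 & 0 <= s6].
  by split; apply: sumr_ge0 => i _; rewrite sqr_ge0.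
have h3 : s4 <= (lam 0)^-1 ^+ 2 * s2.
  rewrite mulr_sumr; apply: ler_sum => i _.
  rewrite exprMn mulrC; apply: ler_wpM2r; first exact: sqr_ge0.
  apply: lerXn2r; rewrite ?nnegrE ?invr_ge0 ?(ltW (l0 _))//.
  by rewrite lef_pV2 ?posrE ?l0// lam_le.
have h7 : s5 <= lam N * s6.
  rewrite mulr_sumr; apply: ler_sum => i _; apply: ler_wpM2r; first exact: sqr_ge0.
  by rewrite lam_le// ltnW// -ltn_subRL.
have h6 := mulr_ge0 (sqr_ge0 (lam 0)^-1) h1.
have h8 := mulr_ge0 (ltW (l0 N)) h2.
lra.
Qed.

Lemma bcoef_sum_le : \sum_(n < N) b_coef theta2 phi n ^+ 2 <= inner b b.
Proof.
have := Bessel (spectrum_basis spec) N (b_fun_L2 theta2).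
by rewrite big_mkord.
Qed.

Lemma sum3_sqr_le (f g h : nat -> R) (k B : R) : \sum_(n < N) h n ^+ 2 <= B ->
  \sum_(n < N) (f n + g n + k * h n) ^+ 2 <=
  3 * (\sum_(n < N) f n ^+ 2 + \sum_(n < N) g n ^+ 2 + B * k ^+ 2).
Proof.
move=> hB.
apply: le_trans (ler_sum _ (fun (n : 'I_N) _ => sqr_sum3 (f n) (g n) (k * h n))) _.
rewrite -mulr_sumr ler_pM2l// !big_split/= lerD2l.
under eq_bigr do rewrite exprMn.
by rewrite -mulr_sumr mulrC ler_wpM2r ?sqr_ge0.
Qed.

(** The energy of [w] is the tail plus [N] modes with weights at most [lam N], and each mode is
    error plus observer mode plus [b_n u]. Coercivity turns this into the $H^1$ norm of [w], and
    subtracting [b u] gives that of [z]. *)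
Lemma H1norm_le_state : exists2 C : R, 0 < C & forall (zh : nat -> R -> R) (z : R -> R -> R) (t : R) f1 h,
  SL (w zh z t) f1 h ->
  H1norm (z t) ^+ 2 + \sum_(n < N) zh n t ^+ 2 <=
  C * (sqn (Xst zh z t) + tail_energy lam phi (w zh z t) h N).
Proof.
have [cl cl0 low] := eform_lower theta1_itv theta2_itv C1p p_gt0 cq q_gt0.
have [c1 c10 h1] := zh_le_state; have [c2 c20 h2] := err_le_state.
have kK0 : 0 <= \sum_(k < N0) K 0 k ^+ 2 by apply: sumr_ge0 => i _; exact: sqr_ge0.
have [C C0 hC] := norm_from_energy (ltW (l0 N)) (inner_ge0 b) (sqr_ge0 (H1norm b)) cl0 kK0 c10 c20.
exists C => // zh z t f1 h sw.
have [dw _ _ _ _] := sw.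
have W0 := tail_energy_ge0 theta1_itv theta2_itv C1p p_gt0 cq q_gt0 spec N sw.
apply: (hC _ (H1norm (w zh z t) ^+ 2) (u zh t ^+ 2) _ _ _ _ (inner h (w zh z t)) (h1 zh z t)
  (h2 zh z t) (control_sqr_le zh t)) => //.
- rewrite /tail_energy -lerBlDl opprB addrC subrK.
  apply: le_trans (_ : lam N * \sum_(n < N) (err zh z n t + zh n t + u zh t * b_coef theta2 phi n) ^+ 2 <= _).
    rewrite big_mkord mulr_sumr; apply: ler_sum => n _.
    rewrite (_ : _ + _ + _ = mode zh z n t); last by rewrite /err; ring.
    by apply: ler_wpM2r; [exact: sqr_ge0|exact/lam_le/ltnW].
  apply: ler_wpM2l; first exact/ltW/l0.
  exact: (sum3_sqr_le (err zh z ^~ t) (zh ^~ t) (u zh t) bcoef_sum_le).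
- by rewrite (sqr_H1norm dw) (inner_SL theta1_itv C1p cq sw); exact: low.
- rewrite -(sqrrN (u zh t)); apply: sqr_H1norm_le dw (b_fun_weak_deriv theta2) _.
  by move=> x _; rewrite /homogenized; ring.
- exact: sqn_ge0.
Qed.

Lemma state_le_H1norm : exists2 C : R, 0 < C & forall (zh : nat -> R -> R) (z : R -> R -> R) (t : R) f1 h,
  SL (w zh z t) f1 h ->
  sqn (Xst zh z t) + inner h (w zh z t) <=
  C * (H1norm (z t) ^+ 2 + \sum_(n < N) zh n t ^+ 2).
Proof.
have [cu cu0 up] := eform_upper theta1_itv theta2_itv C1p p_gt0 cq.
have [c1 [c2 [c10 c20 h12]]] := state_le.
have kK0 : 0 <= \sum_(k < N0) K 0 k ^+ 2 by apply: sumr_ge0 => i _; exact: sqr_ge0.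
have [C C0 hC] := energy_from_norm (inner_ge0 b) (sqr_ge0 (H1norm b)) cu0 kK0 c10 c20.
exists C => // zh z t f1 h sw.
have [dw _ _ _ _] := sw.
have dz : weak_deriv (z t) (fun x => f1 x + - u zh t * b_deriv theta2 x).
  apply: eq_weak_deriv (weak_derivD dw (weak_derivZ (- u zh t) (b_fun_weak_deriv theta2))) => // x _.
  by rewrite /homogenized; ring.
apply: (hC _ (H1norm (w zh z t) ^+ 2) (u zh t ^+ 2) _ _ _ _ (h12 zh z t) (control_sqr_le zh t)).
- rewrite (_ : \sum_(n < N) err zh z n t ^+ 2 = \sum_(n < N) (mode zh z n t + - zh n t +
    - u zh t * b_coef theta2 phi n) ^+ 2); last first.
    by apply: eq_bigr => n _; congr (_ ^+ 2); rewrite /err; ring.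
  apply: le_trans (sum3_sqr_le (fun n => mode zh z n t) (fun n => - zh n t) (- u zh t) bcoef_sum_le) _.
  rewrite ler_pM2l// sqrrN lerD2r.
  under [X in _ + X <= _]eq_bigr do rewrite sqrrN.
  rewrite lerD2r (sqr_H1norm dw).
  have := Bessel (spectrum_basis spec) N (weak_deriv_L2 dw).
  by rewrite big_mkord => /le_trans; apply; rewrite lerDl inner_ge0.
- by rewrite (inner_SL theta1_itv C1p cq sw) (sqr_H1norm dw); exact: up.
- apply: sqr_H1norm_le dz (b_fun_weak_deriv theta2) _.
  by move=> x _; rewrite /homogenized; ring.
- exact: sqr_ge0.
- by apply: sumr_ge0 => i _; exact: sqr_ge0.
Qed.

End norm_equivalence.

Lemma exponential_stability (R : realType) (theta1 theta2 : R) (p p' q qt : R -> R) (qc : R)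
    (lam : nat -> R) (phi : nat -> R -> R) (N0 N : nat) (K : 'rV[R]_N0) (L : 'cV[R]_N0)
    (delta : R) (P : 'M[R]_(dimX N0 N)) (alpha beta gamma : R) :
  0 < theta1 <= pi / 2 -> 0 <= theta2 <= pi / 2 -> C1_01 p p' ->
  (forall x : R, 0 <= x <= 1 -> 0 < p x) ->
  {within `[0, 1], continuous q} -> {within `[0, 1], continuous qt} ->
  (forall x : R, 0 <= x <= 1 -> qt x = q x - qc) ->
  (forall x : R, 0 <= x <= 1 -> 0 < q x) ->
  sl_spectrum theta1 theta2 p q lam phi -> (N0 <= N)%N ->
  LMI theta2 p qt qc lam phi K L delta P alpha beta gamma ->
  exists2 M : R, 0 < M & forall (zh : nat -> R -> R) (z : R -> R -> R),
    plant_eq theta1 theta2 p qt K zh z ->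
    controller_eq theta2 p qt qc lam phi N K L zh z ->
    zhat_regularity N zh -> w_regularity theta1 theta2 p q lam phi K zh z ->
    forall t : R, 0 <= t ->
    H1norm (z t) ^+ 2 + \sum_(n < N) zh n t ^+ 2 <=
    M * expR (- 2 * delta * t) * (H1norm (z 0) ^+ 2 + \sum_(n < N) zh n 0 ^+ 2).
Proof.
move=> th1 th2 C1p p0 cq cqt qtE q0 spec N0N lmi.
have [Ppos _ [beta0 gamma0] _ _] := lmi.
have [m m0 Pm] := posdef_lower Ppos; have [CP CP0 PC] := qform_bound P.
have [C1 C10 hC1] := H1norm_le_state th1 th2 C1p p0 cq q0 spec K N0N.
have [C2 C20 hC2] := state_le_H1norm th1 th2 C1p p0 cq q0 spec K N0N.
have D0 : 0 < m^-1 + gamma^-1 by rewrite addr_gt0 ?invr_gt0.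
have CPg : 0 < CP + gamma by exact: addr_gt0.
(* [V] dominates [m] times the squared state plus [gamma] times the tail, whence [m^-1 + gamma^-1];
   it is at most [CP + gamma] times state plus energy. [C1] and [C2] convert to and from $H^1$
   norms. *)
exists (C1 * (m^-1 + gamma^-1) * ((CP + gamma) * C2)).
  by apply: mulr_gt0; apply: mulr_gt0.
move=> zh z plant ctrl zreg wreg t t0.
have [En [_ EnE dec0]] := Lyapunov_decay th1 th2 C1p p0 cq cqt qtE q0 spec N0N plant ctrl zreg wreg lmi.
have [f1 [h sw]] := w_SL C1p wreg t0.
have [f10 [h0 sw0]] := w_SL C1p wreg (lexx 0).
pose V (s : R) := ((Xst theta2 lam phi N K zh z s)^T *m P *m Xst theta2 lam phi N K zh z s) 0 0 +
  gamma * (En s - \sum_(0 <= n < N) lam n * mode theta2 phi K zh z n s ^+ 2).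
have dec : V t <= expR (- 2 * delta * t) * V 0 by exact: dec0.
have tW : tail_energy lam phi (homogenized theta2 K zh z t) h N =
    En t - \sum_(0 <= n < N) lam n * mode theta2 phi K zh z n t ^+ 2.
  by rewrite /tail_energy (EnE t f1 h t0 sw).
have W0 := tail_energy_ge0 th1 th2 C1p p0 cq q0 spec N sw.
(* The tail at level [0] is the full energy. *)
have E00 := tail_energy_ge0 th1 th2 C1p p0 cq q0 spec 0 sw0.
rewrite /tail_energy big_geq// subr0 in E00.
have hz := hC1 zh z t f1 h sw; have hz0 := hC2 zh z 0 f10 h0 sw0.
have e0 := EnE 0 f10 h0 (lexx 0) sw0.
have V0 : V 0 <= (CP + gamma) * C2 * (H1norm (z 0) ^+ 2 + \sum_(n < N) zh n 0 ^+ 2).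
  rewrite e0 in hz0 E00.
  rewrite -mulrA; apply: le_trans (_ : (CP + gamma) * (sqn (Xst theta2 lam phi N K zh z 0) + En 0) <= _);
    last by rewrite ler_pM2l.
  rewrite /V; apply: le_trans (_ : CP * sqn (Xst theta2 lam phi N K zh z 0) + gamma * En 0 <= _).
    apply: lerD; first exact: PC.
    rewrite ler_pM2l// lerBlDl lerDr big_mkord; apply: sumr_ge0 => i _.
    by apply: mulr_ge0; [exact/ltW/(eigenvalue_gt0 th1 th2 C1p p0 cq q0 spec)|exact: sqr_ge0].
  have := mulr_ge0 (ltW gamma0) (sqn_ge0 (Xst theta2 lam phi N K zh z 0)).
  have := mulr_ge0 (ltW CP0) E00; lra.
rewrite tW in hz W0.
have ex0 := expR_gt0 (- 2 * delta * t); set ex := expR _ in dec ex0 *.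
apply: le_trans hz _; rewrite -!mulrA ler_pM2l//.
apply: le_trans (_ : (m^-1 + gamma^-1) * V t <= _); last first.
  rewrite ler_pM2l//; apply: le_trans dec _.
  rewrite [leRHS](_ : _ =
    ex * ((CP + gamma) * C2 * (H1norm (z 0) ^+ 2 + \sum_(n < N) zh n 0 ^+ 2))); last by ring.
  by rewrite ler_pM2l.
have hP := Pm (Xst theta2 lam phi N K zh z t).
rewrite /V; move: hP W0; set S := sqn _; move: ((_ *m _ *m _) 0 0) => X; set W := En t - _.
move=> hP W0; have S0 : 0 <= S by exact: sqn_ge0.
have mi0 : 0 < m^-1 by rewrite invr_gt0.
have gi0 : 0 < gamma^-1 by rewrite invr_gt0.
have a1 : S <= m^-1 * X by rewrite -(ler_pM2l m0) mulVKf ?gt_eqF.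
have a2 : 0 <= gamma^-1 * X.
  exact: mulr_ge0 (ltW gi0) (le_trans (mulr_ge0 (ltW m0) S0) hP).
have a3 : 0 <= m^-1 * (gamma * W) by exact: mulr_ge0 (ltW mi0) (mulr_ge0 (ltW gamma0) W0).
have a4 : gamma^-1 * (gamma * W) = W by rewrite mulKf ?gt_eqF.
lra.
Qed.

(** * Feasibility of the constraints *)

(** Scalar form of [Theta1] being nonpositive: [z], [e], [s], [t] are squared norms of the four
    state blocks, [y] that of the perturbation, [sy] that of the total output error. [kappa] absorbs
    [D1 * e]; small [rho] and [gamma] cost little of the decay of [z]; a large [sigma] and
    [beta = 2 * Q] absorb [sy], split between [t] and [y]. *)
Lemma LMI_weights (R : realFieldType) (c1 c2 D1 D2 D3 eta BK Mc A G : R) :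
  0 < c1 -> 0 < c2 -> 0 < D1 -> 0 < D2 -> 0 < D3 -> 0 < eta -> 0 <= BK -> 0 <= Mc ->
  0 <= A -> 0 <= G ->
  exists kappa rho sigma beta gamma : R,
    [/\ 0 < kappa, 0 < rho, 0 < sigma, 0 < beta & 0 < gamma] /\
    forall z e s t y sy : R, 0 <= z -> 0 <= e -> 0 <= s -> 0 <= t -> 0 <= y -> 0 <= sy ->
      sy <= 2 * (Mc * t) + 2 * y ->
      - (c1 / 2) * z + D1 * e + D2 * sy + kappa * (- (c2 / 2) * e + D3 * sy) +
      rho * (- eta * s + BK * z) - 2 * eta * sigma * t + 2 * gamma * (A * z) +
      2 * gamma * (G * (z + e + sy)) - beta * y <= 0.
Proof.
move=> c10 c20 D10 D20 D30 eta0 BK0 Mc0 A0 G0.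
pose kappa := 2 * (D1 + 1) / c2.
pose rho := c1 / (8 * (BK + 1)).
(* The factor in [8 / c1] makes [g2 * (A + G)] at most both [1] and [c1 / 8]. *)
pose g2 := ((A + G + 1) * (1 + 8 / c1))^-1.
pose Q := D2 + kappa * D3 + 1.
pose sigma := Q * Mc / eta + 1.
have AG0 : 0 < A + G + 1 by lra.
have c8 : 0 < 8 / c1 by rewrite divr_gt0.
have c81 : 0 < 1 + 8 / c1 by lra.
have kappa0 : 0 < kappa by rewrite divr_gt0//; lra.
have rho0 : 0 < rho by rewrite divr_gt0//; lra.
have g20 : 0 < g2 by rewrite invr_gt0 mulr_gt0.
have kD : 0 < kappa * D3 by exact: mulr_gt0.
have Q0 : 0 < Q by rewrite /Q; lra.
have QM : 0 <= Q * Mc by apply: mulr_ge0 => //; exact: ltW.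
have sigma0 : 0 < sigma.
  have : 0 <= Q * Mc / eta by rewrite divr_ge0// ltW.
  by rewrite /sigma; lra.
have hk : kappa * c2 = 2 * (D1 + 1) by rewrite /kappa divfK ?gt_eqF.
have hr : rho * BK <= c1 / 8.
  rewrite /rho mulrAC ler_pdivrMr ?mulr_gt0//; last lra.
  by have := mulr_ge0 (ltW c10) BK0; lra.
have hg : g2 * (A + G) <= (1 + 8 / c1)^-1.
  rewrite /g2 invfM mulrAC ler_piMl//; first by rewrite invr_ge0 ltW.
  by rewrite mulrC ler_pdivrMr//; lra.
have hg1 : g2 * (A + G) <= 1.
  by apply: le_trans hg _; rewrite invf_le1//; lra.
have hg2 : g2 * (A + G) <= c1 / 8.
  apply: le_trans hg _; rewrite -[leRHS]invrK lef_pV2 ?posrE ?invr_gt0//; last by rewrite divr_gt0.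
  by rewrite invf_div; lra.
have hs : eta * sigma = Q * Mc + eta by rewrite /sigma mulrDr mulr1 mulrC divfK ?gt_eqF.
have gA := mulr_ge0 (ltW g20) A0; have gG := mulr_ge0 (ltW g20) G0.
have gG1 : g2 * G <= 1 by lra.
exists kappa, rho, sigma, (2 * Q), (g2 / 2); split.
  by split=> //; lra.
move=> z e s t y sy z0 e0 s0 t0 y0 sy0 hsy.
have i1 : (rho * BK + g2 * (A + G)) * z <= c1 / 4 * z by rewrite ler_wpM2r//; lra.
have i2 : (g2 * G) * e <= 1 * e by rewrite ler_wpM2r.
have i3 : (D2 + kappa * D3 + g2 * G) * sy <= Q * sy by rewrite ler_wpM2r// /Q; lra.
have i4 : Q * sy <= Q * (2 * (Mc * t) + 2 * y) by rewrite ler_pM2l.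
have i5 : 0 <= rho * eta * s by apply: mulr_ge0 => //; apply: mulr_ge0; exact: ltW.
have i6 : (eta * sigma) * t = (Q * Mc + eta) * t by rewrite hs.
have i7 : (kappa * c2) * e = 2 * (D1 + 1) * e by rewrite hk.
have i8 := mulr_ge0 (ltW eta0) t0.
have i9 := mulr_ge0 (ltW c10) z0.
lra.
Qed.

Lemma LMI_assemble (R : realFieldType) (kappa rho sigma beta gamma delta : R)
    (s t y2 UB VB cz ce cs ct X1 X2 x1 x2 x3 x4 x5 x6 ra rb u2 v2 : R) :
  0 < kappa -> 0 < rho -> 0 < sigma -> 0 < gamma ->
  cz + kappa * ce + rho * cs - ct * sigma * t + 2 * gamma * UB + 2 * gamma * VB -
    beta * y2 <= 0 ->
  X1 + X2 = x3 + kappa * x4 + (rho * x5 + sigma * x6) ->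
  2 * x3 + 2 * delta * x1 <= cz -> 2 * x4 + 2 * delta * x2 <= ce ->
  2 * x5 + 2 * delta * s <= cs -> 2 * x6 + 2 * delta * t <= - ct * t ->
  ra * u2 <= UB -> rb * v2 <= VB ->
  2 * X1 + 2 * delta * (x1 + kappa * x2 + rho * s + sigma * t) +
  2 * gamma * ra * u2 + 2 * X2 - beta * y2 + 2 * gamma * rb * v2 <= 0.
Proof.
move=> k0 r0 s0 g0 H dX hz he hs ht ha hb.
have := ler_wpM2l (ltW k0) he; have := ler_wpM2l (ltW r0) hs.
have := ler_wpM2l (ltW s0) ht; have := ler_wpM2l (ltW g0) ha.
have := ler_wpM2l (ltW g0) hb.
lra.
Qed.

Lemma sqr_sum2 (R : realDomainType) (x y : R) : (x + y) ^+ 2 <= 2 * x ^+ 2 + 2 * y ^+ 2.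
Proof. have := sqr_ge0 (x - y); rewrite sqrrB sqrrD !mulr2n; lra. Qed.

Lemma weighted_sum3_le (R : realDomainType) (x1 x2 x3 g1 g2 g3 z e v : R) :
  0 <= g1 -> 0 <= g2 -> 0 <= g3 -> 0 <= z -> 0 <= e -> 0 <= v ->
  x1 <= g1 * z -> x2 <= g2 * e -> x3 <= g3 * v ->
  x1 + x2 + x3 <= (g1 + g2 + g3) * (z + e + v).
Proof.
move=> g10 g20 g30 z0 e0 v0 h1 h2 h3.
have := mulr_ge0 g10 e0; have := mulr_ge0 g10 v0.
have := mulr_ge0 g20 z0; have := mulr_ge0 g20 v0.
have := mulr_ge0 g30 e0; have := mulr_ge0 g30 z0.
lra.
Qed.

Section block_diagonal.
Context {R : realType}.

Lemma bilinear_Young m n (M : 'M[R]_(m, n)) (eps : R) : 0 < eps ->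
  exists2 D : R, 0 < D & forall (x : 'cV[R]_m) (y : 'cV[R]_n),
    `|2 * (x^T *m M *m y) 0 0| <= eps * sqn x + D * sqn y.
Proof.
move=> eps0; have [C C0 hC] := bilinear_bound M.
(* Scaling [x] by [k] in the symmetric bound and dividing by [k] puts [2 * C * k = eps] in front of
   [sqn x]. *)
pose k : R := eps / (2 * C).
have k0 : 0 < k by rewrite divr_gt0// mulr_gt0.
exists (2 * C / k); first by rewrite divr_gt0// mulr_gt0.
move=> x y; rewrite -(ler_pM2l k0).
have sq : sqn (k *: x) = k ^+ 2 * sqn x.
  by rewrite /sqn mulr_sumr; apply: eq_bigr => i _; rewrite mxE exprMn.
have := hC (k *: x) y; rewrite sq linearZ/= -!scalemxAl mxE normrM gtr0_norm// => h.
rewrite normrM ger0_norm//.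
have e1 : k * (2 * C / k * sqn y) = 2 * (C * sqn y).
  by field; rewrite gt_eqF.
have e2 : eps = 2 * C * k by rewrite /k; field; rewrite gt_eqF.
rewrite mulrDr e1 e2; move: h; set a := `|_|; rewrite expr2; lra.
Qed.

Lemma sqn_gt0 n (x : 'cV[R]_n) : x != 0 -> 0 < sqn x.
Proof.
apply: contraNT; rewrite -leNgt => h; apply/eqP/matrixP => i j; rewrite ord1 mxE.
by apply/eqP; rewrite -sqrf_eq0 eq_le sqr_ge0 (le_trans (sqr_le_sqn x i) h).
Qed.

Lemma sqn_scalar (y : R) : sqn (y%:M : 'cV[R]_1) = y ^+ 2.
Proof. by rewrite /sqn big_ord1 mxE eqxx mulr1n. Qed.

Variables (N0 N : nat).

Definition Pdiag (P1 P2 : 'M[R]_N0) (kappa rho sigma : R) : 'M[R]_(dimX N0 N) :=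
  block_mx (block_mx P1 0 0 (kappa *: P2)) 0 0 (block_mx rho%:M 0 0 sigma%:M).

Lemma Pdiag_form P1 P2 kappa rho sigma Z E S T Z' E' S' T' :
  ((state (N := N) Z E S T)^T *m Pdiag P1 P2 kappa rho sigma *m state Z' E' S' T') 0 0 =
  (Z^T *m P1 *m Z') 0 0 + kappa * (E^T *m P2 *m E') 0 0 +
  rho * (S^T *m S') 0 0 + sigma * (T^T *m T') 0 0.
Proof.
rewrite /state /Pdiag /dimX !tr_col_mx !mul_row_block !mulmx0 !addr0 !add0r.
rewrite !mul_row_col !mul_mx_scalar.
have add00 (A B : 'M[R]_1) : (A + B) 0 0 = A 0 0 + B 0 0 by rewrite mxE.
have sc00 (k : R) (A : 'M[R]_1) : (k *: A) 0 0 = k * A 0 0 by rewrite mxE.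
by rewrite !add00 -scalemxAr -!scalemxAl !sc00 addrA.
Qed.

Lemma state_surj (X : 'cV[R]_(dimX N0 N)) : exists Z E S T, X = state Z E S T.
Proof.
exists (usubmx (usubmx X)), (dsubmx (usubmx X)), (usubmx (dsubmx X)), (dsubmx (dsubmx X)).
by rewrite /state !vsubmxK.
Qed.

Lemma Pdiag_posdef P1 P2 kappa rho sigma : posdef P1 -> posdef P2 ->
  0 < kappa -> 0 < rho -> 0 < sigma -> posdef (Pdiag P1 P2 kappa rho sigma).
Proof.
move=> p1 p2 k0 r0 s0; have [[s1 _] [s2 _]] := (p1, p2); split.
  by rewrite /Pdiag !tr_block_mx !trmx0 linearZ/= s1 s2 !tr_scalar_mx.
have [m1 m10 h1] := posdef_lower p1; have [m2 m20 h2] := posdef_lower p2.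
move=> x /sqn_gt0; have [Z [E [S [T ->]]]] := state_surj x.
rewrite sqn_state Pdiag_form -!sqnE => pos.
have [z0 e0 S0 t0] : [/\ 0 <= sqn Z, 0 <= sqn E, 0 <= sqn S & 0 <= sqn T].
  by split; exact: sqn_ge0.
have g1 := le_trans (mulr_ge0 (ltW m10) z0) (h1 Z).
have g2 := mulr_ge0 (ltW k0) (le_trans (mulr_ge0 (ltW m20) e0) (h2 E)).
have g3 := mulr_ge0 (ltW r0) S0; have g4 := mulr_ge0 (ltW s0) t0.
have [z1|z1] := ltrP 0 (sqn Z).
  by have := lt_le_trans (mulr_gt0 m10 z1) (h1 Z); lra.
have [e1|e1] := ltrP 0 (sqn E).
  by have := mulr_gt0 k0 (lt_le_trans (mulr_gt0 m20 e1) (h2 E)); lra.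
have [S1|S1] := ltrP 0 (sqn S); first by have := mulr_gt0 r0 S1; lra.
have t1 : 0 < sqn T by lra.
by have := mulr_gt0 s0 t1; lra.
Qed.

End block_diagonal.

Section feasibility.
Context {R : realType}.

Lemma rowmul_sqr_le n (r : 'rV[R]_n) (x : 'cV[R]_n) :
  ((r *m x) 0 0) ^+ 2 <= sqn r^T * sqn x.
Proof.
rewrite mxE; apply: le_trans (sqr_sum_CauchySchwarz _ _ _) _.
by rewrite /sqn; under [X in _ <= X * _]eq_bigr do rewrite mxE.
Qed.

Lemma Young_vec n (x y : 'cV[R]_n) (eta : R) : 0 < eta ->
  2 * (x^T *m y) 0 0 <= eta * sqn x + eta^-1 * sqn y.
Proof.
move=> e0; rewrite mxE /sqn !mulr_sumr -big_split; apply: ler_sum => i _ /=.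
rewrite mxE -(ler_pM2l e0) mulrDr mulVKf ?gt_eqF//.
have := sqr_ge0 (eta * x i 0 - y i 0); rewrite sqrrB mulr2n exprMn; lra.
Qed.

Lemma sqn_mul_scalar n (x : 'cV[R]_n) (v : 'M[R]_1) : sqn (x *m v) = v 0 0 ^+ 2 * sqn x.
Proof.
rewrite /sqn mulr_sumr; apply: eq_bigr => i _.
by rewrite rank1_entry exprMn mulrC.
Qed.

Lemma Schur_block_sym n (F P : 'M[R]_n) (Lm : 'cV[R]_n) (Km : 'rV[R]_n)
    (Em : 'rV[R]_(n + 1)) (d2 ca cb beta : R) : P^T = P ->
  let M := block_mx (F^T *m P + P *m F + d2 *: P + ca *: (Km^T *m Km)) (P *m Lm)
        (Lm^T *m P) (- beta)%:M + cb *: (Em^T *m Em) in M^T = M.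
Proof.
move=> Ps M; rewrite /M linearD/= tr_block_mx !linearD/= !linearZ/= !trmx_mul !trmxK Ps.
by rewrite tr_scalar_mx [P *m F + _]addrC.
Qed.

Lemma L2_residual_sqr (theta1 theta2 : R) (p q : R -> R) lam (phi : nat -> R -> R) N f :
  sl_spectrum theta1 theta2 p q lam phi -> L2 f ->
  L2norm (residual phi N f) ^+ 2 <= inner f f.
Proof.
move=> spec Lf; rewrite -sqr_L2norm; apply: lerXn2r; rewrite ?nnegrE ?L2norm_ge0//.
exact: residual_norm_le spec _ _ Lf.
Qed.

Variables (theta1 theta2 : R) (p p' q qt : R -> R) (qc : R).
Variables (lam : nat -> R) (phi : nat -> R -> R).
Hypothesis theta1_itv : 0 < theta1 <= pi / 2.
Hypothesis theta2_itv : 0 <= theta2 <= pi / 2.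
Hypothesis C1p : C1_01 p p'.
Hypothesis p_gt0 : forall x : R, 0 <= x <= 1 -> 0 < p x.
Hypothesis cq : {within `[0, 1], continuous q}.
Hypothesis cqt : {within `[0, 1], continuous qt}.
Hypothesis q_gt0 : forall x : R, 0 <= x <= 1 -> 0 < q x.
Hypothesis spec : sl_spectrum theta1 theta2 p q lam phi.
Variables (N0 : nat) (K : 'rV[R]_N0) (L : 'cV[R]_N0) (delta eta : R).
Hypothesis eta_gt0 : 0 < eta.
Hypothesis gap : forall n, (N0 <= n)%N -> - lam n + qc <= - delta - eta.

Local Notation A0 := (A0 qc lam N0).
Local Notation A1 := (A1 qc lam N0).
Local Notation B0 := (B0 theta2 p qt qc lam phi N0).
Local Notation B1 := (B1 theta2 p qt qc lam phi N0).
Local Notation C0 := (C0 phi N0).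
Local Notation C1 := (C1 lam phi N0).
Local Notation l0 := (eigenvalue_gt0 theta1_itv theta2_itv C1p p_gt0 cq q_gt0 spec).
Local Notation a := (a_fun theta2 p qt).
Local Notation b := (b_fun theta2).

Lemma A1_form N (S : 'cV[R]_(N - N0)) :
  2 * (S^T *m (A1 N *m S)) 0 0 + 2 * delta * (S^T *m S) 0 0 <= - (2 * eta) * sqn S.
Proof.
rewrite -sqnE mxE /sqn !mulr_sumr -big_split; apply: ler_sum => i _.
rewrite mxE A1_entry /=.
have := ler_wpM2r (sqr_ge0 (S i 0)) (gap (leq_addr i N0)).
rewrite expr2; lra.
Qed.

(** The squared norm of the row is a partial sum of [M_phi] started at [N0]: a bound independent of
    [N]. *)
Lemma C1_sqr_le N (T : 'cV[R]_(N - N0)) :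
  ((C1 N *m T) 0 0) ^+ 2 <= fine (M_phi lam phi N0) * sqn T.
Proof.
apply: le_trans (rowmul_sqr_le _ _) _; apply: ler_wpM2r; first exact: sqn_ge0.
have [N0N|NN0] := leqP N0 N; last first.
  have e : (N - N0 = 0)%N by apply/eqP; rewrite subn_eq0 ltnW.
  rewrite /sqn; case: _ / (esym e) (C1 N)^T => x; rewrite big_ord0.
  exact: (fine_M_phi_ge0 theta1_itv theta2_itv C1p p_gt0 cq q_gt0 spec).
apply: le_trans (partial_M_phi theta1_itv theta2_itv C1p p_gt0 cq q_gt0 spec N0 N).
have -> : \sum_(N0 <= n < N) phi n 0 ^+ 2 / lam n =
    \sum_(i < N - N0) phi (N0 + i)%N 0 ^+ 2 / lam (N0 + i)%N.
  rewrite -{1}[N0]add0n big_addn big_mkord; apply: eq_bigr => i _.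
  by rewrite addnC.
by apply: ler_sum => i _; rewrite !mxE expr_div_n sqr_sqrtr ?(ltW (l0 _)).
Qed.

(** An entry is [a_n / lam n + (-1 + qc / lam n) * b_n], with factors bounded because [lam]
    increases; Bessel's inequality for [a] and [b] then gives a bound uniform in [N]. *)
Lemma B1_sqn_le : exists2 B : R, 0 <= B & forall N, sqn (B1 N) <= B.
Proof.
have La := a_fun_L2 theta2 C1p cqt; have Lb := b_fun_L2 theta2.
pose m := (lam 0)^-1; pose k := 1 + `|qc| * m.
have m0 : 0 < m by rewrite invr_gt0 l0.
have k0 : 0 <= k by rewrite addr_ge0// mulr_ge0// ltW.
exists (2 * (m ^+ 2 * inner a a) + 2 * (k ^+ 2 * inner b b)).
  by rewrite addr_ge0// mulr_ge0// mulr_ge0 ?sqr_ge0 ?inner_ge0.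
move=> N.
have [N0N|NN0] := leqP N0 N; last first.
  have e : (N - N0 = 0)%N by apply/eqP; rewrite subn_eq0 ltnW.
  rewrite /sqn; case: _ / (esym e) (B1 N) => x; rewrite big_ord0.
  by rewrite addr_ge0// mulr_ge0// mulr_ge0 ?sqr_ge0 ?inner_ge0.
pose g n := 2 * (m ^+ 2 * inner a (phi n) ^+ 2) + 2 * (k ^+ 2 * inner b (phi n) ^+ 2).
have g0 n : 0 <= g n by rewrite addr_ge0// mulr_ge0// mulr_ge0 ?sqr_ge0.
apply: le_trans (_ : \sum_(n < N) g n <= _).
  rewrite (sum_ord_cat g N0N).
  apply: le_trans (_ : \sum_(i < N - N0) g (N0 + i)%N <= _); last first.
    by rewrite lerDr sumr_ge0.
  apply: ler_sum => i _; rewrite mxE; set n := (N0 + i)%N.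
  have ln := l0 n.
  have lm : (lam n)^-1 <= m by rewrite lef_pV2 ?posrE ?l0// (lam_le spec).
  have ln0 : 0 < (lam n)^-1 by rewrite invr_gt0.
  rewrite /beta_coef /a_coef /b_coef.
  set x := inner a _; set y := inner b _.
  rewrite (_ : (x + (- lam n + qc) * y) / lam n = (lam n)^-1 * x + (- 1 + qc / lam n) * y); last first.
    by field; rewrite gt_eqF.
  have h1 : ((lam n)^-1 * x) ^+ 2 <= m ^+ 2 * x ^+ 2.
    rewrite exprMn ler_wpM2r ?sqr_ge0//.
    by apply: lerXn2r; rewrite ?nnegrE ?(ltW m0) ?(ltW ln0).
  have h2 : ((- 1 + qc / lam n) * y) ^+ 2 <= k ^+ 2 * y ^+ 2.
    rewrite exprMn ler_wpM2r ?sqr_ge0// -(real_normK (num_real _)).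
    apply: lerXn2r; rewrite ?nnegrE//.
    apply: le_trans (ler_normD _ _) _; rewrite normrN1 lerD2l normrM.
    by rewrite (gtr0_norm ln0) ler_wpM2l.
  have := sqr_ge0 ((lam n)^-1 * x - (- 1 + qc / lam n) * y).
  rewrite sqrrB sqrrD !mulr2n /g -/x -/y; lra.
rewrite big_split/= -!mulr_sumr.
have ha := Bessel (spectrum_basis spec) N La; have hb := Bessel (spectrum_basis spec) N Lb.
rewrite !big_mkord in ha hb.
by apply: lerD; rewrite ler_pM2l// ler_wpM2l ?sqr_ge0.
Qed.

Lemma Fmx_Lmx_state N Z E S T (y : 'M[R]_1) :
  Fmx theta2 p qt qc lam phi N K L *m state Z E S T + Lmx N L *m y =
  state ((A0 + B0 *m K) *m Z + L *m C0 *m E + L *m (C1 N *m T + y))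
        ((A0 - L *m C0) *m E - L *m (C1 N *m T + y))
        (B1 N *m (K *m Z) + A1 N *m S) (A1 N *m T).
Proof.
rewrite Fmx_state Lmx_mul /state !add_col_mx !addr0 !mulmxDr !mulmxA opprD.
by rewrite !addrA.
Qed.

Lemma LMI_feasible :
  spectral_abscissa_lt (A0 + B0 *m K) (- delta) ->
  spectral_abscissa_lt (A0 - L *m C0) (- delta) ->
  exists Nmin : nat, forall N, (Nmin <= N)%N ->
    exists (P : 'M[R]_(dimX N0 N)) (alpha beta gamma : R),
    LMI theta2 p qt qc lam phi K L delta P alpha beta gamma.
Proof.
move=> /Lyapunov_Hurwitz[P1 [pP1 [c1 c10 h1]]] /Lyapunov_Hurwitz[P2 [pP2 [c2 c20 h2]]].
have c14 : 0 < c1 / 4 by rewrite divr_gt0.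
have c22 : 0 < c2 / 2 by rewrite divr_gt0.
have [D1 D10 y1] := bilinear_Young (P1 *m (L *m C0)) c14.
have [D2 D20 y2] := bilinear_Young (P1 *m L) c14.
have [D3 D30 y3] := bilinear_Young (P2 *m L) c22.
have [Bc Bc0 hB] := B1_sqn_le.
have [Mc Mc0 hMc] := fine_M_phi_le theta1_itv theta2_itv C1p p_gt0 cq q_gt0 spec.
pose kK := sqn K^T.
(* Bounds the square of [u'], a sum of three row products, whence the factor 3. *)
pose G := 3 * (sqn (K *m (A0 + B0 *m K))^T + sqn (K *m (L *m C0))^T + sqn (K *m L)^T).
have G0 : 0 <= G by rewrite mulr_ge0// !addr_ge0// sqn_ge0.
have BK0 : 0 <= eta^-1 * (kK * Bc).
  by rewrite mulr_ge0 ?invr_ge0 ?(ltW eta_gt0)// mulr_ge0 ?sqn_ge0.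
have A0' : 0 <= inner a a * kK by rewrite mulr_ge0 ?inner_ge0 ?sqn_ge0.
have G0' : 0 <= inner b b * G by rewrite mulr_ge0 ?inner_ge0.
have [kappa [rho [sigma [beta [gamma [[k0 r0 s0 be0 g0] hw]]]]]] :=
  LMI_weights c10 c20 D10 D20 D30 eta_gt0 BK0 (ltW Mc0) A0' G0'.
have [Cg Cg0 hg] := eigenvalue_linear_growth theta1_itv theta2_itv C1p p_gt0 cq q_gt0 spec.
(* With [alpha = 2], [Theta2] is at most [- gamma * lam N + 2 * gamma * (qc + delta) + beta * Mc];
   [Cg] turns the required lower bound on [lam N] into one on [N]. *)
pose B := Cg * (2 * (qc + delta) + beta * Mc / gamma).
exists (Num.truncn B).+1 => N NB.
exists (Pdiag N P1 P2 kappa rho sigma), 2, beta, gamma.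
have Pp := Pdiag_posdef N pP1 pP2 k0 r0 s0.
have [Ps _] := Pp.
split => //; first by rewrite ltr1n.
  split; first exact: Schur_block_sym.
  move=> x; rewrite -(vsubmxK x).
  have [Z [E [S [T ->]]]] := state_surj (usubmx x).
  rewrite [dsubmx x]mx11_scalar; move: (dsubmx x 0 0) => y {x}.
  rewrite (Theta1_qform _ _ _ _ _ _ _ _ _ _ _ _ _ _ Ps) Kmx_state Emx_state.
  (* Tail errors and perturbation enter only through [L], and by the same scalar, so they are
     estimated together. *)
  pose v := C1 N *m T + y%:M.
  have add00 (M M' : 'M[R]_1) : (M + M') 0 0 = M 0 0 + M' 0 0 by rewrite mxE.
  have opp00 (M : 'M[R]_1) : (- M) 0 0 = - M 0 0 by rewrite mxE.
  have dXE := congr1 (fun V => ((state Z E S T)^T *m Pdiag N P1 P2 kappa rho sigma *m V) 0 0)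
    (Fmx_Lmx_state Z E S T y%:M).
  rewrite /= mulmxDr add00 Pdiag_form -/v in dXE.
  rewrite -addrA in dXE.
  have vE : L *m C1 N *m T + L *m y%:M = L *m v by rewrite mulmxDr mulmxA.
  have uE : K *m ((A0 + B0 *m K) *m Z + L *m C0 *m E + L *m C1 N *m T + L *m y%:M) =
      K *m (A0 + B0 *m K) *m Z + K *m (L *m C0) *m E + K *m L *m v.
    by rewrite -addrA vE (mulmxDr K) (mulmxDr K) !mulmxA.
  rewrite uE Pdiag_form -!sqnE.
  have Hz : 2 * (Z^T *m P1 *m ((A0 + B0 *m K) *m Z + L *m C0 *m E + L *m v)) 0 0 +
      2 * delta * (Z^T *m P1 *m Z) 0 0 <= - (c1 / 2) * sqn Z + D1 * sqn E + D2 * sqn v.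
    rewrite !(mulmxDr (Z^T *m P1)) !add00.
    have := h1 Z; have := le_trans (ler_norm _) (y1 Z E).
    have := le_trans (ler_norm _) (y2 Z v); rewrite !mulmxA; lra.
  have He : 2 * (E^T *m P2 *m ((A0 - L *m C0) *m E - L *m v)) 0 0 +
      2 * delta * (E^T *m P2 *m E) 0 0 <= - (c2 / 2) * sqn E + D3 * sqn v.
    rewrite (mulmxDr (E^T *m P2)) add00 mulmxN opp00.
    have := h2 E; have := y3 E v; rewrite ler_norml => /andP[+ _]; rewrite !mulmxA; lra.
  have u2 := rowmul_sqr_le K Z; rewrite -/kK in u2.
  have Hs : 2 * (S^T *m (B1 N *m (K *m Z) + A1 N *m S)) 0 0 + 2 * delta * sqn S <=
      - eta * sqn S + eta^-1 * (kK * Bc) * sqn Z.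
    rewrite mulmxDr add00.
    have := A1_form S; have := Young_vec S (B1 N *m (K *m Z)) eta_gt0.
    rewrite sqn_mul_scalar -sqnE => yS aS.
    have h : eta^-1 * (((K *m Z) 0 0) ^+ 2 * sqn (B1 N)) <= eta^-1 * (kK * Bc) * sqn Z.
      rewrite -mulrA ler_pM2l ?invr_gt0//.
      rewrite [kK * Bc * _]mulrAC; apply: ler_pM; rewrite ?sqr_ge0 ?sqn_ge0//.
    lra.
  have Ht := A1_form T; rewrite -sqnE in Ht.
  have Ha : L2norm (residual phi N a) ^+ 2 * ((K *m Z) 0 0) ^+ 2 <= inner a a * kK * sqn Z.
    rewrite -mulrA; apply: ler_pM => //; rewrite ?sqr_ge0//.
    by apply: (L2_residual_sqr N spec); exact: (a_fun_L2 theta2 C1p cqt).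
  have Hb : L2norm (residual phi N b) ^+ 2 * ((K *m (A0 + B0 *m K) *m Z +
      K *m (L *m C0) *m E + K *m L *m v) 0 0) ^+ 2 <=
      inner b b * G * (sqn Z + sqn E + sqn v).
    rewrite -mulrA; apply: ler_pM; rewrite ?sqr_ge0//.
      by apply: (L2_residual_sqr N spec); exact: b_fun_L2.
    rewrite !add00; apply: le_trans (sqr_sum3 _ _ _) _.
    rewrite /G -mulrA ler_pM2l//.
    by apply: weighted_sum3_le; rewrite ?sqn_ge0//; exact: rowmul_sqr_le.
  have Hv : sqn v <= 2 * (Mc * sqn T) + 2 * y ^+ 2.
    have -> : sqn v = ((C1 N *m T) 0 0 + y) ^+ 2.
      by rewrite [v]mx11_scalar sqn_scalar /v add00 [_%:M 0 0]mxE eqxx mulr1n.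
    have h : ((C1 N *m T) 0 0) ^+ 2 <= Mc * sqn T.
      by apply: le_trans (C1_sqr_le T) _; rewrite ler_wpM2r ?sqn_ge0.
    by apply: le_trans (sqr_sum2 _ _) _; rewrite lerD2r ler_pM2l.
  have H := hw _ _ _ _ _ _ (sqn_ge0 Z) (sqn_ge0 E) (sqn_ge0 S) (sqn_ge0 T) (sqr_ge0 y) (sqn_ge0 v) Hv.
  exact: (LMI_assemble k0 r0 s0 g0 H dXE Hz He Hs Ht Ha Hb).
rewrite /Theta2.
have lN : 2 * (qc + delta) + beta * Mc / gamma <= lam N.
  rewrite -(ler_pM2l Cg0); apply: le_trans (hg N).
  apply/ltW/(lt_le_trans (truncnS_gt _)); by rewrite ler_nat.
have : beta * fine (M_phi lam phi N) <= beta * Mc by rewrite ler_pM2l.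
have : gamma * (2 * (qc + delta) + beta * Mc / gamma) <= gamma * lam N by rewrite ler_pM2l.
rewrite mulrDr [gamma * (_ / gamma)]mulrC divfK ?gt_eqF//.
lra.
Qed.

End feasibility.

Theorem theorem1 (R : realType) (theta1 theta2 : R) (p qt q : R -> R) (qc : R)
    (lam : nat -> R) (phi : nat -> R -> R)
    (delta : R) (N0 : nat) (K : 'rV[R]_N0) (L : 'cV[R]_N0) :
  0 < theta1 <= pi / 2 ->
  0 <= theta2 <= pi / 2 ->
  C2_01 p ->
  (forall x, 0 <= x <= 1 -> 0 < p x) ->
  {within `[0, 1], continuous qt} ->
  {within `[0, 1], continuous q} ->
  (forall x, 0 <= x <= 1 -> qt x = q x - qc) ->
  (forall x, 0 <= x <= 1 -> 0 < q x) ->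
  sl_spectrum theta1 theta2 p q lam phi ->
  0 < delta ->
  (1 <= N0)%N ->
  (forall n, (N0 <= n)%N -> - lam n + qc < - delta) ->
  spectral_abscissa_lt
    (A0 qc lam N0 + B0 theta2 p qt qc lam phi N0 *m K) (- delta) ->
  spectral_abscissa_lt (A0 qc lam N0 - L *m C0 phi N0) (- delta) ->
  [/\ forall N, (M_phi lam phi N < +oo)%E,
      forall N, (N0.+1 <= N)%N ->
        forall (P : 'M[R]_(dimX N0 N)) (alpha beta gamma : R),
        LMI theta2 p qt qc lam phi K L delta P alpha beta gamma ->
        exists2 M : R, 0 < M &
          forall (z0 : R -> R) (zh0 : nat -> R),
          H2_bc theta1 theta2 (\sum_(k < N0) K 0 k * zh0 k) z0 ->
          forall (zh : nat -> R -> R) (z : R -> R -> R),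
          closed_loop_trajectory theta1 theta2 p qt q qc lam phi N K L zh z
            z0 zh0 ->
          forall t, 0 <= t ->
            H1norm (z t) ^+ 2 + \sum_(n < N) zh n t ^+ 2 <=
            M * expR (- 2 * delta * t) *
            (H1norm z0 ^+ 2 + \sum_(n < N) zh0 n ^+ 2) &
      exists Nmin : nat, forall N, (N0.+1 <= N)%N -> (Nmin <= N)%N ->
        exists (P : 'M[R]_(dimX N0 N)) (alpha beta gamma : R),
        LMI theta2 p qt qc lam phi K L delta P alpha beta gamma].
Proof.
move=> th1 th2 [p' [p2 [C1p _]]] p0 cqt cq qtE q0 spec delta0 N00 gap hA hC.
split.
- exact: (M_phi_lty th1 th2 C1p p0 cq q0 spec).
- move=> N N0N P alpha beta gamma lmi.
  have [M M0 hM] := exponential_stability th1 th2 C1p p0 cq cqt qtE q0 spec (ltnW N0N) lmi.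
  exists M => // z0 zh0 [f1 [f2 [dz0 _ _ _]]] zh z [z0E zh0E plant ctrl [zreg wreg]] t t0.
  have dz : weak_deriv (z 0) f1 by apply: eq_weak_deriv dz0 => // x xI; rewrite z0E.
  have -> : H1norm z0 ^+ 2 = H1norm (z 0) ^+ 2.
    rewrite (sqr_H1norm dz0) (sqr_H1norm dz); congr (_ + _).
    by apply: eq_inner => x xI; rewrite z0E.
  have -> : \sum_(n < N) zh0 n ^+ 2 = \sum_(n < N) zh n 0 ^+ 2.
    by apply: eq_bigr => n _; rewrite zh0E.
  exact: hM.
- pose eta := lam N0 - qc - delta.
  have eta0 : 0 < eta by have := gap N0 (leqnn N0); rewrite /eta; lra.
  have gap' n : (N0 <= n)%N -> - lam n + qc <= - delta - eta.
    by move=> /(lam_le spec); rewrite /eta; lra.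
  have [Nmin hN] := LMI_feasible th1 th2 C1p p0 cq cqt q0 spec eta0 gap' hA hC.
  by exists Nmin => N _; exact: hN.
Qed.
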